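(* Let $R$ be a commutative ring with identity, and let $Q$ be as in the context (linear, symplectic or orthogonal case). Let $\alpha(X)\in \mathrm{G}(Q[X])$ with $\alpha(0)=\mathrm{Id}_Q$. If $\alpha_{\mathfrak m}(X)\in \mathrm{ET}(Q_{\mathfrak m}[X])$ for every maximal ideal $\mathfrak m$ of $R$, then $\alpha(X)\in \mathrm{ET}(Q[X])$.
   Context: Three cases are treated in parallel, over any commutative ring $R$ with identity. Linear case: $P$ is a finitely generated projective $R$-module, $Q=P\oplus R$, and $Q$ has constant rank $\ge 3$. $\mathrm{G}(Q)=\mathrm{Aut}_R(Q)$. The elementary transvections of $Q$ are the automorphisms $(p,a)\mapsto (p+ax,a)$ and $(p,a)\mapsto (p,a+\psi(p))$ with $x\in P$, $\psi\in P^*=\mathrm{Hom}_R(P,R)$. Symplectic case: $2$ is invertible in $R$; $P$ is a finitely generated projective $R$-module with a nonsingular (i.e. $p\mapsto\langle p,\cdot\rangle$ is an isomorphism $P\to P^*$) alternating bilinear form $\langle\,,\rangle$; $Q=P\perp R^2$ with form $\langle (p,b,a),(p',b',a')\rangle=\langle p,p'\rangle+ba'-ab'$. $\mathrm{G}(Q)=\mathrm{Sp}(Q)$ is the group of isometries of $Q$. The elementary transvections of $Q$ are the isometries $(p,b,a)\mapsto(p+aq,\,b-\langle p,q\rangle+a,\,a)$ and $(p,b,a)\mapsto(p+bq,\,b,\,a+\langle p,q\rangle-b)$ with $q\in P$. Orthogonal case: $2$ is invertible in $R$; $P$ is a finitely generated projective $R$-module with a nonsingular symmetric bilinear form $\langle\,,\rangle$;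 $Q=P\perp R^2$ with form $\langle (p,b,a),(p',b',a')\rangle=\langle p,p'\rangle+ba'+ab'$. $\mathrm{G}(Q)=\mathrm{O}(Q)$ is the group of isometries of $Q$. The elementary transvections of $Q$ are the isometries $(p,b,a)\mapsto(p-aq,\,b+\langle p,q\rangle,\,a)$ and $(p,b,a)\mapsto(p-bq,\,b,\,a+\langle p,q\rangle)$ with $q\in P$ isotropic ($\langle q,q\rangle=0$). In the symplectic and orthogonal cases it is assumed that there is a fixed integer $m\ge 3$ such that, for every maximal ideal $\mathfrak m$ of $R$, $Q_{\mathfrak m}$ is isometric to the hyperbolic module $\mathbb H(R_{\mathfrak m}^m)=R_{\mathfrak m}^m\oplus (R_{\mathfrak m}^m)^*$ with form $\langle(x,f),(x',f')\rangle=f(x')-f'(x)$ (symplectic) or $f(x')+f'(x)$ (orthogonal). $\mathrm{ET}(Q)\le \mathrm{G}(Q)$ is the subgroup generated by the elementary transvections. $Q[X]=R[X]\otimes_R Q$ with the extended form; it equals $P[X]\oplus R[X]$ (resp. $P[X]\perp R[X]^2$), and $\mathrm{G}$, $\mathrm{ET}$ of it are taken over $R[X]$ with respect to this decomposition; similarly for $Q_{\mathfrak m}[X]$ over $R_{\mathfrak m}[X]$. $\alpha_{\mathfrak m}(X)$ is the image of $\alpha(X)$ in $\mathrm{G}(Q_{\mathfrak m}[X])$, and $\alpha(0)$ is the specialization at $X=0$. *)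

(* Defs.v *)
From HB Require Import structures.
From mathcomp Require Import all_boot all_order all_algebra.
From mathcomp Require Import ring.
From mathcomp Require Import boolp.

Set Implicit Arguments.
Unset Strict Implicit.
Unset Printing Implicit Defensive.

Import GRing.Theory.

Local Open Scope ring_scope.
Local Open Scope quotient_scope.

Section Ideals.
Variable R : comNzRingType.

(* [idealr_closed] already includes properness, [1 \notin M]. *)
Definition maximal_ideal (M : {pred R}) : Prop :=
  idealr_closed M /\
  forall J : {pred R}, idealr_closed J -> {subset M <= J} -> {subset J <= M}.

Lemma maximal_prime (M : {pred R}) : maximal_ideal M -> prime_idealr_closed M.
Proof.
move=> [[M0 M1 MP] Mmax] u v uvM; case: (boolP (u \in M)) => //= uM.
apply: contraNT uM => vM.
have MD a b : a \in M -> b \in M -> a + b \in M.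
  by move=> aM bM; have := MP 1 a b aM bM; rewrite mul1r.
have Mm c a : a \in M -> c * a \in M.
  by move=> aM; have := MP c a 0 aM M0; rewrite addr0.
pose J : {pred R} := fun x => `[< exists r : R, x - r * u \in M >].
have JE x : (x \in J) = `[< exists r : R, x - r * u \in M >] by [].
have MJ : {subset M <= J}.
  by move=> x xM; rewrite JE; apply/asboolP; exists 0; rewrite // mul0r subr0.
have uJ : u \in J.
  by rewrite JE; apply/asboolP; exists 1; rewrite // mul1r subrr.
apply: (Mmax J) => //; split; first exact: MJ.
  rewrite JE; apply/asboolP => -[r rM].
  move/negP: vM; apply.
  have -> : v = v * (1 - r * u) + r * (u * v) by ring.
  by apply: MD; apply: Mm.
move=> a x y; rewrite !JE => /asboolP[r rM] /asboolP[s sM].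
apply/asboolP; exists (a * r + s) => //.
have -> : a * x + y - (a * r + s) * u = a * (x - r * u) + (y - s * u) by ring.
exact: MP.
Qed.

Definition prime_of_maximal (M : {pred R}) (hM : maximal_ideal M) :
    prime_idealr R :=
  HB.pack_for (prime_idealr R) (M : R -> bool)
    (isIdealr.Build R M hM.1)
    (isPrimeIdealrClosed.Build R M (maximal_prime hM)).

End Ideals.

Module Localization.
Section Localization.
Variables (R : comNzRingType) (p : prime_idealr R).

Record den := Den { dval : R; _ : dval \notin (p : {pred R}) }.
#[export] HB.instance Definition _ := [isSub for dval].
#[export] HB.instance Definition _ := [Choice of den by <:].

Local Notation frac := (R * den)%type.
Implicit Types (x y : frac) (s t : den).

Lemma den1_subproof : (1 : R) \notin (p : {pred R}).
Proof. by rewrite idealr1. Qed.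
Definition den1 : den := Den den1_subproof.

Lemma denM_subproof s t : dval s * dval t \notin (p : {pred R}).
Proof. by rewrite prime_idealrM negb_or (valP s) (valP t). Qed.
Definition denM s t : den := Den (denM_subproof s t).

Definition equiv x y : bool :=
  `[< exists u : den, dval u * (x.1 * dval y.2) = dval u * (y.1 * dval x.2) >].

Lemma equiv_refl : reflexive equiv.
Proof. by move=> x; apply/asboolP; exists den1. Qed.

Lemma equiv_sym : symmetric equiv.
Proof. by move=> x y; apply/asboolP/asboolP => -[u e]; exists u. Qed.

Lemma equiv_trans : transitive equiv.
Proof.
move=> [b t] [a s] [c w] /asboolP[u /= e1] /asboolP[v /= e2].
apply/asboolP; exists (denM (denM u v) t) => /=.
transitivity (dval v * dval w * (dval u * (a * dval t))); first by ring.
rewrite e1.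
transitivity (dval u * dval s * (dval v * (b * dval w))); first by ring.
by rewrite e2; ring.
Qed.

Canonical equiv_equiv := EquivRel equiv equiv_refl equiv_sym equiv_trans.

(* The local ring R_p = (R \ p)^-1 R. *)
Definition type := {eq_quot equiv}.
#[export] HB.instance Definition _ : EqQuotient _ equiv type := EqQuotient.on type.
#[export] HB.instance Definition _ := Choice.on type.

Definition mk (a : R) (s : den) : type := \pi_type (a, s).

Lemma mk_eqP a s b t :
  mk a s = mk b t <-> exists u : den, dval u * (a * dval t) = dval u * (b * dval s).
Proof.
split; first by move=> /eqmodP /asboolP.
by move=> h; apply/eqmodP/asboolP.
Qed.

Lemma mk_ind (Q : type -> Prop) : (forall a s, Q (mk a s)) -> forall x : type, Q x.
Proof. by move=> h; elim/quotW=> -[a s]; apply: h. Qed.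

Definition add (x y : type) : type :=
  let: (a, s) := repr x in let: (b, t) := repr y in
  mk (a * dval t + b * dval s) (denM s t).
Definition opp (x : type) : type := let: (a, s) := repr x in mk (- a) s.
Definition mul (x y : type) : type :=
  let: (a, s) := repr x in let: (b, t) := repr y in mk (a * b) (denM s t).

Lemma repr_mk a s :
  exists u : den, dval u * ((repr (mk a s)).1 * dval s) =
                  dval u * (a * dval (repr (mk a s)).2).
Proof.
case E: (repr (mk a s)) => [b t] /=.
by apply/mk_eqP; rewrite /mk -E reprK.
Qed.

Lemma addE a s b t :
  add (mk a s) (mk b t) = mk (a * dval t + b * dval s) (denM s t).
Proof.
rewrite /add; case: (repr _) (repr_mk a s) => a' s' /= [u eu].
case: (repr _) (repr_mk b t) => b' t' /= [v ev].
apply/mk_eqP; exists (denM u v) => /=.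
transitivity (dval v * dval t * dval t' * (dval u * (a' * dval s))
  + dval u * dval s * dval s' * (dval v * (b' * dval t))); first by ring.
by rewrite eu ev; ring.
Qed.

Lemma oppE a s : opp (mk a s) = mk (- a) s.
Proof.
rewrite /opp; case: (repr _) (repr_mk a s) => a' s' /= [u eu].
by apply/mk_eqP; exists u; rewrite !mulNr !mulrN eu.
Qed.

Lemma mulE a s b t : mul (mk a s) (mk b t) = mk (a * b) (denM s t).
Proof.
rewrite /mul; case: (repr _) (repr_mk a s) => a' s' /= [u eu].
case: (repr _) (repr_mk b t) => b' t' /= [v ev].
apply/mk_eqP; exists (denM u v) => /=.
transitivity ((dval u * (a' * dval s)) * (dval v * (b' * dval t))); first by ring.
by rewrite eu ev; ring.
Qed.

Lemma addA : associative add.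
Proof.
elim/mk_ind=> a s; elim/mk_ind=> b t; elim/mk_ind=> c w; rewrite !addE.
by apply/mk_eqP; exists den1 => /=; ring.
Qed.

Lemma addC : commutative add.
Proof.
elim/mk_ind=> a s; elim/mk_ind=> b t; rewrite !addE.
by apply/mk_eqP; exists den1 => /=; ring.
Qed.

Lemma add0 : left_id (mk 0 den1) add.
Proof.
by elim/mk_ind=> a s; rewrite addE; apply/mk_eqP; exists den1 => /=; ring.
Qed.

Lemma addN : left_inverse (mk 0 den1) opp add.
Proof.
elim/mk_ind=> a s; rewrite oppE addE.
by apply/mk_eqP; exists den1 => /=; ring.
Qed.

#[export] HB.instance Definition _ := GRing.isZmodule.Build type addA addC add0 addN.

Lemma mulA : associative mul.
Proof.
elim/mk_ind=> a s; elim/mk_ind=> b t; elim/mk_ind=> c w; rewrite !mulE.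
by apply/mk_eqP; exists den1 => /=; ring.
Qed.

Lemma mulC : commutative mul.
Proof.
elim/mk_ind=> a s; elim/mk_ind=> b t; rewrite !mulE.
by apply/mk_eqP; exists den1 => /=; ring.
Qed.

Lemma mul1 : left_id (mk 1 den1) mul.
Proof.
by elim/mk_ind=> a s; rewrite mulE; apply/mk_eqP; exists den1 => /=; ring.
Qed.

Lemma mulD : left_distributive mul add.
Proof.
elim/mk_ind=> a s; elim/mk_ind=> b t; elim/mk_ind=> c w.
rewrite !addE !mulE addE.
by apply/mk_eqP; exists den1 => /=; ring.
Qed.

Lemma one_neq0 : mk 1 den1 != 0.
Proof.
apply/eqP => /mk_eqP [u] /=; rewrite mul0r mulr0 !mulr1 => u0.
by have := valP u; rewrite /= u0 idealr0.
Qed.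

#[export] HB.instance Definition _ :=
  GRing.Zmodule_isComNzRing.Build type mulA mulC mul1 mulD one_neq0.

Definition tofrac (r : R) : type := mk r den1.

Lemma tofrac_is_zmod_morphism : zmod_morphism tofrac.
Proof.
move=> a b; rewrite -[RHS]/(add _ (opp _)) oppE addE.
by apply/mk_eqP; exists den1 => /=; ring.
Qed.
#[export] HB.instance Definition _ :=
  GRing.isZmodMorphism.Build R type tofrac tofrac_is_zmod_morphism.

Lemma tofrac_is_monoid_morphism : monoid_morphism tofrac.
Proof.
split=> // a b; rewrite -[RHS]/(mul _ _) mulE.
by apply/mk_eqP; exists den1 => /=; ring.
Qed.
#[export] HB.instance Definition _ :=
  GRing.isMonoidMorphism.Build R type tofrac tofrac_is_monoid_morphism.

End Localization.
Module Exports. HB.reexport. End Exports.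
End Localization.
Export Localization.Exports.

Notation localization := Localization.type.
(* The canonical map R -> R_p. *)
Definition loc (R : comNzRingType) (p : prime_idealr R) :
  {rmorphism R -> localization p} := @Localization.tofrac R p.

Module BaseChange.
Section BaseChange.
Variables (R S : comNzRingType) (f : {rmorphism R -> S}) (M : lmodType R).

(* A sequence of pairs (s, x) stands for the formal sum of the s ⊗ x. *)
Local Notation formal := (seq (S * M)).

Inductive rel : formal -> formal -> Prop :=
| rel_refl u : rel u u
| rel_sym u v : rel u v -> rel v u
| rel_trans u v w : rel u v -> rel v w -> rel u w
| rel_cat u u' v v' : rel u u' -> rel v v' -> rel (u ++ v) (u' ++ v')
| rel_catC u v : rel (u ++ v) (v ++ u)
| rel_0l x : rel [:: (0, x)] [::]
| rel_Dl s t x : rel [:: (s + t, x)] [:: (s, x); (t, x)]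
| rel_Dr s x y : rel [:: (s, x + y)] [:: (s, x); (s, y)]
| rel_scale s r x : rel [:: (s * f r, x)] [:: (s, r *: x)].

Definition equiv (u v : formal) : bool := `[< rel u v >].

Lemma equiv_refl : reflexive equiv.
Proof. by move=> u; apply/asboolP; apply: rel_refl. Qed.
Lemma equiv_sym : symmetric equiv.
Proof. by move=> u v; apply/asboolP/asboolP; apply: rel_sym. Qed.
Lemma equiv_trans : transitive equiv.
Proof.
by move=> v u w /asboolP uv /asboolP vw; apply/asboolP; apply: rel_trans vw.
Qed.
Canonical equiv_equiv := EquivRel equiv equiv_refl equiv_sym equiv_trans.

(* The S-module S ⊗_R M, where S is an R-algebra through f. *)
Definition type := {eq_quot equiv}.
#[export] HB.instance Definition _ : EqQuotient _ equiv type := EqQuotient.on type.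
#[export] HB.instance Definition _ := Choice.on type.

Definition cls (u : formal) : type := \pi_type u.

Lemma clsP u v : rel u v <-> cls u = cls v.
Proof.
split=> [h|]; first by apply/eqmodP/asboolP.
by move=> /eqmodP/asboolP.
Qed.

Lemma cls_ind (Q : type -> Prop) : (forall u, Q (cls u)) -> forall x, Q x.
Proof. by move=> h; elim/quotW=> u; apply: h. Qed.

Lemma rel_repr u : rel (repr (cls u)) u.
Proof. by apply/clsP; rewrite /cls reprK. Qed.

Definition add (x y : type) : type := cls (repr x ++ repr y).
Definition smul (c : S) (u : formal) : formal :=
  [seq (c * z.1, z.2) | z <- u].
Definition scale (c : S) (x : type) : type := cls (smul c (repr x)).
Definition opp (x : type) : type := scale (-1) x.

Lemma rel_smul c u v : rel u v -> rel (smul c u) (smul c v).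
Proof.
elim=> {u v}.
- by move=> u; apply: rel_refl.
- by move=> u v _; apply: rel_sym.
- by move=> u v w _ h _; apply: rel_trans.
- by move=> u u' v v' _ h _ h'; rewrite /smul !map_cat; apply: rel_cat.
- by move=> u v; rewrite /smul !map_cat; apply: rel_catC.
- by move=> x; rewrite /= mulr0; apply: rel_0l.
- by move=> s t x; rewrite /= mulrDr; apply: rel_Dl.
- by move=> s x y; apply: rel_Dr.
- by move=> s r x; rewrite /= mulrA; apply: rel_scale.
Qed.

Lemma addE u v : add (cls u) (cls v) = cls (u ++ v).
Proof. by apply/clsP; apply: rel_cat; apply: rel_repr. Qed.

Lemma scaleE c u : scale c (cls u) = cls (smul c u).
Proof. by apply/clsP; apply: rel_smul; apply: rel_repr. Qed.

Lemma addA : associative add.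
Proof.
by elim/cls_ind=> u; elim/cls_ind=> v; elim/cls_ind=> w; rewrite !addE catA.
Qed.

Lemma addC : commutative add.
Proof.
elim/cls_ind=> u; elim/cls_ind=> v; rewrite !addE.
by apply/clsP; apply: rel_catC.
Qed.

Lemma add0 : left_id (cls [::]) add.
Proof. by elim/cls_ind=> u; rewrite addE. Qed.

Lemma scaleDl_subproof u a b :
  cls (smul (a + b) u) = cls (smul a u ++ smul b u).
Proof.
elim: u => [//|[s x] u IH].
transitivity (add (add (cls [:: (a * s, x)]) (cls [:: (b * s, x)]))
                  (add (cls (smul a u)) (cls (smul b u)))).
  rewrite -[smul (a + b) _]/([:: ((a + b) * s, x)] ++ smul (a + b) u).
  rewrite -addE IH -addE; congr (add _ _); rewrite addE.
  by apply/clsP; rewrite mulrDl; apply: rel_Dl.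
rewrite -addE -[smul a (_ :: _)]/([:: (a * s, x)] ++ smul a u).
rewrite -[smul b (_ :: _)]/([:: (b * s, x)] ++ smul b u) -!addE.
rewrite -!addA; congr (add _ _); rewrite !addA; congr (add _ _).
exact: addC.
Qed.

Lemma scale0_subproof u : cls (smul 0 u) = cls [::].
Proof.
elim: u => [//|[s x] u IH]; rewrite /= -cat1s -addE IH addC add0.
by apply/clsP; rewrite mul0r; apply: rel_0l.
Qed.

Lemma scale1 : left_id 1 scale.
Proof.
elim/cls_ind=> u; rewrite scaleE; congr cls.
by elim: u => [//|[s x] u /= ->]; rewrite mul1r.
Qed.

Lemma addN : left_inverse (cls [::]) opp add.
Proof.
elim/cls_ind=> u; rewrite /opp scaleE.
rewrite -[X in add _ X]scale1 scaleE addE -scaleDl_subproof addNr.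
exact: scale0_subproof.
Qed.

#[export] HB.instance Definition _ := GRing.isZmodule.Build type addA addC add0 addN.

Lemma scaleA a b x : scale a (scale b x) = scale (a * b) x.
Proof.
elim/cls_ind: x => u; rewrite !scaleE /smul -map_comp; congr cls.
by apply: eq_map => z /=; rewrite mulrA.
Qed.

Lemma scaleDr : right_distributive scale +%R.
Proof.
move=> c; elim/cls_ind=> u; elim/cls_ind=> v.
by rewrite -[_ + _]/(add _ _) addE !scaleE /smul map_cat -addE.
Qed.

Lemma scaleDl x : {morph scale^~ x : a b / a + b}.
Proof.
by elim/cls_ind: x => u a b /=; rewrite !scaleE scaleDl_subproof -addE.
Qed.

#[export] HB.instance Definition _ :=
  GRing.Zmodule_isLmodule.Build S type scaleA scale1 scaleDr scaleDl.

Definition pure (s : S) (x : M) : type := cls [:: (s, x)].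

Lemma pureDl x : {morph pure^~ x : s t / s + t}.
Proof. by move=> s t; rewrite [RHS]addE; apply/clsP; apply: rel_Dl. Qed.

Lemma pureDr s : {morph pure s : x y / x + y}.
Proof. by move=> x y; rewrite [RHS]addE; apply/clsP; apply: rel_Dr. Qed.

Lemma pure_scale s r x : pure (s * f r) x = pure s (r *: x).
Proof. by apply/clsP; apply: rel_scale. Qed.

Lemma scale_pure c s x : c *: pure s x = pure (c * s) x.
Proof. exact: scaleE. Qed.

Lemma pure_ind (Q : type -> Prop) :
  Q 0 -> (forall s x, Q (pure s x)) ->
  (forall u v, Q u -> Q v -> Q (u + v)) -> forall u, Q u.
Proof.
move=> Q0 Qp QD; elim/cls_ind=> u; elim: u => [|[s x] u IH]; first exact: Q0.
rewrite -[cls _]/(cls ([:: (s, x)] ++ u)) -addE.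
by apply: QD => //; apply: Qp.
Qed.

(* The additive map on S ⊗_R M sending s ⊗ x to g s x; it is meaningful only
   for balanced g, see [lift_pure]. *)
Definition lift (A : zmodType) (g : S -> M -> A) (x : type) : A :=
  \sum_(z <- repr x) g z.1 z.2.

Definition balanced (A : zmodType) (g : S -> M -> A) : Prop :=
  [/\ forall x, {morph g^~ x : s t / s + t},
      forall s, {morph g s : x y / x + y}
    & forall s r x, g (s * f r) x = g s (r *: x)].

Section Lift.
Variables (A : zmodType) (g : S -> M -> A).
Hypothesis bg : balanced g.

Lemma lift_rel u v :
  rel u v -> \sum_(z <- u) g z.1 z.2 = \sum_(z <- v) g z.1 z.2.
Proof.
case: bg => gDl gDr gZ; elim=> {u v}.
- by [].
- by move=> u v _ ->.
- by move=> u v w _ -> _ ->.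
- by move=> u u' v v' _ e _ e'; rewrite !big_cat /= e e'.
- by move=> u v; rewrite !big_cat /= addrC.
- move=> x; rewrite big_seq1 big_nil /=.
  by apply: (addrI (g 0 x)); rewrite -gDl !addr0.
- by move=> s t x; rewrite big_seq1 big_cons big_seq1 gDl.
- by move=> s x y; rewrite big_seq1 big_cons big_seq1 gDr.
- by move=> s r x; rewrite !big_seq1 gZ.
Qed.

Lemma lift_cls u : lift g (cls u) = \sum_(z <- u) g z.1 z.2.
Proof. by apply: lift_rel; apply: rel_repr. Qed.

Lemma lift_pure s x : lift g (pure s x) = g s x.
Proof. by rewrite lift_cls big_seq1. Qed.

Lemma liftD : {morph lift g : x y / x + y}.
Proof.
elim/cls_ind=> u; elim/cls_ind=> v.
by rewrite -[_ + _]/(add _ _) addE !lift_cls big_cat.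
Qed.

End Lift.
End BaseChange.
Module Exports. HB.reexport. End Exports.
End BaseChange.
Export BaseChange.Exports.

Notation basechange := BaseChange.type.

Section Modules.
Variable R : comNzRingType.

Definition finitely_generated (M : lmodType R) : Prop :=
  exists (n : nat) (g : 'I_n -> M),
    forall x : M, exists c : 'I_n -> R, x = \sum_(i < n) c i *: g i.

Definition projective (M : lmodType R) : Prop :=
  forall (N N' : lmodType R) (e : {linear N -> N'}) (g : {linear M -> N'}),
    (forall y, exists x, e x = y) ->
    exists h : {linear M -> N}, forall x, e (h x) = g x.

Definition constant_rank (n : nat) (M : lmodType R) : Prop :=
  forall p : prime_idealr R,
    exists phi : {linear basechange (loc p) M -> 'rV[localization p]_n},
      bijective phi.

Definition nonsingular (M : lmodType R) (b : M -> M -> R) : Prop :=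
  forall psi : {scalar M}, exists! x, forall y, psi y = b x y.

Definition is_isometry (M N : lmodType R) (bM : M -> M -> R) (bN : N -> N -> R)
    (h : M -> N) : Prop :=
  bijective h /\ forall x y, bN (h x) (h y) = bM x y.

Definition isometric (M N : lmodType R) (bM : M -> M -> R)
    (bN : N -> N -> R) : Prop :=
  exists h : {linear M -> N}, is_isometry bM bN h.

Definition invertible2 : Prop := exists c : R, 2%:R * c = 1.

End Modules.

(* <s ⊗ x, t ⊗ y> = s t f(<x, y>) *)
Definition basechange_form (R S : comNzRingType) (f : {rmorphism R -> S})
    (M : lmodType R) (b : M -> M -> R) (u v : basechange f M) : S :=
  BaseChange.lift (fun s x =>
    BaseChange.lift (fun t y => s * t * f (b x y)) v) u.

Lemma basechange_form_pure (R S : comNzRingType) (f : {rmorphism R -> S})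
    (M : lmodType R) (b : {biscalar M}) s x t y :
  @basechange_form R S f M b (BaseChange.pure f s x) (BaseChange.pure f t y)
  = s * t * f (b x y).
Proof.
have bal s' x' : BaseChange.balanced f (fun t y => s' * t * f (b x' y)).
  split=> [y' t1 t2|t' y1 y2|t' r y'] /=; first by rewrite mulrDr mulrDl.
    by rewrite linearDr rmorphD mulrDr.
  by rewrite linearZr /= rmorphM !mulrA.
rewrite /basechange_form BaseChange.lift_pure ?BaseChange.lift_pure //.
split=> [x' s1 s2|s' x1 x2|s' r x'] /=; rewrite !BaseChange.lift_pure //.
- by rewrite !mulrDl.
- by rewrite linearDl rmorphD mulrDr.
- by rewrite linearZl /= rmorphM; ring.
Qed.

Section Extension.
Variable R : comNzRingType.

(* M[X] = R[X] ⊗_R M *)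
Definition polymod (M : lmodType R) : lmodType {poly R} :=
  basechange (@polyC R) M.

Definition polymod_form (M : lmodType R) (b : M -> M -> R) :
    polymod M -> polymod M -> {poly R} :=
  @basechange_form R {poly R} (@polyC R) M b.

(* M_p = R_p ⊗_R M *)
Definition locmod (p : prime_idealr R) (M : lmodType R) :
  lmodType (localization p) := basechange (loc p) M.

Definition locmod_form (p : prime_idealr R) (M : lmodType R)
    (b : M -> M -> R) : locmod p M -> locmod p M -> localization p :=
  @basechange_form R (localization p) (loc p) M b.

End Extension.

Section ExtensionMaps.
Variable R : comNzRingType.

(* The maps M -> M[X], x |-> 1 ⊗ x, and M[X] -> M, a ⊗ x |-> a(0) x. *)
Definition polymod_cst (M : lmodType R) (x : M) : polymod M :=
  BaseChange.pure (@polyC R) 1 x.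
Definition polymod_at0 (M : lmodType R) (u : polymod M) : M :=
  BaseChange.lift (fun (a : {poly R}) (x : M) => a.[0] *: x) u.

(* The maps R[X] -> R_p[X] and M[X] -> M_p[X], a ⊗ x |-> a_p ⊗ (1 ⊗ x). *)
Definition poly_loc (p : prime_idealr R) (a : {poly R}) :
  {poly localization p} := map_poly (loc p) a.
Definition polymod_loc (p : prime_idealr R) (M : lmodType R) (u : polymod M) :
    polymod (locmod p M) :=
  BaseChange.lift (fun (a : {poly R}) (x : M) =>
    BaseChange.pure (@polyC (localization p)) (poly_loc p a)
      (BaseChange.pure (loc p) 1 x)) u.

Lemma polymod_at0_pure (M : lmodType R) (a : {poly R}) (x : M) :
  polymod_at0 (BaseChange.pure (@polyC R) a x) = a.[0] *: x.
Proof.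
rewrite /polymod_at0 BaseChange.lift_pure //.
split=> [y s t|s y z|s r y]; first by rewrite hornerD scalerDl.
  exact: scalerDr.
by rewrite hornerM hornerC scalerA.
Qed.

Lemma polymod_loc_pure (p : prime_idealr R) (M : lmodType R) (a : {poly R})
    (x : M) :
  polymod_loc p (BaseChange.pure (@polyC R) a x) =
  BaseChange.pure (@polyC (localization p)) (poly_loc p a)
    (BaseChange.pure (loc p) 1 x).
Proof.
rewrite /polymod_loc BaseChange.lift_pure // /poly_loc.
split=> [y s t|s y z|s r y]; first by rewrite rmorphD BaseChange.pureDl.
  by rewrite BaseChange.pureDr BaseChange.pureDr.
rewrite rmorphM /= map_polyC BaseChange.pure_scale BaseChange.scale_pure.
by rewrite mulr1 -BaseChange.pure_scale mul1r.
Qed.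

End ExtensionMaps.

(* The subgroup generated by T in the group of bijections of Q. *)
Inductive subgroup_gen (Q : Type) (T : (Q -> Q) -> Prop) : (Q -> Q) -> Prop :=
| subgroup_gen_in f : T f -> subgroup_gen T f
| subgroup_gen_id : subgroup_gen T id
| subgroup_gen_comp f g :
    subgroup_gen T f -> subgroup_gen T g -> subgroup_gen T (f \o g)
| subgroup_gen_inv f g :
    subgroup_gen T f -> cancel f g -> cancel g f -> subgroup_gen T g.

(* Q = P ⊕ R, with elements (p, a). *)
Definition linQ (R : comNzRingType) (P : lmodType R) : lmodType R :=
  (P * R^o)%type.

(* The module P ⊕ R^2, with elements (p, (b, a)). *)
Definition hypQ (R : comNzRingType) (P : lmodType R) : lmodType R :=
  (P * (R^o * R^o))%type.

Section Transvections.
Variables (R : comNzRingType) (P : lmodType R).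

Variant lin_transvection : (linQ P -> linQ P) -> Prop :=
| LinTransvectionP (x : P) :
    lin_transvection (fun u => (u.1 + (u.2 : R) *: x, u.2))
| LinTransvectionR (psi : {scalar P}) :
    lin_transvection (fun u => (u.1, u.2 + psi u.1)).

Definition ET_lin : (linQ P -> linQ P) -> Prop := subgroup_gen lin_transvection.

Variable form : P -> P -> R.

Definition sp_form (u v : hypQ P) : R :=
  let: (p, (b, a)) := u in let: (p', (b', a')) := v in
  form p p' + b * a' - a * b'.

Definition orth_form (u v : hypQ P) : R :=
  let: (p, (b, a)) := u in let: (p', (b', a')) := v in
  form p p' + b * a' + a * b'.

Variant sp_transvection : (hypQ P -> hypQ P) -> Prop :=
| SpTransvection1 (q : P) :
    sp_transvection (fun u => let: (p, (b, a)) := u in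
      (p + (a : R) *: q, (b - form p q + a, a)))
| SpTransvection2 (q : P) :
    sp_transvection (fun u => let: (p, (b, a)) := u in
      (p + (b : R) *: q, (b, a + form p q - b))).

Variant orth_transvection : (hypQ P -> hypQ P) -> Prop :=
| OrthTransvection1 (q : P) (_ : form q q = 0) :
    orth_transvection (fun u => let: (p, (b, a)) := u in
      (p - (a : R) *: q, (b + form p q, a)))
| OrthTransvection2 (q : P) (_ : form q q = 0) :
    orth_transvection (fun u => let: (p, (b, a)) := u in
      (p - (b : R) *: q, (b, a + form p q))).

Definition ET_sp : (hypQ P -> hypQ P) -> Prop := subgroup_gen sp_transvection.
Definition ET_orth : (hypQ P -> hypQ P) -> Prop :=
  subgroup_gen orth_transvection.

End Transvections.

(* The hyperbolic module H(V) = V ⊕ V^*, with elements (x, f). *)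
Section Hyperbolic.
Variables (R : comNzRingType) (V : vectType R).

Definition hyperbolic : lmodType R := (V * 'Hom(V, R^o))%type.

Definition hyperbolic_sp (u v : hyperbolic) : R := u.2 v.1 - v.2 u.1.
Definition hyperbolic_orth (u v : hyperbolic) : R := u.2 v.1 + v.2 u.1.

End Hyperbolic.

Definition locally_hyperbolic_sp (R : comNzRingType) (n : nat) (Q : lmodType R)
    (form : Q -> Q -> R) : Prop :=
  forall (M : {pred R}) (hM : maximal_ideal M),
    isometric (locmod_form (p := prime_of_maximal hM) form)
      (@hyperbolic_sp _ 'rV[localization (prime_of_maximal hM)]_n).

Definition locally_hyperbolic_orth (R : comNzRingType) (n : nat)
    (Q : lmodType R) (form : Q -> Q -> R) : Prop :=
  forall (M : {pred R}) (hM : maximal_ideal M),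
    isometric (locmod_form (p := prime_of_maximal hM) form)
      (@hyperbolic_orth _ 'rV[localization (prime_of_maximal hM)]_n).

(* Below, Q[X] is P[X] ⊕ R[X] or P[X] ⊕ R[X]^2, and Q_p[X] is P_p[X] ⊕ R_p[X]
   or P_p[X] ⊕ R_p[X]^2. *)
Section Specialization.
Variables (R : comNzRingType) (P : lmodType R).

Definition linQ_cst (u : linQ P) : linQ (polymod P) :=
  (polymod_cst u.1, u.2%:P).
Definition linQ_at0 (u : linQ (polymod P)) : linQ P :=
  (polymod_at0 u.1, (u.2 : {poly R}).[0]).
Definition linQ_loc (p : prime_idealr R) (u : linQ (polymod P)) :
    linQ (polymod (locmod p P)) :=
  (polymod_loc p u.1, poly_loc p u.2).

Definition hypQ_cst (u : hypQ P) : hypQ (polymod P) :=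
  (polymod_cst u.1, (u.2.1%:P, u.2.2%:P)).
Definition hypQ_at0 (u : hypQ (polymod P)) : hypQ P :=
  (polymod_at0 u.1, ((u.2.1 : {poly R}).[0], (u.2.2 : {poly R}).[0])).
Definition hypQ_loc (p : prime_idealr R) (u : hypQ (polymod P)) :
    hypQ (polymod (locmod p P)) :=
  (polymod_loc p u.1, (poly_loc p u.2.1, poly_loc p u.2.2)).

(* alpha(0) : Q -> Q *)
Definition lin_at0 (alpha : linQ (polymod P) -> linQ (polymod P))
    (u : linQ P) : linQ P := linQ_at0 (alpha (linQ_cst u)).
Definition hyp_at0 (alpha : hypQ (polymod P) -> hypQ (polymod P))
    (u : hypQ P) : hypQ P := hypQ_at0 (alpha (hypQ_cst u)).

(* beta = alpha_p: since Q_p[X] is spanned over R_p[X] by the image of Q[X], at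
   most one linear map beta satisfies this relation. *)
Definition lin_localizes (p : prime_idealr R)
    (alpha : linQ (polymod P) -> linQ (polymod P))
    (beta : linQ (polymod (locmod p P)) -> linQ (polymod (locmod p P))) :=
  forall u, beta (linQ_loc p u) = linQ_loc p (alpha u).
Definition hyp_localizes (p : prime_idealr R)
    (alpha : hypQ (polymod P) -> hypQ (polymod P))
    (beta : hypQ (polymod (locmod p P)) -> hypQ (polymod (locmod p P))) :=
  forall u, beta (hypQ_loc p u) = hypQ_loc p (alpha u).

End Specialization.

(* Main.v *)
(** Coordinates with respect to a dual basis embed Q as the image of an idempotent matrix
    [et] over R, and turn automorphisms of Q[X] into matrices over R[X] equal to the
    identity on the complement. The symplectic and the orthogonal case are treated at
    once, for a form with [<y, x> = lam <x, y>], where [lam] is -1 or 1.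

    Quillen's argument: the elements [a] of R such that alpha(X + aY) alpha(X)^-1 is
    elementary over R[X, Y] form an ideal, and the theorem is the membership of 1 in it.
    It thus suffices to find such an [a] outside each maximal ideal [m]. There
    alpha_m(X + aY) alpha_m(X)^-1 is a product of conjugates g E(aY t) g^-1 of elementary
    generators, and one has to show that such a conjugate comes from an elementary matrix
    over R[X, Y] once [a] is divisible by some [s] outside [m]. The conjugate of a
    transvection along [e] by g is a transvection along the unimodular vector g e. The
    local hypothesis on Q provides a basis of Q_m containing the given vector [e] (in the
    unitary cases, by Witt exchange, a hyperbolic basis containing the given hyperbolic
    plane), and Suslin's trick decomposes a vector orthogonal to a unimodular vector [w]
    into Koszul vectors [w_j b_i - w_i b_j]; these lead, by commutator formulas using a
    third basis vector or plane, to generators in which the variable can be rescaled.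

    Back on Q, elementary matrices are products of the given transvections because, again
    by a local-global argument, the values of the form on P generate R in the symplectic
    case, and the isotropic vectors generate P in the orthogonal case. *)

Require Import Defs.
From HB Require Import structures.
From mathcomp Require Import all_boot all_order all_algebra.
From mathcomp Require Import ring boolp classical_sets.

Set Implicit Arguments.
Unset Strict Implicit.
Unset Printing Implicit Defensive.

Import GRing.Theory.

Local Open Scope ring_scope.

(** Two points shape the argument. First, R -> R_m need not be injective: an elementary matrix over
    R[X, Y] whose image over R_m[X, Y] is alpha(X + sY) alpha(X)^-1 still differs from it over
    R[X, Y]. Both are made to equal 1 at Y = 0, so the entries differ by Y times a torsion
    polynomial, and one more substitution Y |-> tY removes the difference. Second, denominators must
    be absorbed inside a noncommutative product. This is handled by families t |-> F(t) for which a
    single denominator s makes every F(st), with t in R[X, Y], the image of an elementary matrix.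
    Commutator formulas preserve this property because they are multiplicative in two independent
    parameters: one is frozen at a denominator, the other stays free.

    In the unitary cases the Koszul vector of b_i and b_j is isotropic unless b_i and b_j are
    hyperbolic partners. The partner vectors need a separate argument, which combines <w, w> = 0
    with the unimodularity of w. The constant 1/2 serves to define transvections along an isotropic
    w for vectors that are not isotropic themselves, so that a generating family of P suffices as
    index set for the generators. *)

(** * Maximal ideals and localization *)

Lemma one_in_ideal (R : comNzRingType) (J : R -> Prop) :
  J 0 -> (forall a x y, J x -> J y -> J (a * x + y)) ->
  (forall M : {pred R}, maximal_ideal M -> exists2 s, s \notin M & J s) -> J 1.
Proof.
move=> J0 JD Jloc; apply: contrapT => J1.
(* [idealr_closed] contains properness, so J itself is admissible because J 1 fails; a maximal
   admissible set is then a maximal ideal containing J. *)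
pose ok (M : R -> bool) := idealr_closed M /\ forall x, J x -> x \in M.
pose T := {M : R -> bool | ok M}.
pose le (M M' : T) : bool := `[< forall x, x \in sval M -> x \in sval M' >].
have okJ : ok (fun x => `[< J x >]).
  split; last by move=> x Jx; apply/asboolP.
  by split=> [||a x y /asboolP Jx /asboolP Jy]; [apply/asboolP| apply/asboolP|
     apply/asboolP; apply: JD].
have [] := @Zorn T le.
- by move=> M; apply/asboolP.
- move=> M1 M2 M3 /asboolP h1 /asboolP h2.
  by apply/asboolP => x /h1 /h2.
- move=> [M1 ok1] [M2 ok2] /asboolP /= h1 /asboolP /= h2.
  have e : M1 = M2.
    by apply/funext => x; apply/idP/idP; [apply: h1|apply: h2].
  by rewrite -e in ok2 *; rewrite (Prop_irrelevance ok1 ok2).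
- move=> A totA.
  (* The empty chain is bounded by J. *)
  have [[M0 AM0]|Anone] := pselect (exists M, A M); last first.
    by exists (exist _ _ okJ) => M AM; case: Anone; exists M.
  pose U : {pred R} := fun x => `[< exists2 M, A M & x \in sval M >].
  have UE x : (x \in U) = `[< exists2 M, A M & x \in sval M >] by [].
  have okU : ok U.
    split; first split.
    - rewrite UE; apply/asboolP; exists M0 => //.
      by have [[]] := svalP M0.
    - rewrite UE; apply/asboolP => -[M _].
      by apply/negP; have [[]] := svalP M.
    - move=> a x y; rewrite !UE => /asboolP[M1 A1 xM] /asboolP[M2 A2 yM].
      apply/asboolP.
      have [/asboolP h|/asboolP h] := totA _ _ A1 A2.
        by exists M2 => //; have [[_ _ hM] _] := svalP M2; apply: hM => //; apply: h.
      by exists M1 => //; have [[_ _ hM] _] := svalP M1; apply: hM => //; apply: h.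
    - move=> x Jx; rewrite UE; apply/asboolP; exists M0 => //.
      by have [_ h] := svalP M0; apply: h.
  exists (exist _ U okU) => M AM; apply/asboolP => x xM /=.
  by rewrite UE; apply/asboolP; exists M.
move=> [M Mid'] Mmax; have [Mid JM] := Mid'.
have maxM : maximal_ideal M.
  split=> // M' id' sub x.
  have ok' : ok M' by split=> // y /JM; apply: sub.
  have /(congr1 sval) /= e : exist ok M' ok' = exist ok M Mid'.
    by apply: Mmax; apply/asboolP.
  by rewrite -[x \in M']/(M' x) e.
by have [s /negP sM Js] := Jloc M maxM; apply: sM; apply: JM.
Qed.

Section LocalizationFacts.
Variables (R : comNzRingType) (p : prime_idealr R).
Local Notation Den := (@Localization.Den R p).

Lemma loc_mkE (a : R) s : loc p a = loc p (Localization.dval s) * Localization.mk a s.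
Proof.
rewrite -[RHS]/(Localization.mul _ _) Localization.mulE.
by apply/Localization.mk_eqP; exists (Localization.den1 p) => /=; ring.
Qed.

Lemma loc_surj (x : localization p) :
  exists2 s, s \notin p & exists a, loc p a = loc p s * x.
Proof.
elim/Localization.mk_ind: x => a s.
by exists (Localization.dval s); [exact: (valP s)|exists a; apply: loc_mkE].
Qed.

Lemma loc_eq0 a : loc p a = 0 -> exists2 s, s \notin p & s * a = 0.
Proof.
move=> /Localization.mk_eqP[u] /=; rewrite mul0r mulr0 mulr1 => e.
by exists (Localization.dval u) => //; exact: (valP u).
Qed.

Lemma loc_nonunit (x : localization p) :
  ~ (exists c, x * c = 1) -> exists a s, x = Localization.mk a s /\ a \in p.
Proof.
elim/Localization.mk_ind: x => a s nu; exists a, s; split=> //.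
apply/negPn/negP => ap; apply: nu.
exists (Localization.mk (Localization.dval s) (Den ap)).
rewrite -[LHS]/(Localization.mul _ _) Localization.mulE.
by apply/Localization.mk_eqP; exists (Localization.den1 p) => /=; ring.
Qed.

(** Locality of R_p in the form used for exchanging basis vectors: nonunits are fractions with
    numerator in p, these are stable under linear combinations, and 1 is not among them. *)
Lemma loc_sum_unit (I : finType) (a b : I -> localization p) :
  \sum_i a i * b i = 1 -> exists i c, a i * c = 1.
Proof.
move=> e; apply: contrapT => nu.
have pD u v : u \in p -> v \in p -> u + v \in p by move=> up vp; rewrite rpredD.
have pM u v : u \in p -> u * v \in p by move=> up; rewrite prime_idealrM up.
suff [c [s [e' cp]]] : exists c s, \sum_i a i * b i = Localization.mk c s /\ c \in p.
  move: e'; rewrite e => /Localization.mk_eqP[u] /= eu.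
  have: Localization.dval u * (1 * Localization.dval s) \in p.
    by rewrite eu mulrC; apply: pM; rewrite mulr1.
  rewrite mul1r prime_idealrM => /orP[h|h]; first by have := valP u; rewrite /= h.
  by have := valP s; rewrite /= h.
elim/big_ind: _ => [|x y [c [s [-> cp]]] [d [t [-> dp]]]|i _].
- by exists 0, (Localization.den1 p); split=> //; apply: rpred0.
- exists (c * Localization.dval t + d * Localization.dval s), (Localization.denM s t).
  by split; [exact: Localization.addE|apply: pD; apply: pM].
- have [|c [s [-> cp]]] := @loc_nonunit (a i); first by move=> [c h]; apply: nu; exists i, c.
  elim/Localization.mk_ind: (b i) => d t.
  exists (c * d), (Localization.denM s t).
  by split; [exact: Localization.mulE|apply: pM].
Qed.

(** The product of the finitely many witnesses is a common one, because p is prime and each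
    condition passes to multiples. *)
Lemma common_den (I : finType) (P : I -> R -> Prop) :
  (forall i s r, P i s -> P i (r * s)) ->
  (forall i, exists2 s, s \notin p & P i s) ->
  exists2 s, s \notin p & forall i, P i s.
Proof.
move=> PM Ploc.
have /choice[h hP] : forall i, exists s, s \notin p /\ P i s.
  by move=> i; have [s sp Ps] := Ploc i; exists s.
exists (\prod_i h i).
  elim/big_ind: _ => [|x y xp yp|i _]; last exact: (hP i).1.
    by rewrite idealr1.
  by rewrite prime_idealrM negb_or xp yp.
by move=> i; rewrite (bigD1 i) //= mulrC; apply: PM; exact: (hP i).2.
Qed.

(** The two facts about a localization that the patching uses: elements of K become images after
    multiplication by a denominator, and the kernel is killed by denominators. The denominators are
    kept in R through [sigma], so that the property passes from R to R[X] and R[X, Y]. *)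
Definition localizes (C K : comNzRingType) (sigma : {rmorphism R -> C})
    (f : {rmorphism C -> K}) : Prop :=
  (forall c, exists2 s, s \notin p & exists c0, f c0 = f (sigma s) * c) /\
  (forall c, f c = 0 -> exists2 s, s \notin p & sigma s * c = 0).

Lemma localizes_loc : localizes idfun (loc p).
Proof. by split=> c; [exact: loc_surj|exact: loc_eq0]. Qed.

Lemma localizes_poly (C K : comNzRingType) (sigma : {rmorphism R -> C})
    (f : {rmorphism C -> K}) :
  localizes sigma f -> localizes (polyC \o sigma) (map_poly f).
Proof.
move=> [surj tors]; split=> c.
  elim/poly_ind: c => [|c k [s sp [c0 ec]]].
    by exists 1; rewrite ?idealr1 //; exists 0; rewrite !rmorph0 mulr0.
  have [t tp [k0 ek]] := surj k.
  exists (s * t); first by rewrite prime_idealrM negb_or sp.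
  exists ((sigma t)%:P * c0 * 'X + (sigma s * k0)%:P).
  rewrite !(rmorphD, rmorphM) /= ec ?map_polyX !map_polyC /= ek.
  by rewrite !(rmorphM, map_polyC) /=; ring.
elim/poly_ind: c => [|c k IH].
  by exists 1; rewrite ?idealr1 //; rewrite mulr0.
rewrite rmorphD rmorphM /= map_polyX map_polyC => e.
have fk : f k = 0.
  by move/(congr1 (coefp 0)): e; rewrite /= coefD coefMX coefC coef0 add0r.
have fc : map_poly f c = 0.
  move: e; rewrite /= [f k]fk polyC0 addr0 => /polyP h; apply/polyP => i; by have := h i.+1; rewrite coefMX !coef0.
have [s sp es] := IH fc; have [t tp et] := tors _ fk.
exists (s * t); first by rewrite prime_idealrM negb_or sp.
move: es; rewrite /= => es.
rewrite !rmorphM /= mulrDr -rmorphM /= rmorphM /=.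
rewrite -!polyCM -mulrA et mulr0 polyC0 addr0 polyCM mulrA [_ * (sigma t)%:P * c]mulrAC es.
by rewrite !mul0r.
Qed.

End LocalizationFacts.

(** * Quillen patching for elementary groups of matrices *)

Section Evaluation.

(* Locked so that simplification does not unfold composite ring morphisms. *)
Fact rmorph_key : unit. Proof. by []. Qed.

Definition ev (A B : comNzRingType) (f : {rmorphism A -> B}) (u : B) :
    {rmorphism {poly A} -> B} :=
  locked_with rmorph_key (horner_eval u \o map_poly f : {rmorphism {poly A} -> B}).

Lemma evC (A B : comNzRingType) (f : {rmorphism A -> B}) u c : ev f u c%:P = f c.
Proof. by rewrite /ev locked_withE /= map_polyC /horner_eval hornerC. Qed.

Lemma evX (A B : comNzRingType) (f : {rmorphism A -> B}) u : ev f u 'X = u.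
Proof. by rewrite /ev locked_withE /= map_polyX /horner_eval hornerX. Qed.

(** All substitutions (shifts, dilations, specializations) are compared through this lemma, on
    constants and on the variable. *)
Lemma poly_rmorph_ext (A B : comNzRingType) (f g : {rmorphism {poly A} -> B}) :
  (forall c, f c%:P = g c%:P) -> f 'X = g 'X -> f =1 g.
Proof.
move=> hC hX; elim/poly_ind=> [|q c IH]; first by rewrite !rmorph0.
by rewrite !rmorphD !rmorphM /= IH hX hC.
Qed.

Lemma poly_divX (A : comNzRingType) (q : {poly A}) : exists q', q = q' * 'X + (q.[0])%:P.
Proof.
elim/poly_ind: q => [|q c _]; first by exists 0; rewrite mul0r horner0 polyC0 addr0.
by exists q; rewrite hornerMXaddC mulr0 add0r.
Qed.

End Evaluation.

Section Dilate.

Definition dilate (A : comNzRingType) (a : A) : {rmorphism {poly A} -> {poly A}} :=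
  locked_with rmorph_key (ev polyC (a%:P * 'X)).

Lemma dilateC (A : comNzRingType) (a c : A) : dilate a c%:P = c%:P.
Proof. by rewrite /dilate locked_withE evC. Qed.

Lemma dilateX (A : comNzRingType) (a : A) : dilate a 'X = a%:P * 'X.
Proof. by rewrite /dilate locked_withE evX. Qed.

Lemma dilateM (A : comNzRingType) (a b : A) (c : {poly A}) :
  dilate a (dilate b c) = dilate (a * b) c.
Proof.
move: c; apply: (@poly_rmorph_ext _ _ (dilate a \o dilate b) (dilate (a * b))) => [c|] /=.
  by rewrite !dilateC.
by rewrite !dilateX rmorphM /= dilateC dilateX polyCM; ring.
Qed.
End Dilate.

Section PolyMorphisms.
Variable R : comNzRingType.

(** In [{poly {poly R}}] the inner variable ['X%:P] is X and the outer variable ['X] is Y; dilations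
    act on Y only. The maps [const2], [cloc] and [cloc2] embed the constants of R in R[X, Y], R_p[X]
    and R_p[X, Y]. *)
Definition const2 : {rmorphism R -> {poly {poly R}}} :=
  locked_with rmorph_key (polyC \o polyC : {rmorphism R -> {poly {poly R}}}).

Variable p : prime_idealr R.

Definition cloc : {rmorphism R -> {poly localization p}} :=
  locked_with rmorph_key (polyC \o loc p : {rmorphism R -> {poly localization p}}).
Definition cloc2 : {rmorphism R -> {poly {poly localization p}}} :=
  locked_with rmorph_key (polyC \o cloc : {rmorphism R -> {poly {poly localization p}}}).
Definition loc2 : {rmorphism {poly {poly R}} -> {poly {poly localization p}}} :=
  locked_with rmorph_key (map_poly (map_poly (loc p)) :
    {rmorphism {poly {poly R}} -> {poly {poly localization p}}}).

Lemma const2E s : const2 s = s%:P%:P.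
Proof. by rewrite /const2 locked_withE. Qed.

Lemma clocE s : cloc s = (loc p s)%:P.
Proof. by rewrite /cloc locked_withE. Qed.

Lemma cloc2E s : cloc2 s = (cloc s)%:P.
Proof. by rewrite /cloc2 locked_withE. Qed.

Lemma localizes2 : localizes p const2 loc2.
Proof.
rewrite /const2 /loc2 !locked_withE.
exact: (localizes_poly (localizes_poly (localizes_loc p))).
Qed.

Lemma loc2C c : loc2 c%:P = (map_poly (loc p) c)%:P.
Proof. by rewrite /loc2 locked_withE /= map_polyC. Qed.

Lemma loc2X : loc2 'X = 'X.
Proof. by rewrite /loc2 locked_withE /= map_polyX. Qed.

Lemma map_loc_const s : map_poly (loc p) s%:P = cloc s.
Proof. by rewrite clocE map_polyC. Qed.

Lemma loc2_const s : loc2 (const2 s) = cloc2 s.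
Proof. by rewrite const2E loc2C map_loc_const cloc2E. Qed.

Lemma dilate_loc2 (s : R) c : dilate (cloc s) (loc2 c) = loc2 (dilate s%:P c).
Proof.
move: c; apply: (@poly_rmorph_ext _ _ (dilate (cloc s) \o loc2) (loc2 \o dilate s%:P)) => [c|] /=.
  by rewrite !(loc2C, dilateC).
by rewrite !(loc2X, dilateX) rmorphM /= loc2C loc2X map_loc_const.
Qed.

Lemma horner0_loc2 c : horner_eval 0 (loc2 c) = map_poly (loc p) (horner_eval 0 c).
Proof.
move: c; apply: (@poly_rmorph_ext _ _ (horner_eval 0 \o loc2) (map_poly (loc p) \o horner_eval 0)) => [c|] /=.
  by rewrite loc2C /horner_eval !hornerC.
by rewrite loc2X /horner_eval !hornerX rmorph0.
Qed.

End PolyMorphisms.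

Section ElementaryGroup.
Variables (R : comNzRingType) (N : nat) (I : Type).
Variable E : I -> forall A : comNzRingType, (R -> A) -> A -> 'M[A]_N.
Hypothesis E_map : forall (A B : comNzRingType) (g : {rmorphism A -> B}) (f : R -> A) i t,
  map_mx g (E i f t) = E i (g \o f) (g t).
Hypothesis E_add : forall (A : comNzRingType) (f : {rmorphism R -> A}) i s t,
  E i f (s + t) = E i f s *m E i f t.
Hypothesis E_0 : forall (A : comNzRingType) (f : {rmorphism R -> A}) i,
  E i f 0 = 1%:M.

(** Words in the generators suffice: the inverse of [E i f t] is [E i f (- t)] by additivity.
    Naturality of E in the ring lets one definition serve R[X], R[X, Y] and their localizations, the
    structure map [f] telling them apart. *)
Inductive elem_group (A : comNzRingType) (f : R -> A) : 'M[A]_N -> Prop :=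
| elem_group1 : elem_group f 1%:M
| elem_groupM i t M : elem_group f M -> elem_group f (E i f t *m M).

Lemma elem_gen (A : comNzRingType) (f : R -> A) i t : elem_group f (E i f t).
Proof. by rewrite -[E i f t]mulmx1; apply/elem_groupM/elem_group1. Qed.

Lemma elem_mul (A : comNzRingType) (f : R -> A) M M' :
  elem_group f M -> elem_group f M' -> elem_group f (M *m M').
Proof.
move=> h h'; elim: h => [|i t {}M _ IH]; first by rewrite mul1mx.
by rewrite -mulmxA; apply: elem_groupM.
Qed.

Lemma EN (A : comNzRingType) (f : {rmorphism R -> A}) i t :
  E i f t *m E i f (- t) = 1%:M.
Proof. by rewrite -E_add subrr E_0. Qed.

Lemma elem_inv (A : comNzRingType) (f : {rmorphism R -> A}) M :
  elem_group f M -> exists2 M', elem_group f M' & M *m M' = 1%:M.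
Proof.
elim=> [|i t {}M _ [M' h e]].
  by exists 1%:M; [exact: elem_group1|rewrite mulmx1].
exists (M' *m E i f (- t)); first by apply: elem_mul => //; apply: elem_gen.
by rewrite mulmxA -[_ *m M *m _]mulmxA e mulmx1 EN.
Qed.

Lemma elem_map (A B : comNzRingType) (g : {rmorphism A -> B}) (f : R -> A) h M :
  g \o f =1 h -> elem_group f M -> elem_group h (map_mx g M).
Proof.
move=> /funext <-; elim=> [|i t {}M _ IH].
  by rewrite map_mx1; apply: elem_group1.
by rewrite map_mxM /= E_map; apply: elem_groupM.
Qed.

Lemma conj_cancel (A : comNzRingType) (H H' D U V W Z X Y : 'M[A]_N) :
  H' *m H = 1%:M -> U *m V = 1%:M -> X *m Y = 1%:M ->
  H *m (D *m U) *m H' *m (H *m V *m W *m (Z *m X) *m (Y *m H')) =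
  H *m (D *m W) *m Z *m H'.
Proof.
move=> HH UV XY.
transitivity (H *m (D *m (U *m (H' *m H) *m V) *m W) *m Z *m (X *m Y) *m H').
  by rewrite !mulmxA.
by rewrite HH XY !mulmx1 UV mulmx1.
Qed.

Section LocalGlobal.
Variable alpha : 'M[{poly R}]_N.
Variable alphaV : 'M[{poly R}]_N.
Hypothesis alphaK : alpha *m alphaV = 1%:M.
Hypothesis alpha0 : map_mx (horner_eval 0) alpha = 1%:M.

Local Notation C := {poly {poly R}}.

Definition shift (a : R) : {rmorphism {poly R} -> C} :=
  locked_with rmorph_key (ev (const2 R) ('X%:P + const2 R a * 'X)).

Lemma shiftC a c : shift a c%:P = const2 R c.
Proof. by rewrite /shift locked_withE evC. Qed.

Lemma shiftX a : shift a 'X = 'X%:P + const2 R a * 'X.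
Proof. by rewrite /shift locked_withE evX. Qed.

(* alpha(X + aY) alpha(X)^-1 *)
Definition shifted (a : R) : 'M[C]_N :=
  map_mx (shift a) alpha *m map_mx polyC alphaV.

Lemma shifted0 a : map_mx (horner_eval 0) (shifted a) = 1%:M.
Proof.
rewrite /shifted map_mxM -!map_mx_comp -[RHS]alphaK; congr (_ *m _); last first.
  by apply/matrixP => i j; rewrite !mxE /= /horner_eval hornerC.
apply/matrixP => i j; rewrite !mxE; move: (alpha i j).
apply: (@poly_rmorph_ext _ _ (horner_eval 0 \o shift a) idfun) => [c|] /=.
  by rewrite shiftC const2E /horner_eval hornerC.
by rewrite shiftX /horner_eval hornerD hornerM hornerC hornerX mulr0 addr0.
Qed.

Section Dilation.
Variable p : prime_idealr R.
Local Notation B := {poly localization p}.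
Local Notation K := {poly {poly localization p}}.
Local Notation F := (loc2 p).
Local Notation cC := (const2 R).
Local Notation cB := (cloc p).
Local Notation cK := (cloc2 p).

(** The only input that depends on the kind of group. The denominator s depends on the conjugator
    and on the generator, but serves all parameters t at once. *)
Definition conjugates_dilate : Prop :=
  forall g g', elem_group cK g -> g *m g' = 1%:M -> forall i,
  exists2 s, s \notin p & forall t, exists2 d, elem_group cC d &
    map_mx F d = g *m E i cK (F (cC s * t)) *m g'.

Hypothesis conj_dil : conjugates_dilate.

(** Induction on the word g(X, Y) for h g(X, rsY) g(X, 0)^-1 h^-1. With g = E(c) g1 and c0 = c(X,
    0), this splits into the conjugate of E(c(X, rsY) - c0) by h, covered by the hypothesis on
    conjugates, and the same expression for g1 with h E(c0) in place of h; hence the statement is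
    made for all h. The free factor r makes it possible to combine the denominators of both
    parts. *)
Lemma conj_word_dilate g : elem_group cK g -> forall g', g *m g' = 1%:M ->
  forall h h' : 'M[B]_N, elem_group cB h -> h *m h' = 1%:M ->
  exists2 s, s \notin p & forall r, exists2 d, elem_group cC d &
    map_mx F d = map_mx polyC h *m map_mx (dilate (cB (r * s))) g *m
                 map_mx polyC (map_mx (horner_eval 0) g') *m map_mx polyC h'.
Proof.
elim=> [|i c {}g _ IH] g' gg' h h' hE hh'.
  exists 1; first by rewrite idealr1.
  move=> r; exists 1%:M; first exact: elem_group1.
  rewrite mul1mx in gg'; rewrite gg' !map_mx1 !mulmx1 -map_mxM hh' !map_mx1 //.
pose g1' := g' *m E i cK c.
have gg1 : g *m g1' = 1%:M.
  rewrite /g1' mulmxA; have /(congr1 (mulmx (E i cK (- c)))) := gg'.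
  rewrite -mulmxA [_ *m (_ *m _)]mulmxA mulmx1.
  have -> : E i cK (- c) *m E i cK c = 1%:M by apply: mulmx1C; apply: EN.
  by rewrite mul1mx => ->; apply: mulmx1C; apply: EN.
pose c0 := horner_eval 0 c.
have h1E : elem_group cB (h *m E i cB c0).
  by apply: elem_mul => //; apply: elem_gen.
have hh1 : (h *m E i cB c0) *m (E i cB (- c0) *m h') = 1%:M.
  by rewrite mulmxA -[_ *m _ *m E i cB (- c0)]mulmxA EN mulmx1.
have [s1 s1p IH1] := IH _ gg1 _ _ h1E hh1.
have [q eq] := poly_divX c.
have [s2 s2p [q0 eq0]] := (localizes2 p).1 q.
have hK : elem_group cK (map_mx polyC h).
  by apply: elem_map hE => r; rewrite cloc2E.
have hhK : map_mx polyC h *m map_mx polyC h' = 1%:M :> 'M[K]_N.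
  by rewrite -map_mxM hh' map_mx1.
have [s3 s3p h3] := conj_dil hK hhK i.
exists (s3 * (s1 * s2)); first by rewrite !prime_idealrM !negb_or s1p s2p s3p.
move=> r.
(* The parameter is chosen so that s3 times its image is sY q(X, sY) = c(X, sY) - c(X, 0), where s =
   r s1 s2 s3 and q0 maps to s2 q. *)
have [d1 d1E ed1] := h3 (cC (r * s1) * 'X * dilate ((r * (s3 * (s1 * s2)))%:P) q0).
have [d2 d2E ed2] := IH1 (r * s3 * s2).
exists (d1 *m d2); first exact: elem_mul.
rewrite map_mxM ed1 ed2 => {ed1 ed2 h3 IH1 IH}.
have -> : r * s3 * s2 * s1 = r * (s3 * (s1 * s2)) by ring.
set s := r * (s3 * (s1 * s2)).
have -> : F (cC s3 * (cC (r * s1) * 'X * dilate s%:P q0)) = dilate (cB s) c - c0%:P.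
  rewrite !(rmorphM F) -(dilate_loc2 p s q0) eq0 (rmorphM (dilate _)) !loc2_const !cloc2E !dilateC.
  rewrite [X in _ = dilate _ X - _]eq (rmorphD (dilate _)) (rmorphM (dilate _)) !dilateC dilateX.
  rewrite -[c.[0]]/c0 addrK loc2X /s !(rmorphM cB) !polyCM.
  ring.
have hV : map_mx polyC h' *m map_mx polyC h = 1%:M :> 'M[K]_N by apply: mulmx1C.
have polycB : polyC \o cB = cK by apply/funext => x; rewrite cloc2E.
have hornerK : horner_eval 0 \o cK = cB.
  by apply/funext => x /=; rewrite cloc2E /horner_eval hornerC.
have dilK : dilate (cB s) \o cK = cK.
  by apply/funext => x /=; rewrite !cloc2E dilateC.
rewrite E_add !map_mxM (E_map (dilate _)) dilK !(E_map polyC) (E_map (horner_eval 0)).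
rewrite hornerK polycB -/c0 (E_map polyC) polycB.
apply: conj_cancel => //; last by rewrite rmorphN; apply: EN.
by apply: mulmx1C; apply: EN.
Qed.

(** The word g = alpha_p(X + Y) alpha_p(X)^-1 is elementary over R_p[X, Y] and equals 1 at Y = 0, so
    [conj_word_dilate] with h = 1 lifts g(X, sY). *)
Lemma elem_dilate_to_local :
  elem_group cB (map_mx (map_poly (loc p)) alpha) ->
  exists2 s, s \notin p & exists2 d, elem_group cC d &
    map_mx F d = map_mx F (shifted s) /\ map_mx (horner_eval 0) d = 1%:M.
Proof.
move=> alE.
set al := map_mx _ alpha in alE.
pose alV := map_mx (map_poly (loc p)) alphaV.
have alK : al *m alV = 1%:M by rewrite -map_mxM alphaK map_mx1.
have alVE : elem_group cB alV.
  have [M ME eM] := elem_inv alE.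
  by rewrite (_ : alV = M) // -[M]mul1mx -(mulmx1C alK) -mulmxA eM mulmx1.
pose u : K := 'X%:P + 'X.
pose shK := ev (polyC \o polyC : {rmorphism localization p -> K}) u.
have shKB : shK \o cB =1 cK by move=> x /=; rewrite clocE cloc2E clocE evC.
have polycB : polyC \o cB =1 cK by move=> x; rewrite cloc2E.
have gE : elem_group cK (map_mx shK al *m map_mx polyC alV).
  by apply: elem_mul; [apply: elem_map alE|apply: elem_map alVE].
have gg' : (map_mx shK al *m map_mx polyC alV) *m (map_mx polyC al *m map_mx shK alV) = 1%:M.
  rewrite mulmxA -[_ *m _ *m map_mx polyC al]mulmxA -map_mxM (mulmx1C alK) map_mx1 mulmx1.
  by rewrite -map_mxM alK map_mx1.
have h1 : elem_group cB 1%:M by apply: elem_group1.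
have [s sp hs] := conj_word_dilate gE gg' h1 (mulmx1 _).
have [d dE ed] := hs 1.
have h0shK (c : B) : horner_eval 0 (shK c) = c.
  move: c; apply: (@poly_rmorph_ext _ _ (horner_eval 0 \o shK) idfun) => [c|] /=.
    by rewrite evC /horner_eval hornerC.
  by rewrite evX /horner_eval hornerD hornerC hornerX addr0.
have Fd : map_mx F d = map_mx F (shifted s).
  have g'0 : map_mx (horner_eval 0) (map_mx polyC al *m map_mx shK alV) = 1%:M.
    rewrite map_mxM -!map_mx_comp -[RHS]alK; congr (_ *m _).
      by apply/matrixP => i j; rewrite !mxE /= /horner_eval hornerC.
    by apply/matrixP => i j; rewrite !mxE /= h0shK.
  rewrite ed g'0 !map_mx1 !mulmx1 mul1mx mul1r /shifted !map_mxM -!map_mx_comp; congr (_ *m _).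
    apply/matrixP => i j; rewrite !mxE /=; move: (alpha i j).
    apply: (@poly_rmorph_ext _ _ (dilate (cB s) \o (shK \o map_poly (loc p))) (F \o shift s)) => [c|] /=.
      rewrite map_polyC [shK _]evC /= dilateC.
      by rewrite shiftC loc2_const cloc2E clocE.
    rewrite map_polyX [shK _]evX shiftX (rmorphD (dilate _)) dilateX dilateC.
    by rewrite (rmorphD F) loc2C map_polyX (rmorphM F) loc2X loc2_const cloc2E.
  apply/matrixP => i j; rewrite !mxE /= dilateC; by rewrite loc2C.
(* Dividing d by d(X, 0) makes the lift equal to 1 at Y = 0 over R[X] itself; the image over R_p is
   unchanged, since d(X, 0) already becomes 1 there. *)
pose d0 := map_mx (horner_eval 0) d.
have d0E : elem_group (polyC : R -> {poly R}) d0.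
  by apply: elem_map dE => x; rewrite /= const2E /horner_eval hornerC.
have [d0V d0VE ed0] := elem_inv d0E.
have d01 : map_mx (map_poly (loc p)) d0 = 1%:M.
  have -> : map_mx (map_poly (loc p)) d0 = map_mx (horner_eval 0) (map_mx F d).
    by rewrite /d0 -!map_mx_comp; apply/matrixP => i j; rewrite !mxE /= horner0_loc2.
  rewrite Fd -map_mx_comp (_ : horner_eval 0 \o F = map_poly (loc p) \o horner_eval 0); last first.
    by apply/funext => c /=; rewrite horner0_loc2.
  by rewrite map_mx_comp shifted0 map_mx1.
have d0V1 : map_mx (map_poly (loc p)) d0V = 1%:M.
  by rewrite -[LHS]mul1mx -d01 -map_mxM ed0 map_mx1.
exists s => //; exists (d *m map_mx polyC d0V).
  by apply: elem_mul => //; apply: elem_map d0VE => x; rewrite const2E.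
split.
  rewrite map_mxM Fd (_ : map_mx F (map_mx polyC d0V) = 1%:M) ?mulmx1 //.
  have <- : map_mx polyC (map_mx (map_poly (loc p)) d0V) = 1%:M by rewrite d0V1 map_mx1.
  by rewrite -!map_mx_comp; apply/matrixP => i j; rewrite !mxE /= loc2C.
rewrite map_mxM -map_mx_comp (_ : map_mx (horner_eval 0 \o polyC) d0V = d0V) //.
by apply/matrixP => i j; rewrite !mxE /= /horner_eval hornerC.
Qed.

(** The lift d and [shifted s] agree over R_p[X, Y] and at Y = 0, so each entry of the difference is
    Y c' with t c' = 0 for some t outside p. The substitution Y |-> tY kills these entries and turns
    [shifted s] into [shifted (t * s)]. *)
Lemma shifted_local :
  elem_group cB (map_mx (map_poly (loc p)) alpha) ->
  exists2 s, s \notin p & elem_group cC (shifted s).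
Proof.
move=> /elem_dilate_to_local[s sp [d dE [Fd d0]]].
pose P (ij : 'I_N * 'I_N) (t : R) :=
  dilate t%:P (d ij.1 ij.2) = dilate t%:P (shifted s ij.1 ij.2).
have [|[i j]|t tp ht] := @common_den R p _ P.
- by move=> ij t r e; rewrite /P polyCM -2!(dilateM r%:P t%:P) e.
- set c := d i j - shifted s i j.
  have Fc : F c = 0.
    have /matrixP/(_ i j) := Fd; rewrite [LHS]mxE [RHS]mxE => e.
    by rewrite (rmorphB F) e subrr.
  have c0 : c.[0] = 0.
    have /matrixP/(_ i j) : map_mx (horner_eval 0) d = map_mx (horner_eval 0) (shifted s).
      by rewrite d0 shifted0.
    rewrite [LHS]mxE [RHS]mxE => e.
    by rewrite -[LHS]/(horner_eval 0 (d i j - shifted s i j)) rmorphB /= e subrr.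
  have [c' ec] := poly_divX c; rewrite c0 polyC0 addr0 in ec.
  have Fc' : F c' = 0.
    move: Fc; rewrite ec rmorphM loc2X => /polyP h.
    by apply/polyP => k; have := h k.+1; rewrite coefMX !coef0.
  have [t tp et] := (localizes2 p).2 _ Fc'.
  exists t => //; apply/eqP; rewrite /P -subr_eq0 -rmorphB -/c ec rmorphM dilateX mulrA.
  have -> : dilate t%:P c' * t%:P%:P = dilate t%:P (cC t * c').
    by rewrite rmorphM const2E dilateC mulrC.
  by rewrite et rmorph0 mul0r.
exists (t * s); first by rewrite prime_idealrM negb_or tp.
have -> : shifted (t * s) = map_mx (dilate t%:P) d.
  transitivity (map_mx (dilate t%:P) (shifted s)); last first.
    by apply/matrixP => i j; rewrite [LHS]mxE [RHS]mxE (ht (i, j)).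
  rewrite /shifted map_mxM -!map_mx_comp; congr (_ *m _); last first.
    by apply/matrixP => i j; rewrite !mxE /= dilateC.
  apply/matrixP => i j; rewrite !mxE; move: (alpha i j).
  apply: (@poly_rmorph_ext _ _ (shift (t * s)) (dilate t%:P \o shift s)) => [c|] /=.
    by rewrite !shiftC const2E dilateC.
  rewrite !shiftX (rmorphD (dilate _)) (rmorphM (dilate _)) dilateX !const2E !dilateC !polyCM.
  ring.
by apply: elem_map dE => x; rewrite /= const2E dilateC.
Qed.

End Dilation.

Hypothesis alpha_local : forall (M : {pred R}) (hM : maximal_ideal M),
  elem_group (cloc (prime_of_maximal hM)) (map_mx (map_poly (loc (prime_of_maximal hM))) alpha).
Hypothesis alpha_dilate : forall (M : {pred R}) (hM : maximal_ideal M),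
  conjugates_dilate (prime_of_maximal hM).

Theorem elem_local_global : elem_group (polyC : R -> {poly R}) alpha.
Proof.
have alVK : alphaV *m alpha = 1%:M by apply: mulmx1C.
have J1 : elem_group (const2 R) (shifted 1).
  apply: (@one_in_ideal R (fun a => elem_group (const2 R) (shifted a))).
  - rewrite /shifted (_ : map_mx (shift 0) alpha = map_mx polyC alpha).
      by rewrite -map_mxM alphaK map_mx1; apply: elem_group1.
    apply/matrixP => i j; rewrite !mxE; move: (alpha i j).
    apply: (@poly_rmorph_ext _ _ (shift 0) polyC) => [c|]; first by rewrite shiftC const2E.
    by rewrite shiftX rmorph0 mul0r addr0.
  - move=> a x y hx hy.
    (* Cocycle relation: [tau] sends X to X + yY and Y to aY, and alpha(X + (ax + y)Y) alpha(X)^-1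
       is the product of alpha(X + yY + axY) alpha(X + yY)^-1 and alpha(X + yY) alpha(X)^-1. *)
    pose tau := ev (shift y) (const2 R a * 'X).
    have tauC c : tau c%:P = shift y c by apply: evC.
    have tauX : tau 'X = const2 R a * 'X by apply: evX.
    have tauc c : tau (const2 R c) = const2 R c by rewrite {1}const2E tauC shiftC.
    have -> : shifted (a * x + y) = map_mx tau (shifted x) *m shifted y.
      rewrite /shifted map_mxM -!map_mx_comp.
      have -> : map_mx (tau \o polyC) alphaV = map_mx (shift y) alphaV.
        by apply/matrixP => i j; rewrite !mxE /= tauC.
      rewrite mulmxA -[_ *m _ *m map_mx (shift y) _]mulmxA -map_mxM alVK map_mx1 mulmx1.
      congr (_ *m _); apply/matrixP => i j; rewrite !mxE; move: (alpha i j).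
      apply: (@poly_rmorph_ext _ _ (shift (a * x + y)) (tau \o shift x)) => [c|] /=.
        by rewrite !shiftC tauc.
      rewrite !shiftX (rmorphD tau) (rmorphM tau) tauc tauX tauC shiftX.
      by rewrite (rmorphD (const2 R)) (rmorphM (const2 R)); ring.
    apply: elem_mul => //; apply: elem_map hx => r /=.
    by rewrite tauc.
  - by move=> M hM; apply: shifted_local (alpha_local hM); apply: alpha_dilate.
(* [w] puts X = 0 and renames Y to X: it sends alpha(X + Y) alpha(X)^-1 to alpha(X) alpha(0)^-1,
   which is alpha. *)
pose w := ev (polyC \o horner_eval 0 : {rmorphism {poly R} -> {poly R}}) 'X.
have <- : map_mx w (shifted 1) = alpha.
  rewrite /shifted map_mxM -!map_mx_comp.
  have -> : map_mx (w \o shift 1) alpha = alpha.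
    apply/matrixP => i j; rewrite !mxE; move: (alpha i j).
    apply: (@poly_rmorph_ext _ _ (w \o shift 1) idfun) => [c|] /=.
      by rewrite shiftC const2E evC /= /horner_eval hornerC.
    by rewrite shiftX rmorph1 mul1r (rmorphD w) evC evX /= /horner_eval hornerX polyC0 add0r.
  have -> : map_mx (w \o polyC) alphaV = map_mx polyC (map_mx (horner_eval 0) alphaV).
    by rewrite -map_mx_comp; apply/matrixP => i j; rewrite !mxE /= evC.
  have -> : map_mx (horner_eval 0) alphaV = 1%:M.
    by rewrite -[LHS]mul1mx -alpha0 -map_mxM alphaK map_mx1.
  by rewrite map_mx1 mulmx1.
by apply: elem_map J1 => x /=; rewrite const2E evC /= /horner_eval hornerC.
Qed.

End LocalGlobal.
End ElementaryGroup.

(** * One-parameter families that lift after rescaling the parameter *)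

Section Dilatable.
Variables (C K : comNzRingType) (f : {rmorphism C -> K}) (S : C -> Prop).
Variables (N : nat) (G : 'M[K]_N -> Prop).
Hypothesis S1 : S 1.
Hypothesis SM : forall s t, S s -> S t -> S (s * t).
Hypothesis S_den : forall x : K, exists2 s, S s & exists x0, f x0 = f s * x.
Hypothesis G1 : G 1%:M.
Hypothesis GM : forall M M', G M -> G M' -> G (M *m M').

(** In the applications C = R[X, Y], K = R_p[X, Y], S is the set of constants outside p and G the
    set of images of elementary matrices over C. The parameter t runs over C, not over K. *)
Definition dilatable (F : K -> 'M[K]_N) : Prop :=
  exists2 s, S s & forall t, G (F (f (s * t))).

Lemma dilatable_ext F F' : F =1 F' -> dilatable F -> dilatable F'.
Proof. by move=> e [s Ss h]; exists s => // t; rewrite -e. Qed.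

Lemma dilatable1 : dilatable (fun=> 1%:M).
Proof. by exists 1. Qed.

Lemma dilatable_mul F F' :
  dilatable F -> dilatable F' -> dilatable (fun t => F t *m F' t).
Proof.
move=> [s Ss h] [s' Ss' h']; exists (s * s'); first exact: SM.
by move=> t; apply: GM; [rewrite -mulrA|rewrite [s * s']mulrC -mulrA].
Qed.

Lemma dilatable_scale a F : dilatable F -> dilatable (fun t => F (a * t)).
Proof.
move=> [s Ss h]; have [s' Ss' [a0 ea]] := S_den a.
exists (s' * s) => [|t]; first exact: SM.
have -> : a * f (s' * s * t) = f (s * (a0 * t)).
  by rewrite !rmorphM ea; ring.
exact: h.
Qed.

Lemma dilatable_comm (a b : nat) F A B L :
  (forall t t', F (t ^+ a * t') = A t *m B t' *m A (- t) *m B (- t') *m L (t ^+ b * t')) ->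
  dilatable A -> dilatable B -> dilatable L -> dilatable F.
Proof.
move=> e [s1 S1s h1] [s2 S2s h2] [s3 S3s h3].
exists (s1 ^+ a * (s2 * s3)) => [|t].
  apply: SM; last exact: SM.
  by elim: a {e} => [|n IH]; rewrite ?expr0 // exprS; apply: SM.
rewrite (_ : f _ = f s1 ^+ a * f (s2 * (s3 * t))); last by rewrite !rmorphM rmorphXn; ring.
rewrite e; repeat apply: GM.
- by have := h1 1; rewrite mulr1.
- exact: h2.
- by have := h1 (-1); rewrite mulrN1 rmorphN.
- by have := h2 (s3 * - t); rewrite -rmorphN !mulrN.
- have := h3 (s1 ^+ b * s2 * t); congr (G (L _)).
  by rewrite !rmorphM rmorphXn; ring.
Qed.

End Dilatable.

(** For c the coordinates of a vector v orthogonal to w, and d those of a vector on which w takes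
    the value 1, the right-hand side is v. *)
Lemma koszul_sum (K : comNzRingType) (V : lmodType K) (I : finType) (x : I -> V)
    (w c d : I -> K) :
  \sum_i \sum_j (d j * c i) *: (w j *: x i - w i *: x j) =
  (\sum_j d j * w j) *: (\sum_i c i *: x i) - (\sum_i c i * w i) *: (\sum_j d j *: x j).
Proof.
rewrite scaler_sumr scaler_suml -sumrB; apply: eq_bigr => i _.
rewrite scaler_suml scaler_sumr -sumrB; apply: eq_bigr => j _.
by rewrite scalerBr !scalerA; congr (_ *: _ - _ *: _); ring.
Qed.

(** * Linear transvections *)

Section LinearTransvections.

Definition dot (K : comNzRingType) N (w : 'rV[K]_N) (v : 'cV[K]_N) : K := (w *m v) 0 0.

Lemma dotE (K : comNzRingType) N (w : 'rV[K]_N) (v : 'cV[K]_N) : w *m v = (dot w v)%:M.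
Proof. exact: mx11_scalar. Qed.

Definition lin_tv (K : comNzRingType) N (v : 'cV[K]_N) (w : 'rV[K]_N) (t : K) : 'M[K]_N :=
  1%:M + t *: (v *m w).

Section Algebra.
Variables (K : comNzRingType) (N : nat).

Lemma dotDl (w w' : 'rV[K]_N) v : dot (w + w') v = dot w v + dot w' v.
Proof. by rewrite /dot mulmxDl mxE. Qed.
Lemma dotDr (w : 'rV[K]_N) v v' : dot w (v + v') = dot w v + dot w v'.
Proof. by rewrite /dot mulmxDr mxE. Qed.
Lemma dotZl (w : 'rV[K]_N) v a : dot (a *: w) v = a * dot w v.
Proof. by rewrite /dot -scalemxAl mxE. Qed.
Lemma dotZr (w : 'rV[K]_N) v a : dot w (a *: v) = a * dot w v.
Proof. by rewrite /dot -scalemxAr mxE. Qed.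
Lemma dotNl (w : 'rV[K]_N) v : dot (- w) v = - dot w v.
Proof. by rewrite /dot mulNmx mxE. Qed.
Lemma dotNr (w : 'rV[K]_N) v : dot w (- v) = - dot w v.
Proof. by rewrite /dot mulmxN mxE. Qed.
Lemma dot0r (w : 'rV[K]_N) : dot w 0 = 0.
Proof. by rewrite /dot mulmx0 mxE. Qed.
Lemma dot0l (v : 'cV[K]_N) : dot 0 v = 0.
Proof. by rewrite /dot mul0mx mxE. Qed.

Lemma rk1_mul (v v' : 'cV[K]_N) (w w' : 'rV[K]_N) :
  (v *m w) *m (v' *m w') = dot w v' *: (v *m w').
Proof. by rewrite mulmxA -[v *m w *m v']mulmxA dotE mul_mx_scalar scalemxAl. Qed.

Lemma lin_tvDl (v v' : 'cV[K]_N) w t :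
  dot w v' = 0 -> lin_tv (v + v') w t = lin_tv v w t *m lin_tv v' w t.
Proof.
move=> h; rewrite /lin_tv mulmxDl mul1mx mulmxDr mulmx1 -scalemxAl -scalemxAr.
by rewrite rk1_mul h scale0r !scaler0 addr0 mulmxDl scalerDr addrA addrAC.
Qed.

Lemma lin_tvDr (v : 'cV[K]_N) w w' t :
  dot w v = 0 -> lin_tv v (w + w') t = lin_tv v w t *m lin_tv v w' t.
Proof.
move=> h; rewrite /lin_tv mulmxDl mul1mx mulmxDr mulmx1 -scalemxAl -scalemxAr.
by rewrite rk1_mul h scale0r !scaler0 addr0 mulmxDr scalerDr addrA addrAC.
Qed.

Lemma lin_tvZl a (v : 'cV[K]_N) w t : lin_tv (a *: v) w t = lin_tv v w (a * t).
Proof. by rewrite /lin_tv -scalemxAl scalerA mulrC. Qed.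

Lemma lin_tvZr a (v : 'cV[K]_N) w t : lin_tv v (a *: w) t = lin_tv v w (a * t).
Proof. by rewrite /lin_tv -scalemxAr scalerA mulrC. Qed.

Lemma lin_tv_comm (v h : 'cV[K]_N) (h' w : 'rV[K]_N) t t' :
  dot h' h = 1 -> dot h' v = 0 -> dot w h = 0 -> dot w v = 0 ->
  lin_tv v w (t * t') =
  lin_tv v h' t *m lin_tv h w t' *m lin_tv v h' (- t) *m lin_tv h w (- t').
Proof.
move=> hh hv wh wv; rewrite /lin_tv.
set A := v *m h'; set B := h *m w; set D := v *m w.
have AB : A *m B = D by rewrite rk1_mul hh scale1r.
have AA : A *m A = 0 by rewrite rk1_mul hv scale0r.
have AD : A *m D = 0 by rewrite rk1_mul hv scale0r.
have BA : B *m A = 0 by rewrite rk1_mul wv scale0r.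
have BB : B *m B = 0 by rewrite rk1_mul wh scale0r.
have BD : B *m D = 0 by rewrite rk1_mul wv scale0r.
have DD : D *m D = 0 by rewrite rk1_mul wv scale0r.
have DA : D *m A = 0 by rewrite rk1_mul wv scale0r.
have DB : D *m B = 0 by rewrite rk1_mul wh scale0r.
have step x y : (1%:M + x *: A) *m (1%:M + y *: B) = 1%:M + x *: A + y *: B + (x * y) *: D.
  rewrite mulmxDl mul1mx !mulmxDr mulmx1 -scalemxAl -scalemxAr AB scalerA.
  by rewrite -!addrA; congr (_ + _); rewrite addrCA.
rewrite -mulmxA !step !(mulmxDl, mulmxDr, mul1mx, mulmx1) -!(scalemxAl, scalemxAr).
rewrite AA AB AD BA BB BD DA DB DD !scaler0.
by apply/matrixP => i j; rewrite !mxE; ring.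
Qed.

End Algebra.

Section Local.
Variables (C K : comNzRingType) (f : {rmorphism C -> K}) (S : C -> Prop).
Variables (N : nat) (G : 'M[K]_N -> Prop).
Hypothesis S1 : S 1.
Hypothesis SM : forall s t, S s -> S t -> S (s * t).
Hypothesis S_den : forall x : K, exists2 s, S s & exists x0, f x0 = f s * x.
Hypothesis G1 : G 1%:M.
Hypothesis GM : forall M M', G M -> G M' -> G (M *m M').
Local Notation dilatable := (dilatable f S G).

Local Notation tv_dil v w := (dilatable (lin_tv v w)).

Lemma tv_dil0l w : tv_dil 0 w.
Proof.
apply: (dilatable_ext _ (dilatable1 f S1 G1)) => t.
by rewrite /lin_tv mul0mx scaler0 addr0.
Qed.

Lemma tv_dil0r v : tv_dil v 0.
Proof.
apply: (dilatable_ext _ (dilatable1 f S1 G1)) => t.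
by rewrite /lin_tv mulmx0 scaler0 addr0.
Qed.

Lemma tv_dilDl v v' w : dot w v' = 0 -> tv_dil v w -> tv_dil v' w -> tv_dil (v + v') w.
Proof.
move=> h d d'; apply: (dilatable_ext _ (dilatable_mul SM GM d d')) => t.
by rewrite lin_tvDl.
Qed.

Lemma tv_dilDr v w w' : dot w v = 0 -> tv_dil v w -> tv_dil v w' -> tv_dil v (w + w').
Proof.
move=> h d d'; apply: (dilatable_ext _ (dilatable_mul SM GM d d')) => t.
by rewrite lin_tvDr.
Qed.

Lemma tv_dilZl a v w : tv_dil v w -> tv_dil (a *: v) w.
Proof.
move=> d; apply: (dilatable_ext _ (dilatable_scale SM S_den a d)) => t.
by rewrite lin_tvZl.
Qed.

Lemma tv_dilZr a v w : tv_dil v w -> tv_dil v (a *: w).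
Proof.
move=> d; apply: (dilatable_ext _ (dilatable_scale SM S_den a d)) => t.
by rewrite lin_tvZr.
Qed.

Lemma tv_dil_suml (I : finType) (x : I -> 'cV[K]_N) w :
  (forall i, dot w (x i) = 0) -> (forall i, tv_dil (x i) w) -> tv_dil (\sum_i x i) w.
Proof.
move=> h d.
suff [] : dot w (\sum_i x i) = 0 /\ tv_dil (\sum_i x i) w by [].
elim/big_ind: _ => [|u v [u0 du] [v0 dv]|i _] //.
- by rewrite dot0r; split=> //; apply: tv_dil0l.
- by rewrite dotDr u0 v0 addr0; split=> //; apply: tv_dilDl.
Qed.

Lemma tv_dil_sumr (I : finType) (x : I -> 'rV[K]_N) v :
  (forall i, dot (x i) v = 0) -> (forall i, tv_dil v (x i)) -> tv_dil v (\sum_i x i).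
Proof.
move=> h d.
suff [] : dot (\sum_i x i) v = 0 /\ tv_dil v (\sum_i x i) by [].
elim/big_ind: _ => [|u w [u0 du] [w0 dw]|i _] //.
- by rewrite dot0l; split=> //; apply: tv_dil0r.
- by rewrite dotDl u0 w0 addr0; split=> //; apply: tv_dilDr.
Qed.

Variables (et : 'M[K]_N) (n : nat) (b : 'I_n -> 'cV[K]_N) (b' : 'I_n -> 'rV[K]_N).
Hypothesis n3 : (3 <= n)%N.
Hypothesis bb : forall i j, dot (b' i) (b j) = (i == j)%:R.
Hypothesis b_tot : et = \sum_i b i *m b' i.

(** The index i can take the place of the vector e and the form l of the standard generators. At the
    start this is known for [i0] only, where the basis vector is e and the dual form is l. *)
Let good i :=
  (forall v, et *m v = v -> dot (b' i) v = 0 -> tv_dil v (b' i)) /\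
  (forall w, w *m et = w -> dot w (b i) = 0 -> tv_dil (b i) w).

Variable i0 : 'I_n.
Hypothesis good0 : good i0.

Lemma et_b i : et *m b i = b i.
Proof.
rewrite b_tot mulmx_suml (bigD1 i) //= -mulmxA dotE bb eqxx mulmx1 big1 ?addr0 // => j ji.
by rewrite -mulmxA dotE bb (negbTE ji) mul_mx_scalar scale0r.
Qed.

Lemma b'_et i : b' i *m et = b' i.
Proof.
rewrite b_tot mulmx_sumr (bigD1 i) //= mulmxA dotE bb eqxx mul1mx big1 ?addr0 // => j ji.
by rewrite mulmxA dotE bb eq_sym (negbTE ji) mul_scalar_mx scale0r.
Qed.

(** The component of w along [b' i] is covered by [good i]. The remainder w1 vanishes on [b i], and
    the transvection of v and w1 is the commutator of those of (v, [b' i]) and ([b i], w1). *)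
Lemma tv_dil_goodl i v w : good i -> et *m v = v -> w *m et = w ->
  dot (b' i) v = 0 -> dot w v = 0 -> tv_dil v w.
Proof.
move=> [gv gw] ev ew iv wv.
pose w1 := w - dot w (b i) *: b' i.
have w1b : dot w1 (b i) = 0.
  by rewrite dotDl -scaleNr dotZl bb eqxx mulr1 subrr.
have w1v : dot w1 v = 0 by rewrite dotDl -scaleNr dotZl iv mulr0 addr0.
rewrite -[w](subrK (dot w (b i) *: b' i)) -/w1; apply: tv_dilDr => //; last first.
  by apply/tv_dilZr/gv.
have dw : tv_dil (b i) w1.
  by apply: gw => //; rewrite mulmxBl -scalemxAl b'_et ew.
apply: (dilatable_comm (a := 1) (b := 1) (L := fun=> 1%:M) S1 SM GM _ (gv _ ev iv) dw) => [t t'|].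
  by rewrite mulmx1 expr1; apply: lin_tv_comm; rewrite ?bb ?eqxx.
exact: dilatable1.
Qed.

Lemma tv_dil_goodr i v w : good i -> et *m v = v -> w *m et = w ->
  dot w (b i) = 0 -> dot w v = 0 -> tv_dil v w.
Proof.
move=> gi ev ew wb wv; have [_ gw] := gi.
pose v1 := v - dot (b' i) v *: b i.
have bv1 : dot (b' i) v1 = 0.
  by rewrite dotDr -scaleNr dotZr bb eqxx mulr1 subrr.
rewrite -[v](subrK (dot (b' i) v *: b i)) -/v1; apply: tv_dilDl.
- by rewrite dotZr wb mulr0.
- apply: (tv_dil_goodl gi) => //; first by rewrite mulmxBr -scalemxAr et_b ev.
  by rewrite dotDr -scaleNr dotZr wb mulr0 addr0.
- by apply/tv_dilZl/gw.
Qed.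

(** Distinct members of the basis and the dual basis annihilate each other, so [b i] and [b' i] meet
    the orthogonality conditions relative to [i0]. *)
Lemma all_good i : good i.
Proof.
have [->|ii0] := eqVneq i i0; first exact: good0.
split=> [v ev iv|w ew wi].
  apply: (tv_dil_goodr good0) => //; first exact: b'_et.
  by rewrite bb (negbTE ii0).
apply: (tv_dil_goodl good0) => //; first exact: et_b.
by rewrite bb eq_sym (negbTE ii0).
Qed.

Lemma third (i j : 'I_n) : exists k : 'I_n, (k != i) && (k != j).
Proof.
apply/existsP; apply: contraT => /existsPn h.
have /(uniq_leq_size (enum_uniq 'I_n)) : {subset enum 'I_n <= [:: i; j]}.
  by move=> k _; have := h k; rewrite !inE negb_and !negbK.
by rewrite size_enum_ord leqNgt n3.
Qed.

Lemma et_expand v : et *m v = v -> v = \sum_i dot (b' i) v *: b i.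
Proof.
move=> {1}<-; rewrite b_tot mulmx_suml; apply: eq_bigr => i _.
by rewrite -mulmxA dotE mul_mx_scalar.
Qed.

Lemma et_expandr w : w *m et = w -> w = \sum_i dot w (b i) *: b' i.
Proof.
move=> {1}<-; rewrite b_tot mulmx_sumr; apply: eq_bigr => i _.
by rewrite mulmxA dotE mul_scalar_mx.
Qed.

Lemma dot_expand v w : et *m v = v -> dot w v = \sum_i dot w (b i) * dot (b' i) v.
Proof.
move=> /et_expand {1}->; rewrite {1}/dot mulmx_sumr summxE; apply: eq_bigr => i _.
by rewrite -[LHS]/(dot _ _) dotZr mulrC.
Qed.

(** Each Koszul vector involves two basis vectors only, hence is killed by the form [b' k] of a
    third index k, and [tv_dil_goodl] applies to k. This is where the rank has to be at least 3. *)
Lemma tv_dil_uniml u v w : et *m u = u -> et *m v = v -> w *m et = w ->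
  dot w u = 1 -> dot w v = 0 -> tv_dil v w.
Proof.
move=> eu ev ew wu wv.
pose x (ij : 'I_n * 'I_n) :=
  (dot (b' ij.2) u * dot (b' ij.1) v) *: (dot w (b ij.2) *: b ij.1 - dot w (b ij.1) *: b ij.2).
have -> : v = \sum_ij x ij.
  rewrite (eq_bigr (fun ij => x (ij.1, ij.2))); last by case.
  rewrite -(pair_bigA _ (fun i j => x (i, j))) /x /=.
  rewrite koszul_sum -(et_expand ev) -(et_expand eu).
  rewrite (eq_bigr _ (fun i _ => mulrC _ _)) -dot_expand // wu scale1r.
  by rewrite (eq_bigr _ (fun i _ => mulrC _ _)) -dot_expand // wv scale0r subr0.
have wx ij : dot w (dot w (b ij.2) *: b ij.1 - dot w (b ij.1) *: b ij.2) = 0.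
  by rewrite dotDr -scaleNr !dotZr; ring.
apply: tv_dil_suml => [ij|[i j]]; first by rewrite dotZr wx mulr0.
apply: tv_dilZl => /=; have [k /andP[ki kj]] := third i j.
apply: (tv_dil_goodl (all_good k)) => //.
- by rewrite mulmxBr -!scalemxAr !et_b.
- by rewrite dotDr -scaleNr !dotZr !bb (negbTE ki) (negbTE kj) !mulr0 addr0.
- exact: (wx (i, j)).
Qed.

Lemma tv_dil_unimr u v w : u *m et = u -> et *m v = v -> w *m et = w ->
  dot u v = 1 -> dot w v = 0 -> tv_dil v w.
Proof.
move=> eu ev ew uv wv.
pose x (ij : 'I_n * 'I_n) :=
  (dot u (b ij.2) * dot w (b ij.1)) *:
    (dot (b' ij.2) v *: b' ij.1 - dot (b' ij.1) v *: b' ij.2).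
have -> : w = \sum_ij x ij.
  rewrite (eq_bigr (fun ij => x (ij.1, ij.2))); last by case.
  rewrite -(pair_bigA _ (fun i j => x (i, j))) /x /=.
  rewrite koszul_sum -(et_expandr ew) -(et_expandr eu).
  by rewrite -!dot_expand // uv wv scale1r scale0r subr0.
have xv ij : dot (dot (b' ij.2) v *: b' ij.1 - dot (b' ij.1) v *: b' ij.2) v = 0.
  by rewrite dotDl -scaleNr !dotZl; ring.
apply: tv_dil_sumr => [ij|[i j]]; first by rewrite dotZl xv mulr0.
apply: tv_dilZr => /=; have [k /andP[ki kj]] := third i j.
apply: (tv_dil_goodr (all_good k)) => //.
- by rewrite mulmxBl -!scalemxAl !b'_et.
- by rewrite dotDl -scaleNr !dotZl !bb eq_sym (negbTE ki) eq_sym (negbTE kj) !mulr0 addr0.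
- exact: (xv (i, j)).
Qed.

End Local.
End LinearTransvections.

(** * Dilatable families over R[X, Y] *)

Section ConjugatesDilate.
Variables (R : comNzRingType) (N : nat) (I : Type).
Variable E : I -> forall A : comNzRingType, (R -> A) -> A -> 'M[A]_N.
Variable p : prime_idealr R.
Local Notation C := {poly {poly R}}.
Local Notation K := {poly {poly localization p}}.

Definition den2 (c : C) : Prop := exists2 s, s \notin p & c = const2 R s.
Definition global_image (M : 'M[K]_N) : Prop :=
  exists2 d, elem_group E (const2 R) d & map_mx (loc2 p) d = M.
Definition glob_dil (F : K -> 'M[K]_N) : Prop := dilatable (loc2 p) den2 global_image F.

Lemma den2_1 : den2 1.
Proof. by exists 1; rewrite ?idealr1 ?rmorph1. Qed.

Lemma den2M s t : den2 s -> den2 t -> den2 (s * t).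
Proof.
move=> [s0 sp ->] [t0 tp ->]; exists (s0 * t0); last by rewrite rmorphM.
by rewrite prime_idealrM negb_or sp.
Qed.

Lemma den2_surj (x : K) : exists2 s, den2 s & exists x0, loc2 p x0 = loc2 p s * x.
Proof.
by have [s sp h] := (localizes2 p).1 x; exists (const2 R s) => //; exists s.
Qed.

Lemma global_image1 : global_image 1%:M.
Proof. by exists 1%:M; [exact: elem_group1|rewrite map_mx1]. Qed.

Lemma global_imageM M M' : global_image M -> global_image M' -> global_image (M *m M').
Proof.
move=> [d dE <-] [d' dE' <-]; exists (d *m d'); first exact: elem_mul.
by rewrite map_mxM.
Qed.

Hypothesis E_map : forall (A B : comNzRingType) (g : {rmorphism A -> B}) (f : R -> A) i t,
  map_mx g (E i f t) = E i (g \o f) (g t).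

Lemma loc2_const2 : loc2 p \o const2 R = cloc2 p.
Proof. by apply/funext => r /=; rewrite loc2_const. Qed.

Lemma glob_dil_gen i : glob_dil (E i (cloc2 p)).
Proof.
exists 1; first exact: den2_1.
move=> t; exists (E i (const2 R) t); first exact: elem_gen.
by rewrite E_map loc2_const2 mul1r.
Qed.

Lemma conjugates_dilateP :
  (forall g g', elem_group E (cloc2 p) g -> g *m g' = 1%:M -> forall i,
     glob_dil (fun t => g *m E i (cloc2 p) t *m g')) ->
  conjugates_dilate E p.
Proof.
move=> h g g' gE gg' i; have [c [s sp ->] hs] := h g g' gE gg' i.
by exists s => // t; have [d dE ed] := hs t; exists d.
Qed.

End ConjugatesDilate.

(** * Local-global principle for the linear elementary group *)

Section LinearLocalGlobal.
Variables (R : comNzRingType) (N : nat).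
Variables (e : 'cV[R]_N) (l : 'rV[R]_N) (pi : 'M[R]_N).
Hypothesis le1 : l *m e = 1%:M.
Hypothesis lpi : l *m pi = 0.
Hypothesis pie : pi *m e = 0.
Hypothesis pipi : pi *m pi = pi.

(** Here e is the vector (0, 1), l the last coordinate and pi the projection onto P. The columns of
    pi span P and its rows give a generating family of P*, so finitely many one-parameter families
    describe all elementary transvections. *)
Definition lin_gen (i : bool * 'I_N) (A : comNzRingType) (f : R -> A) (t : A) : 'M[A]_N :=
  if i.1 then lin_tv (col i.2 (map_mx f pi)) (map_mx f l) t
  else lin_tv (map_mx f e) (row i.2 (map_mx f pi)) t.

Lemma map_lin_tv (A B : comNzRingType) (g : {rmorphism A -> B}) n (v : 'cV[A]_n) w t :
  map_mx g (lin_tv v w t) = lin_tv (map_mx g v) (map_mx g w) (g t).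
Proof. by rewrite /lin_tv rmorphD /= map_mx1 map_mxZ map_mxM. Qed.

Lemma lin_gen_map (A B : comNzRingType) (g : {rmorphism A -> B}) (f : R -> A) i t :
  map_mx g (lin_gen i f t) = lin_gen i (g \o f) (g t).
Proof.
by rewrite /lin_gen; case: i.1; rewrite map_lin_tv ?map_col ?map_row -!map_mx_comp.
Qed.

Section Base.
Variables (A : comNzRingType) (f : {rmorphism R -> A}).

Lemma fle : dot (map_mx f l) (map_mx f e) = 1.
Proof. by rewrite /dot -map_mxM le1 map_mx1 mxE. Qed.

Lemma flpi i : dot (map_mx f l) (col i (map_mx f pi)) = 0.
Proof. by rewrite /dot colE mulmxA -map_mxM lpi map_mx0 mul0mx mxE. Qed.

Lemma fpie i : dot (row i (map_mx f pi)) (map_mx f e) = 0.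
Proof. by rewrite /dot rowE -mulmxA -map_mxM pie map_mx0 mulmx0 mxE. Qed.

Lemma lin_tvD (v : 'cV[A]_N) w s t : dot w v = 0 ->
  lin_tv v w (s + t) = lin_tv v w s *m lin_tv v w t.
Proof.
move=> h; have := @lin_tvDl _ _ (s *: v) (t *: v) w 1.
by rewrite dotZr h mulr0 -scalerDl !lin_tvZl !mulr1; apply.
Qed.

Lemma lin_gen_add i s t : lin_gen i f (s + t) = lin_gen i f s *m lin_gen i f t.
Proof. by rewrite /lin_gen; case: i.1; apply: lin_tvD; rewrite ?flpi ?fpie. Qed.

Lemma lin_gen0 i : lin_gen i f 0 = 1%:M.
Proof. by rewrite /lin_gen /lin_tv !scale0r !addr0 if_same. Qed.

Definition lin_et : 'M[A]_N := map_mx f (pi + e *m l).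

Lemma lin_et_pi i : lin_et *m col i (map_mx f pi) = col i (map_mx f pi).
Proof. by rewrite colE mulmxA -map_mxM mulmxDl pipi -mulmxA lpi mulmx0 addr0. Qed.

Lemma lin_pi_et i : row i (map_mx f pi) *m lin_et = row i (map_mx f pi).
Proof. by rewrite rowE -mulmxA -map_mxM mulmxDr pipi mulmxA pie mul0mx addr0. Qed.

Lemma lin_et_e : lin_et *m map_mx f e = map_mx f e.
Proof. by rewrite -map_mxM mulmxDl pie add0r -mulmxA le1 mulmx1. Qed.

Lemma lin_l_et : map_mx f l *m lin_et = map_mx f l.
Proof. by rewrite -map_mxM mulmxDr lpi add0r mulmxA le1 mul1mx. Qed.

Lemma lin_tv_et v w t : lin_et *m v = v -> w *m lin_et = w ->
  lin_et *m lin_tv v w t = lin_tv v w t *m lin_et.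
Proof.
move=> ev ew; rewrite /lin_tv mulmxDr mulmxDl mulmx1 mul1mx -scalemxAr -scalemxAl.
by rewrite mulmxA ev -mulmxA ew.
Qed.

Lemma lin_elem_et g : elem_group lin_gen f g -> lin_et *m g = g *m lin_et.
Proof.
elim=> [|i t {}g _ IH]; first by rewrite mulmx1 mul1mx.
rewrite mulmxA -[RHS]mulmxA -IH mulmxA; congr (_ *m _).
by rewrite /lin_gen; case: i.1; apply: lin_tv_et;
  rewrite ?lin_et_pi ?lin_pi_et ?lin_et_e ?lin_l_et.
Qed.

End Base.

Definition lin_basis (A : comNzRingType) (f : R -> A) : Prop :=
  exists n (b : 'I_n -> 'cV[A]_N) (b' : 'I_n -> 'rV[A]_N) (i0 : 'I_n),
  [/\ (3 <= n)%N, forall i j, dot (b' i) (b j) = (i == j)%:R,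
      map_mx f (pi + e *m l) = \sum_i b i *m b' i,
      b i0 = map_mx f e & b' i0 = map_mx f l].

Lemma map_dot (A B : comNzRingType) (g : {rmorphism A -> B}) n (w : 'rV[A]_n) v :
  dot (map_mx g w) (map_mx g v) = g (dot w v).
Proof. by rewrite /dot -map_mxM mxE. Qed.

Lemma lin_basis_map (A B : comNzRingType) (g : {rmorphism A -> B}) (f : R -> A) h :
  g \o f =1 h -> lin_basis f -> lin_basis h.
Proof.
move=> /funext <- [n [b [b' [i0 [n3 bb btot bi0 b'i0]]]]].
exists n, (fun i => map_mx g (b i)), (fun i => map_mx g (b' i)), i0; split=> //.
- by move=> i j; rewrite map_dot bb rmorph_nat.
- rewrite map_mx_comp btot raddf_sum /=; apply: eq_bigr => i _.
  by rewrite map_mxM.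
- by rewrite bi0 -map_mx_comp.
- by rewrite b'i0 -map_mx_comp.
Qed.

Section Conjugation.
Variables (C K : comNzRingType) (f : {rmorphism C -> K}) (S : C -> Prop).
Variables (G : 'M[K]_N -> Prop) (k : {rmorphism R -> K}).
Hypothesis S1 : S 1.
Hypothesis SM : forall s t, S s -> S t -> S (s * t).
Hypothesis S_den : forall x : K, exists2 s, S s & exists x0, f x0 = f s * x.
Hypothesis G1 : G 1%:M.
Hypothesis GM : forall M M', G M -> G M' -> G (M *m M').
Hypothesis gen_dil : forall i, dilatable f S G (lin_gen i k).

Lemma lin_et_v v : lin_et k *m v = v -> dot (map_mx k l) v = 0 ->
  v = \sum_i v i 0 *: col i (map_mx k pi).
Proof.
move=> ev lv; rewrite -{1}ev /lin_et map_mxD mulmxDl map_mxM -mulmxA dotE lv.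
rewrite -scalemx1 scale0r mulmx0 addr0.
by apply/matrixP => i j; rewrite !mxE summxE; apply: eq_bigr => h _; rewrite !mxE mulrC ord1.
Qed.

Lemma lin_et_w w : w *m lin_et k = w -> dot w (map_mx k e) = 0 ->
  w = \sum_i w 0 i *: row i (map_mx k pi).
Proof.
move=> ew we; rewrite -{1}ew /lin_et map_mxD mulmxDr map_mxM mulmxA dotE we.
rewrite -scalemx1 scale0r mul0mx addr0.
by apply/matrixP => i j; rewrite !mxE summxE; apply: eq_bigr => h _; rewrite !mxE ord1.
Qed.

(** Conjugation by g turns the transvection of (v, w) into that of (g v, w g^-1). For a generator
    one of the two is g e or l g^-1, and these pair to 1, so the unimodular case applies. *)
Lemma lin_conj_dilatable g g' : lin_basis k ->
  elem_group lin_gen k g -> g *m g' = 1%:M -> forall i,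
  dilatable f S G (fun t => g *m lin_gen i k t *m g').
Proof.
move=> [n [b [b' [i0 [n3 bb btot bi0 b'i0]]]]] gE gg' i.
have good0 : (forall v, lin_et k *m v = v -> dot (b' i0) v = 0 ->
      dilatable f S G (lin_tv v (b' i0))) /\
    (forall w, w *m lin_et k = w -> dot w (b i0) = 0 ->
      dilatable f S G (lin_tv (b i0) w)).
  rewrite bi0 b'i0; split=> [v ev lv|w ew we].
    rewrite (lin_et_v ev lv); apply: (tv_dil_suml S1 SM G1 GM) => [j|j].
      by rewrite dotZr flpi mulr0.
    by apply: tv_dilZl => //; apply: (gen_dil (true, j)).
  rewrite (lin_et_w ew we); apply: (tv_dil_sumr S1 SM G1 GM) => [j|j].
    by rewrite dotZl fpie mulr0.
  by apply: tv_dilZr => //; apply: (gen_dil (false, j)).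
have g'g : g' *m g = 1%:M by apply: mulmx1C.
have etg := lin_elem_et gE.
have etg' : lin_et k *m g' = g' *m lin_et k.
  by rewrite -[LHS]mul1mx -g'g -mulmxA (mulmxA g) -etg -[_ *m g *m g']mulmxA gg' mulmx1.
have conj v w t : lin_tv (g *m v) (w *m g') t = g *m lin_tv v w t *m g'.
  rewrite /lin_tv mulmxDr mulmxDl mulmx1 gg' -scalemxAr -scalemxAl.
  by rewrite !mulmxA.
have dotg w v : dot (w *m g') (g *m v) = dot w v.
  by rewrite /dot mulmxA -[w *m g' *m g]mulmxA g'g mulmx1.
have etgv v : lin_et k *m v = v -> lin_et k *m (g *m v) = g *m v.
  by move=> ev; rewrite mulmxA etg -mulmxA ev.
have etgw w : w *m lin_et k = w -> w *m g' *m lin_et k = w *m g'.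
  by move=> ew; rewrite -mulmxA -etg' mulmxA ew.
case: i => [[] i]; rewrite /lin_gen /=; apply: dilatable_ext (conj _ _) _.
  apply: (tv_dil_uniml S1 SM S_den G1 GM n3 bb btot good0 (u := g *m map_mx k e)).
  - exact/etgv/lin_et_e.
  - exact/etgv/lin_et_pi.
  - exact/etgw/lin_l_et.
  - by rewrite dotg fle.
  - by rewrite dotg flpi.
apply: (tv_dil_unimr S1 SM S_den G1 GM n3 bb btot good0 (u := map_mx k l *m g')).
- exact/etgw/lin_l_et.
- exact/etgv/lin_et_e.
- exact/etgw/lin_pi_et.
- by rewrite dotg fle.
- by rewrite dotg fpie.
Qed.

End Conjugation.

Theorem lin_local_global (alpha alphaV : 'M[{poly R}]_N) :
  alpha *m alphaV = 1%:M -> map_mx (horner_eval 0) alpha = 1%:M ->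
  (forall M (hM : maximal_ideal M), lin_basis (loc (prime_of_maximal hM))) ->
  (forall M (hM : maximal_ideal M),
     elem_group lin_gen (cloc (prime_of_maximal hM))
       (map_mx (map_poly (loc (prime_of_maximal hM))) alpha)) ->
  elem_group lin_gen (polyC : R -> {poly R}) alpha.
Proof.
move=> aK a0 bas al.
apply: (elem_local_global lin_gen_map lin_gen_add lin_gen0 aK a0 al) => M hM.
set p := prime_of_maximal hM.
apply: (conjugates_dilateP (E := lin_gen)) => g g' gE gg' i.
apply: (lin_conj_dilatable (den2_1 p) (@den2M _ p) (@den2_surj _ p)
  (global_image1 lin_gen p) (@global_imageM _ _ _ lin_gen p)) => //.
  exact: (glob_dil_gen p lin_gen_map).
pose cc := polyC \o polyC : {rmorphism localization p -> {poly {poly localization p}}}.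
apply: (lin_basis_map (g := cc) (f := loc p)) (bas M hM) => r.
by rewrite cloc2E clocE.
Qed.

End LinearLocalGlobal.

(** * Unitary transvections *)

Section UnitaryTransvections.
Variables (K : comNzRingType) (N : nat) (J : 'M[K]_N) (lam hf : K).

Definition bf (x y : 'cV[K]_N) : K := (x^T *m J *m y) 0 0.
Definition rk (x y : 'cV[K]_N) : 'M[K]_N := x *m (y^T *m J).

Lemma bfDl x y z : bf (x + y) z = bf x z + bf y z.
Proof. by rewrite /bf linearD !mulmxDl mxE. Qed.
Lemma bfDr x y z : bf z (x + y) = bf z x + bf z y.
Proof. by rewrite /bf !mulmxDr mxE. Qed.
Lemma bfZl a x y : bf (a *: x) y = a * bf x y.
Proof. by rewrite /bf linearZ -!scalemxAl mxE. Qed.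
Lemma bfZr a x y : bf x (a *: y) = a * bf x y.
Proof. by rewrite /bf -!scalemxAr mxE. Qed.
Lemma bfNl x y : bf (- x) y = - bf x y.
Proof. by rewrite -scaleN1r bfZl mulN1r. Qed.
Lemma bfNr x y : bf x (- y) = - bf x y.
Proof. by rewrite -scaleN1r bfZr mulN1r. Qed.
Lemma bf0l x : bf 0 x = 0.
Proof. by rewrite -(scale0r x) bfZl mul0r. Qed.
Lemma bf0r x : bf x 0 = 0.
Proof. by rewrite -(scale0r x) bfZr mul0r. Qed.
Definition bfE := (bfDl, bfDr, bfZl, bfZr, bfNl, bfNr, bf0l, bf0r).

Lemma bf_suml (I : finType) (x : I -> 'cV[K]_N) y : bf (\sum_i x i) y = \sum_i bf (x i) y.
Proof. by elim/big_rec2: _ => [|i a b _ <-]; rewrite ?bf0l // bfDl. Qed.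
Lemma bf_sumr (I : finType) (x : I -> 'cV[K]_N) y : bf y (\sum_i x i) = \sum_i bf y (x i).
Proof. by elim/big_rec2: _ => [|i a b _ <-]; rewrite ?bf0r // bfDr. Qed.

Lemma rkDl x y z : rk (x + y) z = rk x z + rk y z.
Proof. by rewrite /rk mulmxDl. Qed.
Lemma rkDr x y z : rk z (x + y) = rk z x + rk z y.
Proof. by rewrite /rk linearD mulmxDl mulmxDr. Qed.
Lemma rkZl a x y : rk (a *: x) y = a *: rk x y.
Proof. by rewrite /rk -scalemxAl. Qed.
Lemma rkZr a x y : rk x (a *: y) = a *: rk x y.
Proof. by rewrite /rk linearZ -scalemxAl -scalemxAr. Qed.
Definition rkE := (rkDl, rkDr, rkZl, rkZr).

Lemma rk_app x y u : rk x y *m u = bf y u *: x.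
Proof. by rewrite /rk -!mulmxA [y^T *m _]mulmxA [_ *m u]mx11_scalar mul_mx_scalar. Qed.

Lemma rk_mul x y x' y' : rk x y *m rk x' y' = bf y x' *: rk x y'.
Proof. by rewrite {2}/rk mulmxA rk_app -scalemxAl. Qed.

Hypothesis JT : J^T = lam *: J.
Hypothesis lam_pm : lam = 1 \/ lam = -1.
Hypothesis hf2 : hf + hf = 1.

Lemma bfC x y : bf y x = lam * bf x y.
Proof.
transitivity ((y^T *m J *m x)^T 0 0); first by rewrite mxE.
by rewrite !trmx_mul trmxK JT mulmxA -scalemxAr -scalemxAl mxE.
Qed.

(** The Eichler-Siegel transvection, an isometry for w isotropic and v orthogonal to w; [hf] stands
    for 1/2 and v need not be isotropic. *)
Definition utv (w v : 'cV[K]_N) : 'M[K]_N :=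
  1%:M + rk v w - lam *: rk w v - (hf * bf v v) *: rk w w.
(* For lam = 1 this is the identity; for lam = -1 it is a symplectic transvection. *)
Definition long (w : 'cV[K]_N) (y : K) : 'M[K]_N := 1%:M + (hf * (1 - lam) * y) *: rk w w.

(** Lets [ring] work modulo hf + hf = 1: c is the certificate, the cofactor of that relation. *)
Lemma half_ring c (x y : K) : x - y = (hf + hf - 1) * c -> x = y.
Proof. by rewrite hf2 subrr mul0r => /eqP; rewrite subr_eq0 => /eqP. Qed.

Lemma entD (M M' : 'M[K]_N) i j : (M + M') i j = M i j + M' i j.
Proof. exact: mxE. Qed.
Lemma entN (M : 'M[K]_N) i j : (- M) i j = - M i j.
Proof. exact: mxE. Qed.
Lemma entZ a (M : 'M[K]_N) i j : (a *: M) i j = a * M i j.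
Proof. exact: mxE. Qed.
Lemma ent0 i j : (0 : 'M[K]_N) i j = 0.
Proof. exact: mxE. Qed.
Definition entE := (entD, entN, entZ, ent0).

Lemma mx_ringP (M M' : 'M[K]_N) : (forall i j, M i j = M' i j) -> M = M'.
Proof. by move=> h; apply/matrixP. Qed.

Definition mxexp := (mulmxDl, mulmxDr, mulmxBl, mulmxBr, mul1mx, mulmx1, mulNmx, mulmxN).

Lemma utv_app w v u : utv w v *m u =
  u + bf w u *: v - (lam * bf v u) *: w - (hf * bf v v * bf w u) *: w.
Proof. by rewrite /utv !mulmxBl mulmxDl mul1mx -!scalemxAl !rk_app !scalerA. Qed.

Lemma long_app w y u : long w y *m u = u + (hf * (1 - lam) * y * bf w u) *: w.
Proof. by rewrite /long mulmxDl mul1mx -scalemxAl rk_app scalerA. Qed.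

(** A Heisenberg group law: addition of vectors up to a central factor, which is trivial for lam =
    1. *)
Lemma utvD w v v' : bf w w = 0 -> bf w v = 0 -> bf w v' = 0 ->
  utv w v *m utv w v' = utv w (v + v') *m long w (bf v v').
Proof.
move=> ww wv wv'; have vw : bf v w = 0 by rewrite bfC wv mulr0.
have v'w : bf v' w = 0 by rewrite bfC wv' mulr0.
rewrite /utv /long !rkE !mxexp -?scalemxAl -?scalemxAr ?mxexp.
rewrite !rk_mul !bfE ?ww ?wv ?vw ?wv' ?v'w (bfC v v').
apply: mx_ringP => i j; rewrite !entE.
apply: (half_ring (c := lam * bf v v' * rk w w i j)); ring.
Qed.

Lemma lam2 : lam * lam = 1.
Proof. by case: lam_pm => ->; rewrite ?mulrNN mulr1. Qed.

Lemma long_lam w y : lam = 1 -> long w y = 1%:M.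
Proof. by move=> e; rewrite /long e subrr mulr0 mul0r scale0r addr0. Qed.

Lemma longD w y y' : bf w w = 0 -> long w (y + y') = long w y *m long w y'.
Proof.
move=> ww; rewrite /long !mxexp -?scalemxAl -?scalemxAr rk_mul ww scale0r.
by apply: mx_ringP => i j; rewrite !entE; ring.
Qed.

Lemma utv0 w : utv w 0 = 1%:M.
Proof. by rewrite -[0](scale0r 0) /utv !rkE !bfE; apply: mx_ringP => i j; rewrite !entE; ring. Qed.

Lemma long0 w : long w 0 = 1%:M.
Proof. by rewrite /long mulr0 scale0r addr0. Qed.

Lemma utv_self w c : bf w w = 0 -> utv w (c *: w) = long w (2%:R * c).
Proof.
move=> ww; rewrite /utv /long !rkE !bfE ww.
apply: mx_ringP => i j; rewrite !entE.
apply: (half_ring (c := - (1 - lam) * c * rk w w i j)); ring.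
Qed.

Lemma longDl x x' y : lam = -1 -> bf x x' = 0 -> bf x x = 0 -> bf x' x' = 0 ->
  long (x + x') y = long x y *m utv x (y *: x') *m long x' y.
Proof.
move=> e xx' xx x'x'; have x'x : bf x' x = 0 by rewrite bfC xx' mulr0.
rewrite /utv /long !rkE !bfE x'x' !mxexp -?scalemxAl -?scalemxAr ?mxexp.
rewrite -?scalemxAl -?scalemxAr !rk_mul ?xx' ?x'x ?xx ?x'x' !(scale0r, mul0mx, scaler0).
apply: mx_ringP => i j; rewrite !entE e.
apply: (half_ring (c := y * (rk x x' i j + rk x' x i j))); ring.
Qed.

Definition isom (g : 'M[K]_N) : Prop := g^T *m J *m g = J.

Lemma isomP g : (forall x y, bf (g *m x) (g *m y) = bf x y) -> isom g.
Proof.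
move=> h; apply/matrixP => i j.
have bfd M : ((delta_mx i 0 : 'cV[K]_N)^T *m M *m delta_mx j 0 : 'M[K]_1) 0 0 = M i j.
  by rewrite trmx_delta -rowE -colE !mxE.
by have := h (delta_mx i 0) (delta_mx j 0); rewrite /bf trmx_mul !bfd -!mulmxA !(mulmxA g^T)
  -mulmxA !mulmxA -[_ *m g^T *m J]mulmxA -[_ *m (g^T *m J) *m g]mulmxA !bfd.
Qed.

Lemma bf_isom g x y : isom g -> bf (g *m x) (g *m y) = bf x y.
Proof.
move=> gJ; rewrite /bf trmx_mul -[in RHS]gJ.
by congr (fun_of_matrix _ 0 0); rewrite !mulmxA.
Qed.

Lemma rk_conj g g' x y : isom g -> g *m g' = 1%:M ->
  g *m rk x y *m g' = rk (g *m x) (g *m y).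
Proof.
move=> gJ gg'; rewrite /rk trmx_mul.
have e : J *m g' = g^T *m J by rewrite -{1}gJ -mulmxA gg' mulmx1.
by rewrite -!mulmxA e.
Qed.

Lemma utv_conj g g' w v : isom g -> g *m g' = 1%:M ->
  g *m utv w v *m g' = utv (g *m w) (g *m v).
Proof.
move=> gJ gg'; rewrite /utv !mxexp gg' -?scalemxAr -?scalemxAl.
by rewrite !(rk_conj _ _ gJ gg') bf_isom.
Qed.

Lemma long_conj g g' w y : isom g -> g *m g' = 1%:M ->
  g *m long w y *m g' = long (g *m w) y.
Proof.
move=> gJ gg'; rewrite /long !mxexp gg' -?scalemxAr -?scalemxAl.
by rewrite (rk_conj _ _ gJ gg').
Qed.

Lemma bf_alt v : lam = -1 -> bf v v = 0.
Proof.
move=> e; have vv : bf v v + bf v v = 0 by rewrite {1}bfC e mulN1r addNr.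
by rewrite -[LHS]mul1r -hf2 mulrDl -mulrDr vv mulr0.
Qed.

Lemma utv_isom w v : bf w w = 0 -> bf w v = 0 -> isom (utv w v).
Proof.
move=> ww wv; have vw : bf v w = 0 by rewrite bfC wv mulr0.
apply: isomP => x y; rewrite !utv_app !bfE ww vw wv.
rewrite (bfC w x) (bfC v x).
case: lam_pm => e.
  by rewrite e; apply: (half_ring (c := - bf w x * bf w y * bf v v)); ring.
by rewrite (bf_alt v e) e; ring.
Qed.

Lemma long_isom w y : bf w w = 0 -> isom (long w y).
Proof.
move=> ww; apply: isomP => u v; rewrite !long_app !bfE ww (bfC w u).
by case: lam_pm => ->; ring.
Qed.

Lemma lam_bf v : (1 - lam) * bf v v = 0.
Proof.
by case: lam_pm => e; [rewrite e subrr mul0r|rewrite (bf_alt v e) mulr0].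
Qed.

Lemma utv_split w v v' : bf w w = 0 -> bf w v = 0 -> bf w v' = 0 ->
  (1 - lam) * bf v v' = 0 -> utv w (v + v') = utv w v *m utv w v'.
Proof.
move=> ww wv wv' h; rewrite utvD // /long -mulrA h mulr0 scale0r addr0 mulmx1 //.
Qed.

Lemma utvNK w v : bf w w = 0 -> bf w v = 0 -> utv w v *m utv w (- v) = 1%:M.
Proof.
move=> ww wv; rewrite -utv_split ?subrr ?utv0 // bfE ?wv ?oppr0 //.
by rewrite mulrN lam_bf oppr0.
Qed.

(** The central factor in [utvD] carries (1 - lam) <v, v>, which vanishes in both cases: 1 - lam =
    0, or the form is alternating. This gives the additivity in the parameter required of
    generators. *)
Lemma utvZD w v s t : bf w w = 0 -> bf w v = 0 ->
  utv w ((s + t) *: v) = utv w (s *: v) *m utv w (t *: v).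
Proof.
move=> ww wv; rewrite scalerDl utv_split // !bfE ?wv ?mulr0 //.
by rewrite mulrCA [t * _]mulrC mulrA mulrA [_ * (1 - _)]mulrC -!mulrA [bf v v * t]mulrC
  [(1 - lam) * _]mulrCA [(1 - lam) * _]mulrCA lam_bf !mulr0.
Qed.

Lemma utv_swapZ w v d : bf w w = 0 -> bf v v = 0 -> utv w (d *: v) = utv v (- lam * d *: w).
Proof.
move=> ww vv; rewrite /utv !rkE !bfE ww vv.
by apply: mx_ringP => i j; rewrite !entE; case: lam_pm => ->; ring.
Qed.

Section Commutators.
Variables h h' : 'cV[K]_N.
Hypotheses (hh : bf h h = 0) (h'h' : bf h' h' = 0) (hh' : bf h h' = 1).

Lemma utv_comm v x s t : bf v v = 0 -> bf h v = 0 -> bf h' v = 0 ->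
  bf h x = 0 -> bf h' x = 0 -> bf x v = 0 ->
  utv v ((s * t) *: x) =
  utv h' (s *: x) *m utv h (t *: - v) *m utv h' (- s *: x) *m utv h (- t *: - v) *m
  utv h' ((- lam * hf * bf x x * (s ^+ 2 * t)) *: v).
Proof.
move=> vv hv h'v hx h'x xv.
have h'h : bf h' h = lam by rewrite bfC hh' mulr1.
have vx : bf v x = 0 by rewrite bfC xv mulr0.
have vh : bf v h = 0 by rewrite bfC hv mulr0.
have vh' : bf v h' = 0 by rewrite bfC h'v mulr0.
have xh : bf x h = 0 by rewrite bfC hx mulr0.
have xh' : bf x h' = 0 by rewrite bfC h'x mulr0.
have gJ : isom (utv h' (s *: x)) by apply: utv_isom; rewrite ?bfE ?h'x ?mulr0.
have gg' : utv h' (s *: x) *m utv h' (- s *: x) = 1%:M.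
  by rewrite scaleNr utvNK ?bfE ?h'x ?mulr0.
rewrite (utv_conj _ _ gJ gg').
have -> : utv h' (s *: x) *m (t *: - v) = - t *: v.
  by rewrite scalerN scaleNr utv_app !bfE h'v xv !(mulr0, oppr0, scale0r, subr0, addr0).
have -> : utv h' (s *: x) *m h = h + ((lam * s) *: x + (- lam * hf * s ^+ 2 * bf x x) *: h').
  rewrite utv_app !bfE h'h xh !mulr0 scale0r subr0 scalerA -addrA -scaleNr.
  by congr (_ + (_ + _ *: _)); ring.
set y := (lam * s) *: x + _.
have yy : bf (h + y) (h + y) = 0.
  rewrite /y !bfE ?hh ?hh' ?hx ?xh ?xh' ?h'h ?h'x ?h'h'.
  case: lam_pm => e.
    by rewrite e; apply: (half_ring (c := - s ^+ 2 * bf x x)); ring.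
  by rewrite (bf_alt x e); ring.
rewrite (utv_swapZ (- t) yy vv).
have -> : - lam * - t *: (h + y) =
    (s * t) *: x + ((- hf * s ^+ 2 * t * bf x x) *: h' + (lam * t) *: h).
  rewrite /y addrC !scalerDr !scalerA -addrA mulNr mulrN opprK.
  congr (_ *: _ + (_ *: _ + _)); first by case: lam_pm => ->; ring.
  by case: lam_pm => ->; ring.
have lx c : (1 - lam) * (c * bf x x) = 0 by rewrite mulrCA lam_bf mulr0.
rewrite utv_split ?bfE ?vx ?vh ?vh' ?xh ?xh' ?mulr0 ?addr0 ?mulr0 //.
rewrite utv_split ?bfE ?vh ?vh' ?mulr0 //; last first.
  by rewrite h'h -[RHS](lx (lam * t * (- hf * s ^+ 2 * t) * lam)); ring.
rewrite scaleNr scalerN opprK (utv_swapZ t hh vv).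
have -> : utv v (- lam * t *: h) = utv v (- ((lam * t) *: h)) by rewrite mulNr scaleNr.
rewrite -!mulmxA (mulmxA (utv v ((lam * t) *: h))) utvNK ?bfE ?vh ?mulr0 // mul1mx.
rewrite (utv_swapZ _ h'h' vv).
have -> : utv v (- lam * (- lam * hf * bf x x * (s ^+ 2 * t)) *: h') =
   utv v (- ((- hf * s ^+ 2 * t * bf x x) *: h')).
  by congr utv; rewrite -scaleNr; congr (_ *: _); case: lam_pm => ->; ring.
by rewrite utvNK ?mulmx1 // bfE vh' mulr0.
Qed.

(** Conjugating [long h' t] by the transvection of (h, sv) moves h' to sv + h', and [longDl] expands
    the result. The leading term has parameter s^2 t since [long] is quadratic in its vector. *)
Lemma long_comm v s t : lam = -1 -> bf h v = 0 -> bf h' v = 0 ->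
  long v (s ^+ 2 * t) =
  utv h (s *: v) *m long h' t *m utv h (- s *: v) *m long h' (- t) *m
  utv h' ((- (s * t)) *: v).
Proof.
move=> e hv h'v.
have vv := bf_alt v e.
have vh : bf v h = 0 by rewrite bfC hv mulr0.
have vh' : bf v h' = 0 by rewrite bfC h'v mulr0.
have gJ : isom (utv h (s *: v)) by apply: utv_isom; rewrite ?bfE ?hv ?mulr0.
have gg' : utv h (s *: v) *m utv h (- s *: v) = 1%:M.
  by rewrite scaleNr utvNK ?bfE ?hv ?mulr0.
rewrite (long_conj _ _ gJ gg').
have -> : utv h (s *: v) *m h' = s *: v + h'.
  by rewrite utv_app !bfE hh' vv vh' !(mulr0, mul0r, mulr1, oppr0, scale0r, subr0, addr0) scale1r addrC.
rewrite longDl ?bfE ?vv ?vh' ?mulr0 //.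
have -> : long (s *: v) t = long v (s ^+ 2 * t).
  rewrite /long !rkE !scalerA; congr (_ + _ *: _); ring.
have -> : utv (s *: v) (t *: h') = utv h' ((s * t) *: v).
  rewrite /utv !rkE !bfE h'h' vv e.
  by apply: mx_ringP => i j; rewrite !entE; ring.
rewrite -!mulmxA (mulmxA (long h' t)) -longD // subrr long0 mul1mx.
by rewrite scaleNr utvNK ?mulmx1 // bfE h'v mulr0.
Qed.
End Commutators.

End UnitaryTransvections.

(** * Unitary transvections along unimodular isotropic vectors *)

Section UnitaryLocal.
Variables (C K : comNzRingType) (f : {rmorphism C -> K}) (S : C -> Prop).
Variables (N : nat) (G : 'M[K]_N -> Prop).
Hypothesis S1 : S 1.
Hypothesis SM : forall s t, S s -> S t -> S (s * t).
Hypothesis S_den : forall x : K, exists2 s, S s & exists x0, f x0 = f s * x.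
Hypothesis G1 : G 1%:M.
Hypothesis GM : forall M M', G M -> G M' -> G (M *m M').
Local Notation dil := (dilatable f S G).

Lemma dilatable_sqr F : dil F -> dil (fun t => F (t * t)).
Proof.
move=> [s Ss h]; exists s => // t.
by rewrite -rmorphM -mulrA; apply: h.
Qed.

Variables (J : 'M[K]_N) (lam hf : K).
Hypothesis JT : J^T = lam *: J.
Hypothesis lam_pm : lam = 1 \/ lam = -1.
Hypothesis hf2 : hf + hf = 1.
Local Notation bf := (bf J).
Local Notation utv := (utv J lam hf).
Local Notation long := (long J lam hf).
Let bfC x y : bf y x = lam * bf x y := bfC JT x y.

(** By [utvD] the sum differs from the product by [long w] with parameter -<v, v'> t^2; this is why
    [long w] has to be dilatable too. *)
Lemma utv_dilD w v v' : bf w w = 0 -> dil (long w) -> bf w v = 0 -> bf w v' = 0 ->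
  dil (fun t => utv w (t *: v)) -> dil (fun t => utv w (t *: v')) ->
  dil (fun t => utv w (t *: (v + v'))).
Proof.
move=> ww dw wv wv' dv dv'.
have d4 := dilatable_sqr (dilatable_scale SM S_den (- bf v v') dw).
have := dilatable_mul SM GM (dilatable_mul SM GM dv dv') d4.
apply: dilatable_ext => t /=.
rewrite (utvD JT hf2 ww) ?bfE ?wv ?wv' ?mulr0 // -mulmxA -(longD _ _ _ _ ww) scalerDr.
by rewrite [X in long _ X](_ : _ = 0) ?long0 ?mulmx1 //; ring.
Qed.

Lemma utv_dilZ w v a : dil (fun t => utv w (t *: v)) -> dil (fun t => utv w (t *: (a *: v))).
Proof.
move=> dv; have := dilatable_scale SM S_den a dv; apply: dilatable_ext => t.
by rewrite scalerA mulrC.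
Qed.

Lemma utv_dil0 w : dil (fun t => utv w (t *: 0)).
Proof. by apply: (dilatable_ext _ (dilatable1 f S1 G1)) => t; rewrite scaler0 utv0. Qed.

Lemma utv_dil_sum (I : finType) w (x : I -> 'cV[K]_N) : bf w w = 0 -> dil (long w) ->
  (forall i, bf w (x i) = 0) -> (forall i, dil (fun t => utv w (t *: x i))) ->
  dil (fun t => utv w (t *: \sum_i x i)).
Proof.
move=> ww dw wx dx.
suff [] : bf w (\sum_i x i) = 0 /\ dil (fun t => utv w (t *: \sum_i x i)) by [].
elim/big_ind: _ => [|u v [wu du] [wv dv]|i _] //.
- by split; [rewrite bf0r|apply: utv_dil0].
- by split; [rewrite bfDr wu wv addr0|apply: utv_dilD].
Qed.

(** Hyperbolic bases are indexed by a plane k and a Boolean, and [bar] exchanges the two partners of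
    a plane. The pairing of (k, false) with (k, true) is 1, the reverse one is lam. *)
Definition bar (I : Type) (i : I * bool) : I * bool := (i.1, ~~ i.2).

Lemma barK I : involutive (@bar I).
Proof. by case=> k s; rewrite /bar /= negbK. Qed.

Variables (et : 'M[K]_N) (m : nat) (b : 'I_m * bool -> 'cV[K]_N).
Definition hyp_sign (s : bool) : K := if s then lam else 1.
Hypothesis m3 : (3 <= m)%N.
Hypothesis bb : forall i j, bf (b i) (b j) = if j == bar i then hyp_sign i.2 else 0.
Hypothesis et_b : forall i, et *m b i = b i.
Hypothesis et_expand : forall x, et *m x = x ->
  x = \sum_i (hyp_sign (~~ i.2) * bf (b (bar i)) x) *: b i.

Let good i :=
  (forall v, et *m v = v -> bf (b i) v = 0 -> bf (b (bar i)) v = 0 ->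
     dil (fun t => utv (b i) (t *: v))) /\ dil (long (b i)).

Let bi0 i : bf (b i) (b i) = 0.
Proof. by rewrite bb; case: i => k [] /=; rewrite xpair_eqE andbF. Qed.

Let bft k : bf (b (k, false)) (b (k, true)) = 1.
Proof. by rewrite bb eqxx. Qed.

Let bfperp i j : i.1 != j.1 -> bf (b i) (b j) = 0.
Proof. by move=> ij; rewrite bb; case: eqP => // e; rewrite e eqxx in ij. Qed.

Section GoodPlane.
Variable k : 'I_m.
Hypotheses (gf : good (k, false)) (gt : good (k, true)).
Local Notation h := (b (k, false)).
Local Notation h' := (b (k, true)).

Lemma long_dil v : et *m v = v -> bf h v = 0 -> bf h' v = 0 -> dil (long v).
Proof.
move=> ev hv h'v; case: (lam_pm) => e.
  by apply: (dilatable_ext _ (dilatable1 f S1 G1)) => t; rewrite long_lam.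
have dL : dil (fun t => utv h' ((- t) *: v)).
  apply: (dilatable_ext (F := fun t => utv h' ((-1 * t) *: v))) => [t|].
    by rewrite mulN1r.
  by apply: (dilatable_scale SM S_den (-1) (gt.1 v ev _ _)).
apply: (dilatable_comm (a := 2) (b := 1) S1 SM GM _ (gf.1 v ev hv h'v) gt.2 dL) => s t.
by rewrite expr1; apply: (long_comm JT lam_pm hf2).
Qed.

Lemma utv_dil_perp v x : et *m v = v -> et *m x = x ->
  bf v v = 0 -> bf h v = 0 -> bf h' v = 0 ->
  bf h x = 0 -> bf h' x = 0 -> bf x v = 0 -> dil (fun t => utv v (t *: x)).
Proof.
move=> ev ex vv hv h'v hx h'x xv.
have dB : dil (fun t => utv h (t *: - v)).
  by apply: gf.1; rewrite ?mulmxN ?ev ?bfNr ?hv ?h'v ?oppr0.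
have dL := dilatable_scale SM S_den (- lam * hf * bf x x) (gt.1 v ev h'v hv).
apply: (dilatable_comm (a := 1) (b := 2) S1 SM GM _ (gt.1 x ex h'x hx) dB dL) => s t.
by rewrite expr1; apply: (utv_comm JT lam_pm hf2).
Qed.

(** The vector u is split along the plane (h, h') and its complement. The complement is
    [utv_dil_perp]; for the multiples of h and h', both isotropic, the transvection is turned around
    into one along h or h'. The pairing of h with h' leaves a factor [long v]. *)
Lemma utv_dil_all v u : et *m v = v -> et *m u = u ->
  bf v v = 0 -> bf h v = 0 -> bf h' v = 0 -> bf v u = 0 -> dil (fun t => utv v (t *: u)).
Proof.
move=> ev eu vv hv h'v vu.
have h'h : bf h' h = lam by rewrite bb eqxx.
have vh : bf v h = 0 by rewrite bfC hv mulr0.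
have vh' : bf v h' = 0 by rewrite bfC h'v mulr0.
set a := lam * bf h' u; set d := bf h u.
pose x := u - (a *: h + d *: h').
have hx : bf h x = 0.
  by rewrite /x bfDr bfNr bfDr !bfZr bi0 bft mulr0 add0r mulr1 subrr.
have h'x : bf h' x = 0.
  rewrite /x bfDr bfNr bfDr !bfZr bi0 h'h mulr0 addr0 /a mulrAC (lam2 lam_pm) mul1r.
  by rewrite subrr.
have ex : et *m x = x by rewrite /x mulmxBr mulmxDr -!scalemxAr !et_b eu.
have vx : bf v x = 0 by rewrite /x bfDr bfNr bfDr !bfZr vu vh vh' !mulr0 addr0 subr0.
have xh : bf x h = 0 by rewrite bfC hx mulr0.
have xh' : bf x h' = 0 by rewrite bfC h'x mulr0.
have xv : bf x v = 0 by rewrite bfC vx mulr0.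
have ux : u = x + (a *: h + d *: h') by rewrite /x subrK.
clearbody x a d.
have d1 := utv_dil_perp ev ex vv hv h'v hx h'x xv.
have d2 := dilatable_scale SM S_den (- lam * a) (gf.1 v ev hv h'v).
have d3 := dilatable_scale SM S_den (- lam * d) (gt.1 v ev h'v hv).
have d4 := dilatable_sqr (dilatable_scale SM S_den (- (a * d)) (long_dil ev hv h'v)).
have := dilatable_mul SM GM d1 (dilatable_mul SM GM (dilatable_mul SM GM d2 d3) d4).
apply: dilatable_ext => t /=.
have -> : t *: u = t *: x + ((t * a) *: h + (t * d) *: h').
  by rewrite {1}ux !scalerDr !scalerA.
rewrite (utv_split JT hf2) ?bfE ?vx ?vh ?vh' ?xh ?xh' ?mulr0 ?addr0 ?mulr0 //.
congr (_ *m _).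
have -> : utv h ((- lam * a * t) *: v) = utv v ((t * a) *: h).
  rewrite (utv_swapZ hf lam_pm _ (bi0 _) vv) (_ : - lam * (- lam * a * t) = t * a) //.
  by case: (lam_pm) => ->; ring.
have -> : utv h' ((- lam * d * t) *: v) = utv v ((t * d) *: h').
  rewrite (utv_swapZ hf lam_pm _ (bi0 _) vv) (_ : - lam * (- lam * d * t) = t * d) //.
  by case: (lam_pm) => ->; ring.
rewrite (utvD JT hf2 vv) ?bfE ?vh ?vh' ?mulr0 // -mulmxA -(longD _ _ _ _ vv) bft.
by rewrite [X in long _ X](_ : _ = 0) ?long0 ?mulmx1 //; ring.
Qed.

End GoodPlane.

Variable k0 : 'I_m.
Hypotheses (good0f : good (k0, false)) (good0t : good (k0, true)).

Lemma all_planes_good i : good i.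
Proof.
case: i => k s; have [->|kk0] := eqVneq k k0; first by case: s.
have k0k : k0 != k by rewrite eq_sym.
split=> [v ev iv biv|].
  by apply: (utv_dil_all good0f good0t) => //; apply: bfperp.
by apply: (long_dil good0f good0t) => //; apply: bfperp.
Qed.

Let gd := all_planes_good.

(** Since v is isotropic, the transvection can be read along v instead of w. Only v has to be
    orthogonal to a plane of the basis; w is an arbitrary isotropic vector. *)
Lemma utv_dil_iso w v k : et *m w = w -> et *m v = v -> bf w w = 0 -> bf v v = 0 ->
  bf (b (k, false)) v = 0 -> bf (b (k, true)) v = 0 -> bf v w = 0 ->
  dil (fun t => utv w (t *: v)).
Proof.
move=> ew ev ww vv hv h'v vw.
have := dilatable_scale SM S_den (- lam) (utv_dil_all (gd _) (gd _) ev ew vv hv h'v vw).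
by apply: dilatable_ext => t; rewrite (utv_swapZ hf lam_pm _ ww vv).
Qed.

(** In the symplectic case w is the sum of g in the plane [k0] and x orthogonal to it; x is treated
    with the plane [k0], g with another plane [k1], and [longDl] reassembles the two. *)
Lemma long_dil_all w : et *m w = w -> bf w w = 0 -> dil (long w).
Proof.
move=> ew ww; case: (lam_pm) => e.
  by apply: (dilatable_ext _ (dilatable1 f S1 G1)) => t; rewrite long_lam.
have [k1 /andP[k10 _]] := third m3 k0 k0.
set h := b (k0, false); set h' := b (k0, true).
have h'h : bf h' h = lam by rewrite bb eqxx.
pose g := (lam * bf h' w) *: h + bf h w *: h'.
pose x := w - g.
have hx : bf h x = 0.
  by rewrite /x bfDr bfNr bfDr !bfZr bi0 bft mulr0 add0r mulr1 subrr.
have h'x : bf h' x = 0.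
  rewrite /x bfDr bfNr bfDr !bfZr bi0 h'h mulr0 addr0 mulrAC (lam2 lam_pm) mul1r.
  by rewrite subrr.
have eg : et *m g = g by rewrite mulmxDr -!scalemxAr !et_b.
have ex : et *m x = x by rewrite /x mulmxBr eg ew.
have xg : bf x g = 0.
  by rewrite bfDr !bfZr (bfC h) (bfC h') hx h'x !mulr0 addr0.
have alt v := bf_alt JT hf2 v e.
have d1 := long_dil (gd _) (gd _) ex hx h'x.
have d2 := utv_dil_all (gd _) (gd _) ex eg (alt x) hx h'x xg.
have d3 : dil (long g).
  apply: (long_dil (gd (k1, false)) (gd _) eg); rewrite bfDr !bfZr !bfperp ?mulr0 ?addr0 //.
have := dilatable_mul SM GM (dilatable_mul SM GM d1 d2) d3.
by apply: dilatable_ext => t; rewrite -(longDl JT) ?alt // subrK.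
Qed.

Section Unimodular.
Variables w u : 'cV[K]_N.
Hypotheses (ew : et *m w = w) (ww : bf w w = 0) (eu : et *m u = u) (wu : bf w u = 1).

Let Z v := [/\ et *m v = v, bf w v = 0 & dil (fun t => utv w (t *: v))].

Let ZD v v' : Z v -> Z v' -> Z (v + v').
Proof.
move=> [ev wv dv] [ev' wv' dv']; split.
- by rewrite mulmxDr ev ev'.
- by rewrite bfDr wv wv' addr0.
exact: (utv_dilD ww (long_dil_all ew ww)).
Qed.

Let ZZ a v : Z v -> Z (a *: v).
Proof.
move=> [ev wv dv]; split; first by rewrite -scalemxAr ev.
  by rewrite bfZr wv mulr0.
exact: utv_dilZ.
Qed.

Let Z0 : Z 0.
Proof.
by split; rewrite ?mulmx0 ?bf0r //; apply: utv_dil0.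
Qed.

Let Z_sum (I : finType) (x : I -> 'cV[K]_N) : (forall i, Z (x i)) -> Z (\sum_i x i).
Proof. by move=> h; elim/big_ind: _ => //. Qed.

Let vv i j := bf w (b j) *: b i - bf w (b i) *: b j.

Let vvN i j : vv i j = - vv j i.
Proof. by rewrite /vv opprB. Qed.

(** Without partners, the Koszul vector is isotropic and orthogonal to the plane of a third
    index. *)
Let Z_off i j : j != bar i -> Z (vv i j).
Proof.
move=> jbi; have ev : et *m vv i j = vv i j.
  by rewrite /vv mulmxBr -!scalemxAr !et_b.
have wv : bf w (vv i j) = 0 by rewrite /vv bfDr bfNr !bfZr; ring.
have ibj : i != bar j by apply: contraNneq jbi => ->; rewrite barK.
have [k /andP[ki kj]] := third m3 i.1 j.1.
split=> //; apply: (utv_dil_iso (k := k)) => //.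
- rewrite /vv !bfE !bi0 !bb (negbTE jbi) (negbTE ibj); ring.
- by rewrite /vv !bfE !bfperp //; ring.
- by rewrite /vv !bfE !bfperp //; ring.
- by rewrite bfC wv mulr0.
Qed.

Let Z_w : Z w.
Proof.
split=> //.
have := dilatable_scale SM S_den 2%:R (long_dil_all ew ww); apply: dilatable_ext => t.
by rewrite utv_self.
Qed.

Let co (x : 'cV[K]_N) i := hyp_sign (~~ i.2) * bf (b (bar i)) x.

Let bfw x : et *m x = x -> bf w x = \sum_i co x i * bf w (b i).
Proof. by move=> /et_expand {1}->; rewrite bf_sumr; apply: eq_bigr => i _; rewrite bfZr. Qed.

(** Expanding w in the basis and using <w, w> = 0, the combination of the vectors [vv i j] with the
    coordinates of w is -<w, b_i> w. Every term but the partner one is known, and w itself is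
    covered by [utv_self]. *)
Let Z_bar i : Z (bf w (b i) *: vv i (bar i)).
Proof.
have e : \sum_j co w j *: vv i j = - bf w (b i) *: w.
  transitivity ((\sum_j co w j * bf w (b j)) *: b i - bf w (b i) *: (\sum_j co w j *: b j)).
    rewrite scaler_suml scaler_sumr -sumrB; apply: eq_bigr => j _.
    by rewrite /vv scalerBr !scalerA [bf w (b i) * _]mulrC.
  by rewrite -bfw // ww scale0r add0r -(et_expand ew) scaleNr.
have hs2 s : hyp_sign s * hyp_sign s = 1 by case: s; rewrite /= ?mulr1 // (lam2 lam_pm).
have -> : bf w (b i) *: vv i (bar i) =
    (lam * hyp_sign i.2) *: (- bf w (b i) *: w - \sum_(j | j != bar i) co w j *: vv i j).
  rewrite -e (bigD1 (bar i)) //= addrK scalerA; congr (_ *: _).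
  rewrite /co barK /= negbK (bfC w).
  have -> : lam * hyp_sign i.2 * (hyp_sign i.2 * (lam * bf w (b i))) =
    (lam * lam) * (hyp_sign i.2 * hyp_sign i.2) * bf w (b i) by ring.
  by rewrite hs2 (lam2 lam_pm) !mul1r.
apply: ZZ; apply: ZD; first by apply: ZZ.
rewrite -scaleN1r; apply: ZZ; elim/big_ind: _ => // j jbi.
by apply/ZZ/Z_off.
Qed.

Let Zvv i j : Z (vv i j).
Proof.
have [->|jbi] := eqVneq j (bar i); last exact: Z_off.
(* The factor 1 = <w, u> is inserted and expanded along the basis. *)
have -> : vv i (bar i) = \sum_k co u k *: (bf w (b k) *: vv i (bar i)).
  under eq_bigr do rewrite scalerA.
  by rewrite -scaler_suml -bfw // wu scale1r.
apply: Z_sum => k; apply: ZZ.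
have [->|ki] := eqVneq k i; first exact: Z_bar.
have [->|kbi] := eqVneq k (bar i).
  rewrite vvN scalerN -scaleN1r; apply: ZZ.
  by have := Z_bar (bar i); rewrite barK.
(* The three-term Koszul relation trades the partner pair for two pairs without partners. *)
have -> : bf w (b k) *: vv i (bar i) =
    bf w (b (bar i)) *: vv i k + (- bf w (b i)) *: vv (bar i) k.
  by apply/matrixP => r c; rewrite !mxE; ring.
by apply: ZD; apply: ZZ; apply: Z_off; rewrite ?barK.
Qed.

Lemma utv_dil_unim v : et *m v = v -> bf w v = 0 -> dil (fun t => utv w (t *: v)).
Proof.
move=> ev wv; suff [] : Z v by [].
have -> : v = \sum_i \sum_j (co u j * co v i) *: vv i j.
  by rewrite koszul_sum -(et_expand ev) -(et_expand eu) -!bfw // wu wv scale1r scale0r subr0.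
by apply: Z_sum => i; apply: Z_sum => j; apply/ZZ/Zvv.
Qed.

End Unimodular.
End UnitaryLocal.

(** * Local-global principle for the unitary elementary group *)

Section UnitaryLocalGlobal.
Variables (R : comNzRingType) (N : nat) (J : 'M[R]_N) (lam hf : R).
Hypothesis JT : J^T = lam *: J.
Hypothesis lam_pm : lam = 1 \/ lam = -1.
Hypothesis hf2 : hf + hf = 1.
Variables (et : 'M[R]_N) (e e' : 'cV[R]_N).
Hypotheses (etet : et *m et = et) (Jet : J *m et = J).
Hypotheses (ete : et *m e = e) (ete' : et *m e' = e').
Hypotheses (ee : bf J e e = 0) (e'e' : bf J e' e' = 0) (ee' : bf J e e' = 1).

(* The projection onto the orthogonal complement P of the hyperbolic plane (e, e'). *)
Definition perp_proj : 'M[R]_N := et - lam *: rk J e e' - rk J e' e.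
Local Notation pi := perp_proj.

Definition plane (s : bool) : 'cV[R]_N := if s then e' else e.

(** The columns of the projection generate P and need not be isotropic. The families indexed by
    [None] are the central factors of [utvD]; they are trivial in the orthogonal case. *)
Definition uni_gen (i : bool * option 'I_N) (A : comNzRingType) (f : R -> A) (t : A) :
    'M[A]_N :=
  let w := map_mx f (plane i.1) in
  if i.2 is Some j then utv (map_mx f J) (f lam) (f hf) w (t *: col j (map_mx f pi))
  else long (map_mx f J) (f lam) (f hf) w t.

Section Map.
Variables (A B : comNzRingType) (g : {rmorphism A -> B}) (n : nat) (H : 'M[A]_n) (l h : A).

Lemma map_bf x y : bf (map_mx g H) (map_mx g x) (map_mx g y) = g (bf H x y).
Proof. by rewrite /bf map_trmx -!map_mxM mxE. Qed.

Lemma map_rk x y : map_mx g (rk H x y) = rk (map_mx g H) (map_mx g x) (map_mx g y).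
Proof. by rewrite /rk !map_mxM map_trmx. Qed.

Lemma map_utv w v :
  map_mx g (utv H l h w v) = utv (map_mx g H) (g l) (g h) (map_mx g w) (map_mx g v).
Proof.
by rewrite /utv !map_mxB map_mxD map_mx1 !map_mxZ !map_rk map_bf rmorphM.
Qed.

Lemma map_long w y :
  map_mx g (long H l h w y) = long (map_mx g H) (g l) (g h) (map_mx g w) (g y).
Proof.
by rewrite /long map_mxD map_mx1 map_mxZ map_rk !rmorphM rmorphB (rmorph1 g).
Qed.

End Map.

Lemma uni_gen_map (A B : comNzRingType) (g : {rmorphism A -> B}) (f : R -> A) i t :
  map_mx g (uni_gen i f t) = uni_gen i (g \o f) (g t).
Proof.
rewrite /uni_gen; case: i.2 => [j|]; rewrite ?map_utv ?map_long -!map_mx_comp //.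
by rewrite map_mxZ map_col -map_mx_comp.
Qed.

Section Base.
Variables (A : comNzRingType) (f : {rmorphism R -> A}).
Local Notation fJ := (map_mx f J).

Lemma fJT : fJ^T = f lam *: fJ.
Proof. by rewrite map_trmx JT map_mxZ. Qed.

Lemma flam_pm : f lam = 1 \/ f lam = -1.
Proof. by case: lam_pm => ->; [left|right]; rewrite ?rmorphN rmorph1. Qed.

Lemma fhf2 : f hf + f hf = 1.
Proof. by rewrite -rmorphD hf2 rmorph1. Qed.

Lemma bf_et x y : bf J x (et *m y) = bf J x y.
Proof. by rewrite /bf mulmxA -[x^T *m J *m et]mulmxA Jet. Qed.

Lemma pi_app x : pi *m x = et *m x - (lam * bf J e' x) *: e - bf J e x *: e'.
Proof. by rewrite /pi !mulmxBl -scalemxAl !rk_app scalerA. Qed.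

Lemma bf_plane_pi s x : bf J (plane s) (pi *m x) = 0.
Proof.
have e'e : bf J e' e = lam by rewrite (bfC JT) ee' mulr1.
rewrite pi_app !bfE bf_et; case: s => /=.
  by rewrite e'e e'e' mulr0 subr0 mulrAC (lam2 lam_pm) mul1r subrr.
by rewrite ee ee' mulr0 subr0 mulr1 subrr.
Qed.

Lemma et_pi : et *m pi = pi.
Proof.
rewrite /perp_proj !mulmxBr etet -scalemxAr.
by rewrite /rk !mulmxA ete ete'.
Qed.

Lemma fplane_pi s j : bf fJ (map_mx f (plane s)) (col j (map_mx f pi)) = 0.
Proof. by rewrite -map_col map_bf colE bf_plane_pi rmorph0. Qed.

Lemma fplane0 s : bf fJ (map_mx f (plane s)) (map_mx f (plane s)) = 0.
Proof. by rewrite map_bf; case: s; rewrite /= ?ee ?e'e' rmorph0. Qed.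

Lemma uni_gen_add i s t : uni_gen i f (s + t) = uni_gen i f s *m uni_gen i f t.
Proof.
rewrite /uni_gen; case: i.2 => [j|].
  by apply: (utvZD fJT flam_pm fhf2); [apply: fplane0|apply: fplane_pi].
by apply: longD; apply: fplane0.
Qed.

Lemma uni_gen0 i : uni_gen i f 0 = 1%:M.
Proof. by rewrite /uni_gen; case: i.2 => [j|]; rewrite ?scale0r ?utv0 ?long0. Qed.

Local Notation fet := (map_mx f et).

Lemma fet_plane s : fet *m map_mx f (plane s) = map_mx f (plane s).
Proof. by rewrite -map_mxM; case: s; rewrite /= ?ete ?ete'. Qed.

Lemma fet_pi j : fet *m col j (map_mx f pi) = col j (map_mx f pi).
Proof. by rewrite colE mulmxA -map_mxM et_pi. Qed.

Lemma fet_rk x y : fet *m x = x -> fet *m rk fJ x y = rk fJ x y *m fet.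
Proof. by move=> ex; rewrite /rk mulmxA ex -!mulmxA -map_mxM Jet. Qed.

Lemma fet_utv w v : fet *m w = w -> fet *m v = v ->
  fet *m utv fJ (f lam) (f hf) w v = utv fJ (f lam) (f hf) w v *m fet.
Proof.
move=> ew ev; rewrite /utv !mulmxBr !mulmxDr !mulmxBl mulmxDl mulmx1 mul1mx.
by rewrite -!scalemxAl -!scalemxAr !fet_rk.
Qed.

Lemma fet_long w y : fet *m w = w ->
  fet *m long fJ (f lam) (f hf) w y = long fJ (f lam) (f hf) w y *m fet.
Proof.
move=> ew; rewrite /long mulmxDr mulmxDl mulmx1 mul1mx.
by rewrite -!scalemxAl -!scalemxAr !fet_rk.
Qed.

Lemma uni_elem_inv g : elem_group uni_gen f g -> isom fJ g /\ fet *m g = g *m fet.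
Proof.
have isomM a b : isom fJ a -> isom fJ b -> isom fJ (a *m b).
  rewrite /isom => ha hb; rewrite trmx_mul.
  transitivity (b^T *m (a^T *m fJ *m a) *m b); first by rewrite !mulmxA.
  by rewrite ha.
elim=> [|i t {}g _ [IH1 IH2]].
  by split; rewrite /isom ?trmx1 ?mul1mx ?mulmx1.
split.
  apply: isomM => //; rewrite /uni_gen; case: i.2 => [j|].
    by apply: (utv_isom fJT flam_pm fhf2); rewrite ?fplane0 // bfZr fplane_pi mulr0.
  by apply: long_isom; [exact: fJT|exact: flam_pm|exact: fplane0].
rewrite mulmxA -[RHS]mulmxA -IH2 mulmxA; congr (_ *m _).
rewrite /uni_gen; case: i.2 => [j|]; last exact/fet_long/fet_plane.
by apply: fet_utv; rewrite ?fet_plane // -scalemxAr fet_pi.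
Qed.

End Base.

Definition uni_basis (A : comNzRingType) (f : R -> A) : Prop :=
  exists m (b : 'I_m * bool -> 'cV[A]_N) (k0 : 'I_m),
  [/\ (3 <= m)%N,
      forall i j, bf (map_mx f J) (b i) (b j) = if j == bar i then hyp_sign (f lam) i.2 else 0,
      map_mx f et = \sum_i hyp_sign (f lam) (~~ i.2) *: rk (map_mx f J) (b i) (b (bar i)),
      forall i, map_mx f et *m b i = b i
    & forall s, b (k0, s) = map_mx f (plane s)].

Lemma uni_basis_map (A B : comNzRingType) (g : {rmorphism A -> B}) (f : R -> A) h :
  g \o f =1 h -> uni_basis f -> uni_basis h.
Proof.
move=> /funext <- [m [b [k0 [m3 bb btot etb bk0]]]].
have hs s : hyp_sign (g (f lam)) s = g (hyp_sign (f lam) s).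
  by case: s => //=; rewrite rmorph1.
exists m, (fun i => map_mx g (b i)), k0; split=> //.
- move=> i j; rewrite map_mx_comp map_bf bb /= hs.
  by case: ifP => // _; rewrite rmorph0.
- rewrite map_mx_comp btot raddf_sum /=; apply: eq_bigr => i _.
  by rewrite map_mxZ map_rk hs map_mx_comp.
- by move=> i; rewrite map_mx_comp -map_mxM etb.
- by move=> s; rewrite bk0 -map_mx_comp.
Qed.

Section Conjugation.
Variables (C K : comNzRingType) (f : {rmorphism C -> K}) (S : C -> Prop).
Variables (G : 'M[K]_N -> Prop) (k : {rmorphism R -> K}).
Hypothesis S1 : S 1.
Hypothesis SM : forall s t, S s -> S t -> S (s * t).
Hypothesis S_den : forall x : K, exists2 s, S s & exists x0, f x0 = f s * x.
Hypothesis G1 : G 1%:M.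
Hypothesis GM : forall M M', G M -> G M' -> G (M *m M').
Hypothesis gen_dil : forall i, dilatable f S G (uni_gen i k).
Local Notation kJ := (map_mx k J).
Local Notation kutv := (utv kJ (k lam) (k hf)).

Lemma perp_dilatable s v : map_mx k et *m v = v ->
  bf kJ (map_mx k e) v = 0 -> bf kJ (map_mx k e') v = 0 ->
  dilatable f S G (fun t => kutv (map_mx k (plane s)) (t *: v)).
Proof.
move=> ev bv b'v.
have -> : v = \sum_j v j 0 *: col j (map_mx k pi).
  transitivity (map_mx k pi *m v).
    rewrite /perp_proj !map_mxB map_mxZ !map_rk !mulmxBl -scalemxAl !rk_app bv b'v ev.
    by rewrite !scale0r scaler0 !subr0.
  by apply/matrixP => i j; rewrite !mxE summxE; apply: eq_bigr => h _; rewrite !mxE mulrC ord1.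
apply: (utv_dil_sum S1 SM S_den G1 GM (fJT k) (fhf2 k)) => [||j|j].
- exact: fplane0.
- exact: (gen_dil (s, None)).
- by rewrite bfZr fplane_pi mulr0.
- by apply: utv_dilZ => //; apply: (gen_dil (s, Some j)).
Qed.

(** An elementary g is an isometry commuting with the idempotent, so conjugation replaces the vector
    of the plane by its image, still isotropic and unimodular in the image of the idempotent. *)
Lemma uni_conj_dilatable g g' : uni_basis k ->
  elem_group uni_gen k g -> g *m g' = 1%:M -> forall i,
  dilatable f S G (fun t => g *m uni_gen i k t *m g').
Proof.
move=> [m [b [k0 [m3 bb btot etb bk0]]]] gE gg' i.
have [gJ etg] := uni_elem_inv gE.
have good s : (forall v, map_mx k et *m v = v -> bf kJ (b (k0, s)) v = 0 ->
      bf kJ (b (bar (k0, s))) v = 0 ->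
      dilatable f S G (fun t => kutv (b (k0, s)) (t *: v))) /\
    dilatable f S G (long kJ (k lam) (k hf) (b (k0, s))).
  split=> [v ev|]; last by rewrite bk0; apply: (gen_dil (s, None)).
  rewrite /bar !bk0 => h h'; apply: perp_dilatable => //.
    by case: s h h'.
  by case: s h h'.
have expand x : map_mx k et *m x = x ->
    x = \sum_i (hyp_sign (k lam) (~~ i.2) * bf kJ (b (bar i)) x) *: b i.
  move=> {1}<-; rewrite btot mulmx_suml; apply: eq_bigr => j _.
  by rewrite -scalemxAl rk_app scalerA.
have etgv v : map_mx k et *m v = v -> map_mx k et *m (g *m v) = g *m v.
  by move=> ev; rewrite mulmxA etg -mulmxA ev.
case: i => s [j|]; rewrite /uni_gen /=; last first.
  apply: (dilatable_ext (F := long kJ (k lam) (k hf) (g *m map_mx k (plane s)))) => [t|].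
    by rewrite (long_conj _ _ _ _ gJ gg').
  apply: (long_dil_all S1 SM S_den G1 GM (fJT k) (flam_pm k) (fhf2 k) m3 bb etb (good false) (good true)).
    by apply/etgv/fet_plane.
  by rewrite (bf_isom _ _ gJ) fplane0.
(* The image of the hyperbolic partner, with the sign that makes its pairing with the new w equal to
   1: <e', e> is lam, and lam^2 = 1. *)
pose u := (if s then k lam else 1) *: (g *m map_mx k (plane (~~ s))).
apply: (dilatable_ext (F := fun t => kutv (g *m map_mx k (plane s)) (t *: (g *m col j (map_mx k pi))))) => [t|].
  by rewrite (utv_conj _ _ _ _ gJ gg') scalemxAr.
apply: (utv_dil_unim S1 SM S_den G1 GM (fJT k) (flam_pm k) (fhf2 k) m3 bb etb expand
  (good false) (good true) (u := u)).
- by apply/etgv/fet_plane.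
- by rewrite (bf_isom _ _ gJ) fplane0.
- by rewrite -scalemxAr etgv ?fet_plane.
- rewrite bfZr (bf_isom _ _ gJ) map_bf.
  case: s {u} => /=; last by rewrite ee' rmorph1 mulr1.
  by rewrite (bfC JT) ee' mulr1 -rmorphM (lam2 lam_pm) rmorph1.
- by apply/etgv/fet_pi.
- by rewrite (bf_isom _ _ gJ) fplane_pi.
Qed.

End Conjugation.

Theorem uni_local_global (alpha alphaV : 'M[{poly R}]_N) :
  alpha *m alphaV = 1%:M -> map_mx (horner_eval 0) alpha = 1%:M ->
  (forall M (hM : maximal_ideal M), uni_basis (loc (prime_of_maximal hM))) ->
  (forall M (hM : maximal_ideal M),
     elem_group uni_gen (cloc (prime_of_maximal hM))
       (map_mx (map_poly (loc (prime_of_maximal hM))) alpha)) ->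
  elem_group uni_gen (polyC : R -> {poly R}) alpha.
Proof.
move=> aK a0 bas al.
apply: (elem_local_global uni_gen_map uni_gen_add uni_gen0 aK a0 al) => M hM.
set p := prime_of_maximal hM.
apply: (conjugates_dilateP (E := uni_gen)) => g g' gE gg' i.
apply: (uni_conj_dilatable (den2_1 p) (@den2M _ p) (@den2_surj _ p)
  (global_image1 uni_gen p) (@global_imageM _ _ _ uni_gen p)) => //.
  exact: (glob_dil_gen p uni_gen_map).
pose cc := polyC \o polyC : {rmorphism localization p -> {poly {poly localization p}}}.
apply: (uni_basis_map (g := cc) (f := loc p)) (bas M hM) => r.
by rewrite cloc2E clocE.
Qed.

End UnitaryLocalGlobal.

(** * Coordinates *)

Lemma eq_cols (A : Type) m n (B C : 'M[A]_(m, n)) :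
  (forall j, col j B = col j C) -> B = C.
Proof.
move=> h; apply/matrixP => i j.
by have := congr1 (fun v : 'cV_m => v i 0) (h j); rewrite !mxE.
Qed.

Lemma colM (A : comNzRingType) m n r (B : 'M[A]_(m, n)) (C : 'M[A]_(n, r)) j :
  col j (B *m C) = B *m col j C.
Proof. by rewrite !colE mulmxA. Qed.

Section DualBases.
Variables (A : comNzRingType) (M : lmodType A).

Lemma scalar_pack (g : M -> A) : scalar g -> exists G : {scalar M}, forall u, G u = g u.
Proof.
move=> gl; pose L := GRing.isLinear.Build A M A *%R g gl.
by exists (HB.pack_for {scalar M} g L).
Qed.

Lemma scalar_sum (g : M -> A) n (c : 'I_n -> A) (x : 'I_n -> M) : scalar g ->
  g (\sum_i c i *: x i) = \sum_i c i * g (x i).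
Proof.
move=> /scalar_pack[G e]; rewrite -e linear_sum; apply: eq_bigr => i _.
by rewrite linearZ /= e.
Qed.

(** The coordinate forms are plain functions with a linearity proof, because their base changes
    arise as values of [lift], which carry no bundled structure. *)
Record dual_basis n (X : 'I_n -> M) (Phi : 'I_n -> M -> A) : Prop := DualBasis {
  db_scalar : forall i, scalar (Phi i);
  db_sum : forall u, u = \sum_i Phi i u *: X i }.

Variables (n : nat) (X : 'I_n -> M) (Phi : 'I_n -> M -> A).
Hypothesis db : dual_basis X Phi.

Definition coords (u : M) : 'cV[A]_n := \col_i Phi i u.
Definition db_mx : 'M[A]_n := \matrix_(i, j) Phi i (X j).
Definition db_comb (v : 'cV[A]_n) : M := \sum_i v i 0 *: X i.

Lemma coords_linear a u v : coords (a *: u + v) = a *: coords u + coords v.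
Proof. by apply/matrixP => i j; rewrite !mxE (db_scalar db). Qed.

Lemma coords0 : coords 0 = 0.
Proof.
by have := coords_linear (-1) 0 0; rewrite scaler0 addr0 scaleN1r addNr.
Qed.

Lemma coordsD u v : coords (u + v) = coords u + coords v.
Proof. by have := coords_linear 1 u v; rewrite !scale1r. Qed.

Lemma coordsZ a u : coords (a *: u) = a *: coords u.
Proof. by have := coords_linear a u 0; rewrite !addr0 coords0 addr0. Qed.

Lemma coordsB u v : coords (u - v) = coords u - coords v.
Proof. by rewrite coordsD -scaleN1r coordsZ scaleN1r. Qed.

Lemma coords_sum (I : finType) (c : I -> A) (x : I -> M) :
  coords (\sum_i c i *: x i) = \sum_i c i *: coords (x i).
Proof.
by elim/big_rec2: _ => [|i y u _ <-]; [exact: coords0|rewrite coordsD coordsZ].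
Qed.

Lemma coordsK u : db_comb (coords u) = u.
Proof. by rewrite [RHS](db_sum db); apply: eq_bigr => i _; rewrite mxE. Qed.

Lemma coords_inj u v : coords u = coords v -> u = v.
Proof. by move=> e; rewrite -(coordsK u) e coordsK. Qed.

Lemma coords_comb v : coords (db_comb v) = db_mx *m v.
Proof.
rewrite /db_comb coords_sum; apply/matrixP => i j; rewrite !mxE summxE.
by apply: eq_bigr => k _; rewrite !mxE mulrC ord1.
Qed.

Lemma db_mx_coords u : db_mx *m coords u = coords u.
Proof. by rewrite -coords_comb coordsK. Qed.

Lemma col_db_mx j : col j db_mx = coords (X j).
Proof. by apply/matrixP => i k; rewrite !mxE. Qed.

Lemma db_mx_idem : db_mx *m db_mx = db_mx.
Proof. by apply: eq_cols => j; rewrite colM col_db_mx db_mx_coords. Qed.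

Lemma scalar_coords (g : M -> A) u : scalar g ->
  (\row_j g (X j)) *m coords u = (g u)%:M.
Proof.
move=> gl; rewrite [RHS](_ : _ = (\sum_i Phi i u * g (X i))%:M); last first.
  by rewrite -(scalar_sum _ _ gl) -(db_sum db).
apply/matrixP => i j; rewrite !mxE !ord1 eqxx mulr1n; apply: eq_bigr => k _.
by rewrite !mxE mulrC.
Qed.

End DualBases.

(** A generating family gives a surjection from R^n onto P; the components of a section are the
    coordinate forms. *)
Lemma projective_dual_basis (R : comNzRingType) (P : lmodType R) :
  finitely_generated P -> projective P ->
  exists n (x : 'I_n -> P) phi, dual_basis x phi.
Proof.
move=> [n [g gP]] projP.
pose e0 (c : 'rV[R]_n) : P := \sum_i c 0 i *: g i.
have e0l : linear e0.
  move=> a u v; rewrite /e0 scaler_sumr -big_split; apply: eq_bigr => i _.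
  by rewrite !mxE scalerDl scalerA.
pose L := GRing.isLinear.Build R 'rV[R]_n P *:%R e0 e0l.
pose e : {linear 'rV[R]_n -> P} := HB.pack_for {linear 'rV[R]_n -> P} e0 L.
have [|h hP] := projP _ _ e idfun.
  move=> y; have [c ->] := gP y; exists (\row_i c i).
  by apply: eq_bigr => i _; rewrite mxE.
exists n, g, (fun i u => h u 0 i); split.
  by move=> i a u v; rewrite linearP !mxE.
by move=> u; rewrite -[LHS]hP.
Qed.

Section BaseChangeDual.
Variables (R S : comNzRingType) (f : {rmorphism R -> S}) (M : lmodType R).

Definition bc_phi (g : M -> R) : basechange f M -> S :=
  BaseChange.lift (fun s x => s * f (g x)).
Definition bc1 (x : M) : basechange f M := BaseChange.pure f 1 x.

Lemma bc1_scale (a : R) x : bc1 (a *: x) = f a *: bc1 x.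
Proof. by rewrite /bc1 BaseChange.scale_pure mulr1 -BaseChange.pure_scale mul1r. Qed.

Lemma bc1D x y : bc1 (x + y) = bc1 x + bc1 y.
Proof. exact: BaseChange.pureDr. Qed.

Lemma bc1_0 : bc1 0 = 0.
Proof. by rewrite -(scale0r 0) bc1_scale rmorph0 scale0r. Qed.

Lemma bc1_sum (I : finType) (x : I -> M) : bc1 (\sum_i x i) = \sum_i bc1 (x i).
Proof. by elim/big_rec2: _ => [|i y u _ <-]; [exact: bc1_0|exact: bc1D]. Qed.

Lemma pureE s x : BaseChange.pure f s x = s *: bc1 x.
Proof. by rewrite /bc1 BaseChange.scale_pure mulr1. Qed.

Lemma bc_phi_balanced (g : M -> R) : scalar g ->
  BaseChange.balanced f (fun s x => s * f (g x)).
Proof.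
move=> /scalar_pack[G e]; split=> [x s t|s x y|s r x]; rewrite -?e.
- exact: mulrDl.
- by rewrite linearD rmorphD mulrDr !e.
- by rewrite linearZ rmorphM mulrA !e.
Qed.

Lemma bc_phi_pure (g : M -> R) s x : scalar g -> bc_phi g (BaseChange.pure f s x) = s * f (g x).
Proof. by move=> /bc_phi_balanced h; rewrite /bc_phi BaseChange.lift_pure. Qed.

Lemma bc_phi1 (g : M -> R) x : scalar g -> bc_phi g (bc1 x) = f (g x).
Proof. by move=> h; rewrite bc_phi_pure // mul1r. Qed.

Lemma bc_phiD (g : M -> R) u v : scalar g -> bc_phi g (u + v) = bc_phi g u + bc_phi g v.
Proof. by move=> /bc_phi_balanced h; apply: BaseChange.liftD. Qed.

Lemma bc_phi_scalar (g : M -> R) : scalar g -> scalar (bc_phi g).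
Proof.
move=> h a u v; rewrite bc_phiD //; congr (_ + _).
elim/BaseChange.pure_ind: u => [|s x|u w IHu IHw].
- have z : bc_phi g 0 = 0 by apply: (addrI (bc_phi g 0)); rewrite -bc_phiD // !addr0.
  by rewrite scaler0 z mulr0.
- by rewrite BaseChange.scale_pure !bc_phi_pure // mulrA.
- by rewrite scalerDr !bc_phiD // IHu IHw mulrDr.
Qed.

Lemma bc_dual_basis n (x : 'I_n -> M) phi : dual_basis x phi ->
  dual_basis (fun i => bc1 (x i)) (fun i => bc_phi (phi i)).
Proof.
move=> db; split=> [i|u]; first exact/bc_phi_scalar/(db_scalar db).
elim/BaseChange.pure_ind: u => [|s y|u w IHu IHw].
- by rewrite big1 // => i _; have [G e] := scalar_pack (bc_phi_scalar (db_scalar db i));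
    rewrite -e linear0 scale0r.
- rewrite [LHS]pureE {1}(db_sum db y) bc1_sum scaler_sumr; apply: eq_bigr => i _.
  by rewrite bc1_scale scalerA bc_phi_pure //; apply: (db_scalar db).
- rewrite {1}IHu {1}IHw -big_split; apply: eq_bigr => i _.
  by rewrite bc_phiD ?scalerDl //; apply: (db_scalar db).
Qed.

End BaseChangeDual.
Arguments bc_phi {R S} f {M} g u.
Arguments bc1 {R S} f {M} x.

Lemma prod_ext (T U : Type) (u v : T * U) : u.1 = v.1 -> u.2 = v.2 -> u = v.
Proof. by case: u v => [a b] [c d] /= -> ->. Qed.

(** * Matrix form of the linear transvections *)

Section LinCoords.
Variables (A : comNzRingType) (M : lmodType A) (n : nat).
Variables (x : 'I_n -> M) (phi : 'I_n -> M -> A).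

Definition linX (i : 'I_n.+1) : linQ M :=
  if unlift ord0 i is Some k then (x k, 0) else (0, 1).
Definition linPhi (i : 'I_n.+1) (u : linQ M) : A :=
  if unlift ord0 i is Some k then phi k u.1 else u.2.

Hypothesis db : dual_basis x phi.

Lemma lin_dual_basis : dual_basis linX linPhi.
Proof.
split=> [i a u v|u]; rewrite /linPhi /linX.
  by case: (unlift _ i) => // k; rewrite -(db_scalar db).
rewrite big_ord_recl unlift_none; under eq_bigr do rewrite liftK.
rewrite [u in LHS]surjective_pairing {1}(db_sum db u.1).
rewrite -[_ *: (0, 1)]/((u.2 *: 0, u.2 * 1)) scaler0 mulr1.
have -> : \sum_i phi i u.1 *: (x i, 0) = (\sum_i phi i u.1 *: x i, 0) :> linQ M.
  elim/big_rec2: _ => // i y v _ ->.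
  by apply: prod_ext => //=; rewrite scaler0 addr0.
by apply: prod_ext; rewrite /= ?add0r ?addr0.
Qed.

Local Notation co := (coords linPhi).
Definition lin_e : 'cV[A]_n.+1 := co (0, 1).
Definition lin_l : 'rV[A]_n.+1 := \row_j (linX j).2.
Definition lin_pi : 'M[A]_n.+1 := db_mx linX linPhi - lin_e *m lin_l.

Lemma snd_scalar : scalar (fun u : linQ M => u.2 : A). Proof. by []. Qed.

Lemma lin_l_coords u : lin_l *m co u = (u.2)%:M.
Proof. exact: (scalar_coords lin_dual_basis _ snd_scalar). Qed.

Lemma lin_pi_coords u : lin_pi *m co u = co (u.1, 0).
Proof.
rewrite mulmxBl (db_mx_coords lin_dual_basis) -mulmxA lin_l_coords mul_mx_scalar.
rewrite -(coordsZ lin_dual_basis) -(coordsB lin_dual_basis); congr co.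
apply: prod_ext; rewrite /= ?scaler0 ?subr0 //.
by rewrite -[_ *: _]/(_ * 1) mulr1 subrr.
Qed.

Lemma col_lin_pi j : col j lin_pi = co ((linX j).1, 0).
Proof.
rewrite -lin_pi_coords -col_db_mx -colM /lin_pi mulmxBl (db_mx_idem lin_dual_basis).
by congr (col _ (_ - _)); rewrite -mulmxA; congr (_ *m _);
   apply: eq_cols => k; rewrite colM col_db_mx lin_l_coords;
   apply/matrixP => a b; rewrite !mxE !ord1 eqxx mulr1n.
Qed.

Lemma lin_le1 : lin_l *m lin_e = 1%:M.
Proof. by rewrite lin_l_coords. Qed.

Lemma lin_lpi : lin_l *m lin_pi = 0.
Proof.
apply: eq_cols => j; rewrite colM col_lin_pi lin_l_coords.
by apply/matrixP => a b; rewrite !mxE mul0rn.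
Qed.

Lemma lin_pie : lin_pi *m lin_e = 0.
Proof. by rewrite lin_pi_coords (coords0 lin_dual_basis). Qed.

Lemma lin_pipi : lin_pi *m lin_pi = lin_pi.
Proof. by apply: eq_cols => j; rewrite colM col_lin_pi lin_pi_coords. Qed.

Lemma row_lin_pi i u : dot (row i lin_pi) (co u) = linPhi i (u.1, 0).
Proof. by rewrite /dot -row_mul lin_pi_coords !mxE. Qed.

Lemma lin_et_tot : lin_pi + lin_e *m lin_l = db_mx linX linPhi.
Proof. by rewrite subrK. Qed.

Section Transfer.
Variables (R : comNzRingType) (f : {rmorphism R -> A}).
Variables (e : 'cV[R]_n.+1) (l : 'rV[R]_n.+1) (pi : 'M[R]_n.+1).
Hypotheses (fe : map_mx f e = lin_e) (fl : map_mx f l = lin_l).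
Hypothesis fpi : map_mx f pi = lin_pi.
Local Notation EL := (elem_group (lin_gen e l pi) f).

Lemma lin_elem_ET F : EL F -> exists2 g, @ET_lin A M g & forall u, co (g u) = F *m co u.
Proof.
elim=> [|[[] i] t {}F _ [g gE eg]].
- by exists id => [|u]; [exact: subgroup_gen_id|rewrite mul1mx].
- exists ((fun u => (u.1 + (u.2 : A) *: (t *: (linX i).1), u.2)) \o g) => [|u].
    by apply: subgroup_gen_comp gE; apply/subgroup_gen_in/LinTransvectionP.
  rewrite /= /lin_gen /= fl fpi -mulmxA -eg /lin_tv mulmxDl mul1mx.
  rewrite -scalemxAl -mulmxA lin_l_coords mul_mx_scalar col_lin_pi.
  rewrite -!(coordsZ lin_dual_basis) -(coordsD lin_dual_basis); congr co.
  by apply: prod_ext; rewrite /= ?scaler0 ?addr0 // !scalerA mulrC.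
- have [|psi epsi] := @scalar_pack A M (fun y => t * linPhi i (y, 0)).
    move=> a y z; have -> : (a *: y + z, 0) = a *: (y, 0) + (z, 0) :> linQ M.
      by apply: prod_ext; rewrite /= ?scaler0 ?addr0.
    by rewrite (db_scalar lin_dual_basis) mulrDr mulrCA.
  exists ((fun u => (u.1, u.2 + psi u.1)) \o g) => [|u].
    by apply: subgroup_gen_comp gE; apply/subgroup_gen_in/LinTransvectionR.
  rewrite /= /lin_gen /= fe fpi -mulmxA -eg /lin_tv mulmxDl mul1mx.
  rewrite -scalemxAl -mulmxA dotE row_lin_pi mul_mx_scalar.
  rewrite -!(coordsZ lin_dual_basis) -(coordsD lin_dual_basis); congr co.
  apply: prod_ext; rewrite /= ?scaler0 ?addr0 ?epsi //.
  by rewrite -[(linPhi _ _)%:A]/(_ * 1) mulr1.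
Qed.

Lemma lin_tv_elem_sumv (c : 'I_n.+1 -> A) :
  EL (lin_tv (\sum_i c i *: col i lin_pi) lin_l 1).
Proof.
suff [] : dot lin_l (\sum_i c i *: col i lin_pi) = 0 /\
  EL (lin_tv (\sum_i c i *: col i lin_pi) lin_l 1) by [].
elim/big_ind: _ => [|u v [u0 hu] [v0 hv]|i _].
- by rewrite dot0r /lin_tv mul0mx scaler0 addr0; split=> //; apply: elem_group1.
- by rewrite dotDr u0 v0 addr0 lin_tvDl //; split=> //; apply: elem_mul.
- rewrite dotZr lin_tvZl mulr1 -fl -fpi; split; last exact: (@elem_gen _ _ _ _ _ _ (true, i)).
  by rewrite /dot colE mulmxA fl fpi lin_lpi mul0mx mxE mulr0.
Qed.

Lemma lin_tv_elem_sumr (c : 'I_n.+1 -> A) :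
  EL (lin_tv lin_e (\sum_i c i *: row i lin_pi) 1).
Proof.
suff [] : dot (\sum_i c i *: row i lin_pi) lin_e = 0 /\
  EL (lin_tv lin_e (\sum_i c i *: row i lin_pi) 1) by [].
elim/big_ind: _ => [|u v [u0 hu] [v0 hv]|i _].
- by rewrite dot0l /lin_tv mulmx0 scaler0 addr0; split=> //; apply: elem_group1.
- by rewrite dotDl u0 v0 addr0 lin_tvDr //; split=> //; apply: elem_mul.
- rewrite dotZl lin_tvZr mulr1 -fe -fpi; split; last exact: (@elem_gen _ _ _ _ _ _ (false, i)).
  by rewrite /dot rowE -mulmxA fe fpi lin_pie mulmx0 mxE mulr0.
Qed.

Lemma lin_elem_inv F : EL F -> exists2 F', EL F' & F *m F' = 1%:M.
Proof.
elim=> [|i t {}F _ [F' h eF]]; first by exists 1%:M; [exact: elem_group1|rewrite mulmx1].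
have dl j : dot lin_l (col j lin_pi) = 0.
  by rewrite /dot colE mulmxA lin_lpi mul0mx mxE.
have dr j : dot (row j lin_pi) lin_e = 0.
  by rewrite /dot rowE -mulmxA lin_pie mulmx0 mxE.
have EN : lin_gen e l pi i f t *m lin_gen e l pi i f (- t) = 1%:M.
  by rewrite /lin_gen; case: i.1; rewrite ?fe ?fl ?fpi -lin_tvD ?dl ?dr // subrr
    /lin_tv scale0r addr0.
exists (F' *m lin_gen e l pi i f (- t)); first by apply: elem_mul => //; apply: elem_gen.
by rewrite mulmxA -[_ *m F *m _]mulmxA eF mulmx1 EN.
Qed.

(** An arbitrary vector of P is a combination of the columns of [lin_pi], an arbitrary form w on P
    satisfies w = w [lin_pi] and so is a combination of its rows; transvections are multiplicative
    along such sums. *)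
Lemma lin_ET_elem g : @ET_lin A M g -> exists2 F, EL F & forall u, co (g u) = F *m co u.
Proof.
elim=> {g} [g [y|psi]||g h _ [F FE eF] _ [H HE eH]|g h _ [F FE eF] gh hg].
- exists (lin_tv (co (y, 0)) lin_l 1).
    rewrite -(lin_pi_coords (y, 0)).
    rewrite (_ : _ *m _ = \sum_i (co (y, 0)) i 0 *: col i lin_pi).
      exact: lin_tv_elem_sumv.
    apply/matrixP => i j; rewrite mxE summxE; apply: eq_bigr => k _.
    by rewrite !mxE mulrC.
  move=> u; rewrite /lin_tv mulmxDl mul1mx scale1r -mulmxA lin_l_coords mul_mx_scalar.
  rewrite -!(coordsZ lin_dual_basis) -(coordsD lin_dual_basis); congr co.
  by apply: prod_ext; rewrite /= ?scaler0 ?addr0.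
- have sp : scalar (fun u : linQ M => psi u.1) by move=> a u v; rewrite linearP.
  pose w := \row_j psi (linX j).1 : 'rV[A]_n.+1.
  have wu u : w *m co u = (psi u.1)%:M := scalar_coords lin_dual_basis u sp.
  exists (lin_tv lin_e w 1) => [|u].
    have -> : w = \sum_i w 0 i *: row i lin_pi.
      transitivity (w *m lin_pi).
        apply: eq_cols => j; rewrite colM col_lin_pi wu.
        by apply/matrixP => a b; rewrite !mxE !ord1 eqxx mulr1n.
      apply/matrixP => i j; rewrite mxE summxE; apply: eq_bigr => k _.
      by rewrite !mxE.
    exact: lin_tv_elem_sumr.
  rewrite /lin_tv mulmxDl mul1mx scale1r -mulmxA wu mul_mx_scalar.
  rewrite -!(coordsZ lin_dual_basis) -(coordsD lin_dual_basis); congr co.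
  apply: prod_ext; rewrite /= ?scaler0 ?addr0 //.
  by rewrite -[_ *: _]/(_ * 1) mulr1.
- by exists 1%:M => [|u]; [exact: elem_group1|rewrite mul1mx].
- by exists (F *m H) => [|u]; [exact: elem_mul|rewrite /= eF eH mulmxA].
- have [F' F'E eFF] := lin_elem_inv FE; exists F' => // u.
  by rewrite -[u in RHS]hg eF mulmxA (mulmx1C eFF) mul1mx.
Qed.

End Transfer.
End LinCoords.

(** * Matrices of endomorphisms and their specializations *)

Section EndoMatrix.
Variables (A : comNzRingType) (M : lmodType A) (n : nat).
Variables (X : 'I_n -> M) (Phi : 'I_n -> M -> A).
Hypothesis db : dual_basis X Phi.
Local Notation co := (coords Phi).
Local Notation et := (db_mx X Phi).

(* The matrix of an endomorphism of the image of the idempotent et, extended by the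
   identity on the complement. *)
Definition endo_mx (h : M -> M) : 'M[A]_n := (\matrix_(i, j) Phi i (h (X j))) + (1%:M - et).

Lemma compl_coords u : (1%:M - et) *m co u = 0.
Proof. by rewrite mulmxBl mul1mx (db_mx_coords db) subrr. Qed.

Lemma endo_mx_coords h u : linear h -> endo_mx h *m co u = co (h u).
Proof.
move=> hl; rewrite mulmxDl compl_coords addr0.
pose L := GRing.isLinear.Build A M M *:%R h hl.
pose H : {linear M -> M} := HB.pack_for {linear M -> M} h L.
have -> : h u = \sum_i Phi i u *: h (X i).
  rewrite {1}(db_sum db u) -[h _]/(H _) linear_sum; apply: eq_bigr => i _.
  by rewrite linearZ.
rewrite (coords_sum db); apply/matrixP => i j; rewrite mxE summxE; apply: eq_bigr => k _.
by rewrite !mxE mulrC.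
Qed.

Lemma col_endo_mx h j : linear h -> col j (endo_mx h *m et) = co (h (X j)).
Proof. by move=> hl; rewrite colM col_db_mx endo_mx_coords. Qed.

Lemma compl_idem : (1%:M - et) *m (1%:M - et) = 1%:M - et.
Proof.
by rewrite mulmxBr mulmx1 mulmxBl mul1mx (db_mx_idem db) subrr subr0.
Qed.

Lemma endo_mx_compl h : linear h -> endo_mx h *m (1%:M - et) = 1%:M - et.
Proof.
move=> hl; rewrite mulmxDl compl_idem -[RHS]add0r; congr (_ + _).
rewrite mulmxBr mulmx1; apply/eqP; rewrite subr_eq0; apply/eqP.
apply: eq_cols => j; rewrite -[_ *m et]addr0.
have <- : (1%:M - et) *m et = 0 by rewrite mulmxBl mul1mx (db_mx_idem db) subrr.
rewrite -mulmxDl col_endo_mx //.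
by apply/matrixP => i k; rewrite !mxE.
Qed.

Lemma mx_ext (F F' : 'M[A]_n) : F *m (1%:M - et) = F' *m (1%:M - et) ->
  (forall j, F *m co (X j) = F' *m co (X j)) -> F = F'.
Proof.
move=> hc hj.
have split_et (H : 'M[A]_n) : H = H *m (1%:M - et) + H *m et by rewrite -mulmxDr subrK mulmx1.
rewrite (split_et F) (split_et F') hc; congr (_ + _).
by apply: eq_cols => j; rewrite !colM col_db_mx hj.
Qed.

Lemma endo_mxK h h' : linear h -> linear h' -> cancel h' h ->
  endo_mx h *m endo_mx h' = 1%:M.
Proof.
move=> hl hl' K; apply: mx_ext => [|j].
  by rewrite -mulmxA !endo_mx_compl // mul1mx.
by rewrite -mulmxA !endo_mx_coords // K mul1mx.
Qed.

End EndoMatrix.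

Section EndoSpecialize.
Variables (A B : comNzRingType) (g : {rmorphism A -> B}) (n : nat).
Variables (M : lmodType A) (X : 'I_n -> M) (Phi : 'I_n -> M -> A).
Variables (M' : lmodType B) (X' : 'I_n -> M') (Phi' : 'I_n -> M' -> B).
Hypothesis db : dual_basis X Phi.
Variable iota : M -> M'.
Hypothesis iotaP : forall u, coords Phi' (iota u) = map_mx g (coords Phi u).
Hypothesis iotaX : forall j, iota (X j) = X' j.

Lemma map_db_mx : map_mx g (db_mx X Phi) = db_mx X' Phi'.
Proof. by apply: eq_cols => j; rewrite -map_col !col_db_mx -iotaP iotaX. Qed.

(** Two matrices agree once they do so on the complement and on the coordinates of the generators.
    With [iota] the value at X = 0 and F = 1, this gives alpha(0) = 1 for matrices; with [iota] the
    localization, it identifies the image of the matrix of alpha with the local elementary word. *)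
Lemma map_endo_mx h F : linear h ->
  F *m (1%:M - db_mx X' Phi') = 1%:M - db_mx X' Phi' ->
  (forall j, coords Phi' (iota (h (X j))) = F *m coords Phi' (X' j)) ->
  map_mx g (endo_mx X Phi h) = F.
Proof.
move=> hl hF Fh; apply: (@mx_ext _ _ _ X' Phi') => [|j].
  rewrite hF -map_db_mx -(map_mx1 g) -map_mxB -map_mxM endo_mx_compl //.
by rewrite -Fh -iotaX !iotaP -map_mxM endo_mx_coords // iotaX.
Qed.

End EndoSpecialize.

Section PolymodMaps.
Variables (R : comNzRingType) (P : lmodType R).

Lemma polymod_at0D : {morph @polymod_at0 R P : u v / u + v}.
Proof.
apply: BaseChange.liftD; split=> [y s t|s y z|s r y]; first by rewrite hornerD scalerDl.
  exact: scalerDr.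
by rewrite hornerM hornerC scalerA.
Qed.

Lemma polymod_locD p : {morph @polymod_loc R p P : u v / u + v}.
Proof.
apply: BaseChange.liftD; rewrite /poly_loc.
split=> [y s t|s y z|s r y]; first by rewrite rmorphD BaseChange.pureDl.
  by rewrite BaseChange.pureDr BaseChange.pureDr.
rewrite rmorphM /= map_polyC BaseChange.pure_scale BaseChange.scale_pure.
by rewrite mulr1 -BaseChange.pure_scale mul1r.
Qed.

Lemma morph0 (U V : zmodType) (h : U -> V) : {morph h : u v / u + v} -> h 0 = 0.
Proof. by move=> hD; apply: (addrI (h 0)); rewrite -hD !addr0. Qed.

Lemma polymod_at0_phi (g : P -> R) u : scalar g ->
  g (polymod_at0 u) = (bc_phi (@polyC R) g u).[0].
Proof.
move=> gs; have [G e] := scalar_pack gs; rewrite -e.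
elim/BaseChange.pure_ind: u => [|s x|u w IHu IHw].
- rewrite (morph0 polymod_at0D) linear0.
  by rewrite (morph0 (fun u v => bc_phiD u v gs)) horner0.
- by rewrite polymod_at0_pure linearZ bc_phi_pure // hornerM hornerC e.
- by rewrite polymod_at0D linearD IHu IHw bc_phiD // hornerD.
Qed.

Lemma polymod_loc_phi p (g : P -> R) u : scalar g ->
  bc_phi (@polyC _) (bc_phi (loc p) g) (polymod_loc p u) =
  poly_loc p (bc_phi (@polyC R) g u).
Proof.
move=> gs; have gs2 : scalar (bc_phi (loc p) g) by apply: bc_phi_scalar.
elim/BaseChange.pure_ind: u => [|s x|u w IHu IHw].
- rewrite (morph0 (@polymod_locD p)) (morph0 (fun u v => bc_phiD u v gs2)).
  by rewrite (morph0 (fun u v => bc_phiD u v gs)) /poly_loc rmorph0.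
- rewrite polymod_loc_pure !bc_phi_pure // mul1r /poly_loc rmorphM /=.
  by rewrite map_polyC.
- by rewrite polymod_locD !bc_phiD // IHu IHw /poly_loc rmorphD.
Qed.

Lemma polymod_at0_cst (x : P) : polymod_at0 (polymod_cst x) = x.
Proof. by rewrite polymod_at0_pure hornerC scale1r. Qed.

Lemma polymod_loc_cst p (x : P) : polymod_loc p (polymod_cst x) =
  bc1 (@polyC _) (bc1 (loc p) x).
Proof. by rewrite polymod_loc_pure /poly_loc rmorph1. Qed.

End PolymodMaps.

Section LinCompat.
Variables (R S : comNzRingType) (f : {rmorphism R -> S}) (M : lmodType R) (n : nat).
Variables (x : 'I_n -> M) (phi : 'I_n -> M -> R).
Hypothesis db : dual_basis x phi.
Local Notation x' := (fun i => bc1 f (x i)).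
Local Notation phi' := (fun i => bc_phi f (phi i)).

Definition bc_lin (u : linQ M) : linQ (basechange f M) := (bc1 f u.1, f u.2).

Lemma bc_linX j : bc_lin (linX x j) = linX x' j.
Proof.
rewrite /bc_lin /linX; case: (unlift _ _) => [k|] /=; first by rewrite rmorph0.
by rewrite bc1_0 rmorph1.
Qed.

Lemma bc_linPhi u : coords (linPhi phi') (bc_lin u) = map_mx f (coords (linPhi phi) u).
Proof.
apply/matrixP => i j; rewrite !mxE /linPhi /bc_lin; case: (unlift _ _) => [k|] //=.
by rewrite bc_phi1 //; apply: (db_scalar db).
Qed.

Lemma map_lin_e : map_mx f (lin_e phi) = lin_e phi'.
Proof.
rewrite /lin_e -bc_linPhi; congr coords; apply: prod_ext; rewrite /= ?rmorph1 //.
exact: bc1_0.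
Qed.

Lemma map_lin_l : map_mx f (lin_l x) = lin_l x'.
Proof. by apply/matrixP => i j; rewrite !mxE -bc_linX. Qed.

Lemma map_lin_pi : map_mx f (lin_pi x phi) = lin_pi x' phi'.
Proof.
rewrite /lin_pi map_mxB map_mxM map_lin_e map_lin_l; congr (_ - _).
exact: (map_db_mx bc_linPhi bc_linX).
Qed.

End LinCompat.

Section LinLocalBasis.
Variables (R : comNzRingType) (P : lmodType R) (n : nat).
Variables (x : 'I_n -> P) (phi : 'I_n -> P -> R).
Hypothesis db : dual_basis x phi.
Variable p : prime_idealr R.
Local Notation e := (lin_e phi).
Local Notation l := (lin_l x).
Local Notation pi := (lin_pi x phi).

Lemma bc_db_mx (M : lmodType R) r (X : 'I_r -> M) (Phi : 'I_r -> M -> R) (S : comNzRingType)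
    (f : {rmorphism R -> S}) : dual_basis X Phi ->
  db_mx (fun i => bc1 f (X i)) (fun i => bc_phi f (Phi i)) = map_mx f (db_mx X Phi).
Proof. by move=> h; apply/matrixP => i j; rewrite !mxE bc_phi1 //; apply: (db_scalar h). Qed.

(* A local ring: some product in the expansion of l(e) = 1 along a basis is a unit, and
   the corresponding basis vector can be exchanged for e. *)
Lemma constant_rank_basis r : (3 <= r)%N -> constant_rank r (linQ P) ->
  lin_basis e l pi (loc p).
Proof.
move=> r3 /(_ p)[h [h' hK h'K]].
have dbQ := lin_dual_basis db.
have db' := bc_dual_basis (loc p) dbQ.
set X := linX x in dbQ db'; set Phi := linPhi phi in dbQ db'.
have h'l : linear h' := can2_linear hK h'K.
pose et := map_mx (loc p) (db_mx X Phi).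
have etE : et = db_mx (fun i => bc1 (loc p) (X i)) (fun i => bc_phi (loc p) (Phi i)).
  by rewrite (bc_db_mx _ dbQ).
pose co := coords (fun i => bc_phi (loc p) (Phi i)).
pose v i := co (h' (delta_mx 0 i)).
pose u i := \row_j (h (bc1 (loc p) (X j))) 0 i : 'rV_n.+1.
have uco i y : u i *m co y = (h y 0 i)%:M.
  have hs : scalar (fun y => h y 0 i) by move=> a y1 y2; rewrite linearP !mxE.
  exact: (scalar_coords db' y hs).
have uv i j : dot (u i) (v j) = (i == j)%:R.
  by rewrite /dot uco h'K !mxE eqxx mulr1n.
have vu : \sum_i v i *m u i = et.
  rewrite etE; apply: eq_cols => j; rewrite col_db_mx -/co.
  rewrite colE mulmx_suml -[in RHS](hK (bc1 _ _)).
  pose L := GRing.isLinear.Build _ _ _ *:%R h' h'l.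
  pose H : {linear 'rV_r -> basechange (loc p) (linQ P)} := HB.pack_for {linear _ -> _} h' L.
  have -> y : h' y = \sum_i y 0 i *: h' (delta_mx 0 i).
    rewrite {1}(row_sum_delta y) -[LHS]/(H _) linear_sum; apply: eq_bigr => i _.
    by rewrite linearZ.
  rewrite /co (coords_sum db'); apply: eq_bigr => i _.
  rewrite -mulmxA -colE.
  have -> : col j (u i) = ((h (bc1 (loc p) (X j))) 0 i)%:M.
    by apply/matrixP => a b; rewrite !mxE !ord1 eqxx mulr1n.
  by rewrite mul_mx_scalar.
pose E := map_mx (loc p) e; pose L := map_mx (loc p) l.
have et_E : et *m E = E by rewrite -map_mxM (db_mx_coords dbQ).
have L_et : L *m et = L.
  rewrite -map_mxM; congr map_mx; apply: eq_cols => j.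
  rewrite colM col_db_mx (lin_l_coords db); apply/matrixP => a b.
  by rewrite !mxE !ord1 eqxx mulr1n.
have LE : dot L E = 1 by rewrite map_dot /dot (lin_le1 db) mxE rmorph1.
have dv : \sum_i dot (u i) E *: v i = E.
  rewrite -[RHS]et_E -vu mulmx_suml; apply: eq_bigr => i _.
  by rewrite -mulmxA dotE mul_mx_scalar.
have du : \sum_i dot L (v i) *: u i = L.
  rewrite -[RHS]L_et -vu mulmx_sumr; apply: eq_bigr => i _.
  by rewrite mulmxA dotE mul_scalar_mx.
have dd : \sum_i dot L (v i) * dot (u i) E = 1.
  rewrite -LE -{2}dv /dot mulmx_sumr summxE; apply: eq_bigr => i _.
  by rewrite -scalemxAr [RHS]mxE mulrC.
have [i0 [c cE]] : exists i c, dot L (v i) * c = 1.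
  exact: (loc_sum_unit dd).
(* The v_i are corrected into the kernel of L, which is possible as L(v_i0) is a unit with inverse
   c; dually the u_i are corrected to vanish on E. *)
pose B i := if i == i0 then E else v i - (dot L (v i) * c) *: v i0.
pose B' i := if i == i0 then L else u i - dot (u i) E *: L.
have uL i : dot L (v i - (dot L (v i) * c) *: v i0) = 0.
  by rewrite dotDr -scaleNr dotZr mulNr -mulrA [c * _]mulrC cE mulr1 subrr.
exists r, B, B', i0; split=> //.
- move=> i j; rewrite /B /B'.
  have [ei|ii0] := boolP (i == i0); have [ej|ji0] := boolP (j == i0).
  + by rewrite LE (eqP ei) eq_sym ej.
  + by rewrite uL (eqP ei) eq_sym (negbTE ji0).
  + rewrite dotDl -scaleNr dotZl LE mulr1 subrr.
    by rewrite (eqP ej) (negbTE ii0).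
  + by rewrite dotDl dotNl dotZl uL mulr0 subr0 dotDr dotNr dotZr !uv (negbTE ii0) mulr0 subr0.
- rewrite (lin_et_tot x phi) -/et.
  rewrite [RHS](bigD1 i0) //= {1}/B {1}/B' eqxx.
  transitivity (E *m L + \sum_i (v i - (dot L (v i) * c) *: v i0) *m (u i - dot (u i) E *: L)).
    transitivity (E *m L + (\sum_i v i *m u i - (\sum_i dot (u i) E *: v i) *m L -
       (c *: v i0) *m (\sum_i dot L (v i) *: u i) +
       (\sum_i dot L (v i) * dot (u i) E) *: ((c *: v i0) *m L))).
      rewrite dv du dd vu scale1r subrK addrC subrK //.
    congr (_ + _); rewrite mulmx_suml mulmx_sumr scaler_suml -!sumrB -big_split.
    apply: eq_bigr => i _.
    rewrite mulmxBl !mulmxBr -!(scalemxAl, scalemxAr) !scalerA.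
    by apply/matrixP => a b; rewrite !mxE; ring.
  congr (_ + _); rewrite [LHS](bigD1 i0) //= cE scale1r subrr mul0mx add0r.
  by apply: eq_bigr => i ii0; rewrite /B /B' (negbTE ii0).
- by rewrite /B eqxx.
- by rewrite /B' eqxx.
Qed.

End LinLocalBasis.

(** Every generator fixes the complement, since its form vanishes there. This matches the extension
    by the identity built into [endo_mx]. *)
Lemma lin_elem_compl (R : comNzRingType) N (e : 'cV[R]_N) (l : 'rV[R]_N) (pi : 'M[R]_N)
    (A : comNzRingType) (f : {rmorphism R -> A}) F :
  l *m e = 1%:M -> l *m pi = 0 -> pi *m e = 0 -> pi *m pi = pi ->
  elem_group (lin_gen e l pi) f F ->
  F *m (1%:M - lin_et e l pi f) = 1%:M - lin_et e l pi f.
Proof.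
move=> le1 lpi pie pipi; elim=> [|i t {}F _ IH]; first by rewrite mul1mx.
rewrite -mulmxA IH /lin_gen.
have h v w : w *m lin_et e l pi f = w ->
    lin_tv v w t *m (1%:M - lin_et e l pi f) = 1%:M - lin_et e l pi f.
  move=> ew; rewrite /lin_tv mulmxDl mul1mx -scalemxAl -mulmxA mulmxBr mulmx1 ew subrr.
  by rewrite mulmx0 scaler0 addr0.
by case: i.1; apply: h; rewrite ?lin_l_et ?lin_pi_et.
Qed.

(** * The linear case *)

Section LinearTheorem.
Variables (R : comNzRingType) (P : lmodType R) (n : nat).
Variables (x : 'I_n -> P) (phi : 'I_n -> P -> R).
Hypothesis db : dual_basis x phi.

Lemma linQ_at0_coords u :
  coords (linPhi phi) (linQ_at0 u) =
  map_mx (horner_eval 0) (coords (linPhi (fun i => bc_phi (@polyC R) (phi i))) u).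
Proof.
apply/matrixP => i j; rewrite !mxE /linPhi; case: (unlift _ _) => [k|] //=.
by rewrite polymod_at0_phi //; apply: (db_scalar db).
Qed.

Lemma linQ_at0_X j : linQ_at0 (linX (fun i => bc1 (@polyC R) (x i)) j) = linX x j.
Proof.
rewrite /linQ_at0 /linX; case: (unlift _ _) => [k|] /=.
  by rewrite polymod_at0_cst horner0.
by rewrite (morph0 (@polymod_at0D _ _)) hornerC.
Qed.

Lemma linQ_cst_X j : linQ_cst (linX x j) = linX (fun i => bc1 (@polyC R) (x i)) j.
Proof. by rewrite -bc_linX. Qed.

Section Loc.
Variable p : prime_idealr R.
Let x2 i := bc1 (@polyC (localization p)) (bc1 (loc p) (x i)).
Let phi2 i := bc_phi (@polyC (localization p)) (bc_phi (loc p) (phi i)).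

Lemma linQ_loc_coords u :
  coords (linPhi phi2) (linQ_loc p u) =
  map_mx (map_poly (loc p)) (coords (linPhi (fun i => bc_phi (@polyC R) (phi i))) u).
Proof.
apply/matrixP => i j; rewrite !mxE /linPhi; case: (unlift _ _) => [k|] //=.
by rewrite /phi2 polymod_loc_phi //; apply: (db_scalar db).
Qed.

Lemma linQ_loc_X j : linQ_loc p (linX (fun i => bc1 (@polyC R) (x i)) j) = linX x2 j.
Proof.
rewrite /linQ_loc /linX /poly_loc; case: (unlift _ _) => [k|] /=.
  by rewrite polymod_loc_cst rmorph0.
by rewrite (morph0 (@polymod_locD _ _ p)) rmorph1.
Qed.

Lemma cloc_comp m k (H : 'M[R]_(m, k)) : map_mx (cloc p) H = map_mx polyC (map_mx (loc p) H).
Proof. by apply/matrixP => i j; rewrite !mxE clocE. Qed.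

End Loc.

Theorem linear_case : (exists2 r : nat, (3 <= r)%N & constant_rank r (linQ P)) ->
  forall alpha : {linear linQ (polymod P) -> linQ (polymod P)},
  bijective alpha -> lin_at0 alpha =1 id ->
  (forall (M : {pred R}) (hM : maximal_ideal M),
     exists2 beta, ET_lin beta & lin_localizes (p := prime_of_maximal hM) alpha beta) ->
  ET_lin alpha.
Proof.
move=> [r r3 rk] alpha [alphaV aK aVK] a0 aloc.
pose x1 i := bc1 (@polyC R) (x i); pose phi1 i := bc_phi (@polyC R) (phi i).
have db1 : dual_basis x1 phi1 by apply: bc_dual_basis.
have dbQ := lin_dual_basis db1.
have le1 := lin_le1 db; have lpi := lin_lpi db; have pie := lin_pie db.
have pipi := lin_pipi db.
have aVl : linear alphaV := can2_linear aK aVK.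
have al : linear alpha by move=> c u v; rewrite linearP.
pose am := endo_mx (linX x1) (linPhi phi1) alpha.
pose amV := endo_mx (linX x1) (linPhi phi1) alphaV.
have amK : am *m amV = 1%:M by apply: (endo_mxK dbQ).
have am0 : map_mx (horner_eval 0) am = 1%:M.
  apply: (map_endo_mx dbQ linQ_at0_coords linQ_at0_X al) => [|j].
    by rewrite mul1mx.
  by rewrite mul1mx -(linQ_cst_X j) -[linQ_at0 _]/(lin_at0 alpha (linX x j)) a0.
have : elem_group (lin_gen (lin_e phi) (lin_l x) (lin_pi x phi)) (polyC : R -> {poly R}) am.
  apply: (lin_local_global le1 lpi pie pipi amK am0) => M hM.
    exact: (constant_rank_basis db (prime_of_maximal hM) r3 rk).
  set p := prime_of_maximal hM.
  have [beta betaE betaP] := aloc M hM.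
  pose x2 i := bc1 (@polyC (localization p)) (bc1 (loc p) (x i)).
  pose phi2 i := bc_phi (@polyC (localization p)) (bc_phi (loc p) (phi i)).
  have dbp : dual_basis (fun i => bc1 (loc p) (x i)) (fun i => bc_phi (loc p) (phi i)).
    exact: bc_dual_basis.
  have db2 : dual_basis x2 phi2 by apply: bc_dual_basis.
  have fe : map_mx (cloc p) (lin_e phi) = lin_e phi2.
    by rewrite cloc_comp (map_lin_e _ db) (map_lin_e _ dbp).
  have fl : map_mx (cloc p) (lin_l x) = lin_l x2 by rewrite cloc_comp !map_lin_l.
  have fpi : map_mx (cloc p) (lin_pi x phi) = lin_pi x2 phi2.
    by rewrite cloc_comp (map_lin_pi _ db) (map_lin_pi _ dbp).
  have [F FE eF] := lin_ET_elem db2 fe fl fpi betaE.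
  suff -> : map_mx (map_poly (loc p)) am = F by [].
  apply: (map_endo_mx dbQ (linQ_loc_coords p) (linQ_loc_X p) al) => [|j].
    have := lin_elem_compl le1 lpi pie pipi FE.
    by rewrite /lin_et map_mxD map_mxM fe fl fpi lin_et_tot.
  by rewrite -eF -(linQ_loc_X p) betaP.
move=> /(lin_elem_ET db1)[].
- exact: (map_lin_e (@polyC R) db).
- exact: (map_lin_l (@polyC R) x).
- exact: (map_lin_pi (@polyC R) db).
- move=> g gE eg; suff -> : (alpha : linQ _ -> linQ _) = g by [].
  by apply/funext => u; apply: (coords_inj dbQ); rewrite eg (endo_mx_coords dbQ).
Qed.

End LinearTheorem.

(** * Hyperbolic bases over local rings *)

Section HyperbolicBases.
Variables (A : comNzRingType) (N : nat) (J : 'M[A]_N) (lam hf : A) (et : 'M[A]_N).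
Hypothesis JT : J^T = lam *: J.
Hypothesis lam_pm : lam = 1 \/ lam = -1.
Hypothesis hf2 : hf + hf = 1.
Hypothesis Jet : J *m et = J.
Local Notation bf := (bf J).
Local Notation rk := (rk J).
Variable m : nat.

Definition hyp_basis (b : 'I_m * bool -> 'cV[A]_N) : Prop :=
  [/\ forall i j, bf (b i) (b j) = if j == bar i then hyp_sign lam i.2 else 0,
      et = \sum_i hyp_sign lam (~~ i.2) *: rk (b i) (b (bar i))
    & forall i, et *m b i = b i].

Lemma hyp_basis_isom g g' b : isom J g -> g *m g' = 1%:M -> et *m g = g *m et ->
  hyp_basis b -> hyp_basis (fun i => g *m b i).
Proof.
move=> gJ gg' etg [bb btot etb]; split=> [i j||i].
- by rewrite (bf_isom _ _ gJ) bb.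
- transitivity (g *m et *m g'); first by rewrite -etg -mulmxA gg' mulmx1.
  rewrite {1}btot mulmx_sumr mulmx_suml; apply: eq_bigr => i _.
  by rewrite -scalemxAr -scalemxAl (rk_conj _ _ gJ gg').
- by rewrite mulmxA etg -mulmxA etb.
Qed.

Lemma sum_plane k0 (F : 'I_m * bool -> 'M[A]_N) :
  \sum_i F i = F (k0, false) + F (k0, true) + \sum_(i | i.1 != k0) F i.
Proof.
rewrite (bigID (fun i => i.1 == k0)) /=; congr (_ + _).
rewrite (bigD1 (k0, false)) /= ?eqxx // (bigD1 (k0, true)) /=; last first.
  by rewrite eqxx xpair_eqE andbF.
rewrite big1 ?addr0 // => -[k s] /=.
by rewrite !xpair_eqE => /andP[/andP[/eqP -> ]]; rewrite eqxx; case: s.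
Qed.

(** The last hypothesis says that (x, y) and the old pair span the same plane: both sides are the
    orthogonal projection onto it. *)
Lemma hyp_basis_replace b k0 x y : hyp_basis b ->
  et *m x = x -> et *m y = y -> bf x x = 0 -> bf y y = 0 -> bf x y = 1 ->
  (forall j, j.1 != k0 -> bf (b j) x = 0 /\ bf (b j) y = 0) ->
  lam *: rk x y + rk y x =
    lam *: rk (b (k0, false)) (b (k0, true)) + rk (b (k0, true)) (b (k0, false)) ->
  hyp_basis (fun i => if i.1 == k0 then if i.2 then y else x else b i).
Proof.
move=> [bb btot etb] ex ey xx yy xy bxy exy.
have yx : bf y x = lam by rewrite (bfC JT) xy mulr1.
have xyb j : j.1 != k0 -> bf x (b j) = 0 /\ bf y (b j) = 0.
  by move=> /bxy[hx hy]; rewrite (bfC JT _ x) (bfC JT _ y) hx hy mulr0.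
split=> [[k s] [k' s']||[k s]] /=; last first.
- by case: ifP => // _; case: s.
- rewrite {1}btot !(sum_plane k0) /= !eqxx /=; congr (_ + _).
    by rewrite /bar /= !scale1r exy.
  by apply: eq_bigr => i /negbTE ik0; rewrite ik0.
have [-> | kk0] := eqVneq k k0; have [-> | k'k0] := eqVneq k' k0.
- by rewrite /bar xpair_eqE eqxx /=; case: s; case: s'.
- by rewrite /bar xpair_eqE (negbTE k'k0) /=; case: s; case: (xyb (k', s') k'k0).
- by rewrite /bar xpair_eqE eq_sym (negbTE kk0) /=; case: s'; case: (bxy (k, s) kk0).
- exact: bb.
Qed.

Lemma et_rk x y : et *m x = x -> et *m rk x y = rk x y *m et.
Proof. by move=> ex; rewrite /rk mulmxA ex -!mulmxA Jet. Qed.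

Lemma et_utv w v : et *m w = w -> et *m v = v ->
  et *m utv J lam hf w v = utv J lam hf w v *m et.
Proof.
move=> ew ev; rewrite /utv !mulmxBr !mulmxDr !mulmxBl mulmxDl mulmx1 mul1mx.
by rewrite -!scalemxAl -!scalemxAr !et_rk.
Qed.

Lemma et_long w y : et *m w = w -> et *m long J lam hf w y = long J lam hf w y *m et.
Proof.
move=> ew; rewrite /long mulmxDr mulmxDl mulmx1 mul1mx -!scalemxAl -!scalemxAr.
by rewrite et_rk.
Qed.

Lemma hyp_basis_tv w v y b : bf w w = 0 -> bf w v = 0 -> et *m w = w -> et *m v = v ->
  hyp_basis b -> hyp_basis (fun i => utv J lam hf w v *m (long J lam hf w y *m b i)).
Proof.
move=> ww wv ew ev hb.
apply: (hyp_basis_isom (g' := utv J lam hf w (- v))).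
- exact: utv_isom.
- exact: utvNK.
- exact: et_utv.
apply: (hyp_basis_isom (g' := long J lam hf w (- y))) hb.
- exact: long_isom.
- by rewrite -longD // subrr long0.
- exact: et_long.
Qed.

Section Exchange.
Variables (b : 'I_m * bool -> 'cV[A]_N) (k0 : 'I_m).
Hypothesis hb : hyp_basis b.
Local Notation h := (b (k0, false)).
Local Notation h' := (b (k0, true)).

Let bb i j : bf (b i) (b j) = if j == bar i then hyp_sign lam i.2 else 0.
Proof. by case: hb. Qed.
Let etb i : et *m b i = b i. Proof. by case: hb. Qed.
Let hh : bf h h = 0. Proof. by rewrite bb xpair_eqE andbF. Qed.
Let h'h' : bf h' h' = 0. Proof. by rewrite bb xpair_eqE andbF. Qed.
Let hh' : bf h h' = 1. Proof. by rewrite bb eqxx. Qed.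
Let h'h : bf h' h = lam. Proof. by rewrite bb eqxx. Qed.

(** The hypothesis says that e has coordinate 1 along h, so e = h + q + d h' with q orthogonal to
    the plane. A transvection along h' composed with [long h'] is an isometry taking h to e. *)
Lemma hyp_basis_exchange1 e : et *m e = e -> bf e e = 0 -> lam * bf h' e = 1 ->
  exists2 b', hyp_basis b' & b' (k0, false) = e.
Proof.
move=> ee0 ee h'e; have h'e' : bf h' e = lam.
  by rewrite -[LHS]mul1r -(lam2 lam_pm) -mulrA h'e mulr1.
pose d := bf h e; pose q := e - (h + d *: h').
have hq : bf h q = 0 by rewrite /q !bfE hh hh' /d; ring.
have h'q : bf h' q = 0 by rewrite /q !bfE h'h h'h' h'e'; ring.
have eq_ : et *m q = q by rewrite /q mulmxBr mulmxDr -scalemxAr ee0 !etb.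
have eE : e = h + q + d *: h' by rewrite addrAC addrC /q subrK.
clearbody d q.
have qh : bf q h = 0 by rewrite (bfC JT) hq mulr0.
have qh' : bf q h' = 0 by rewrite (bfC JT) h'q mulr0.
(* Isotropy of e. For lam = 1 it forces d = -<q, q>/2, the coefficient that [utv] produces; for lam
   = -1 it leaves d free, and [long] supplies it. *)
have dq : (1 + lam) * d + bf q q = 0.
  by move: ee; rewrite eE !bfE hh hh' h'h h'h' hq h'q qh qh' => <-; ring.
exists (fun i => utv J lam hf h' (lam *: q) *m (long J lam hf h' (- d) *m b i)).
  by apply: hyp_basis_tv => //; rewrite ?bfE ?h'q ?mulr0 // -scalemxAr eq_.
rewrite long_app utv_app !bfE h'h h'h' qh qh' [RHS]eE.
apply/matrixP => i j; rewrite !mxE.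
have -> : bf q q = - ((1 + lam) * d) by apply/eqP; rewrite -addr_eq0 addrC dq.
apply: (half_ring hf2 (c := d * b (k0, true) i j)).
by case: (lam_pm) => ->; ring.
Qed.

(** The same move along h instead of h': it fixes h and takes h' to e'. *)
Lemma hyp_basis_exchange2 e' : et *m e' = e' -> bf e' e' = 0 -> bf h e' = 1 ->
  exists2 b', hyp_basis b' & forall s, b' (k0, s) = if s then e' else h.
Proof.
move=> ee0 ee he'.
pose d := lam * bf h' e'; pose q := e' - (h' + d *: h).
have hq : bf h q = 0 by rewrite /q !bfE hh hh' he'; ring.
have h'q : bf h' q = 0.
  rewrite /q !bfE h'h h'h' /d mulrAC (lam2 lam_pm); ring.
have eq_ : et *m q = q by rewrite /q mulmxBr mulmxDr -scalemxAr ee0 !etb.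
have eE : e' = h' + q + d *: h by rewrite addrAC addrC /q subrK.
clearbody d q.
have qh : bf q h = 0 by rewrite (bfC JT) hq mulr0.
have qh' : bf q h' = 0 by rewrite (bfC JT) h'q mulr0.
have dq : (1 + lam) * d + bf q q = 0.
  by move: ee; rewrite eE !bfE hh hh' h'h h'h' hq h'q qh qh' => <-; ring.
exists (fun i => utv J lam hf h q *m (long J lam hf h d *m b i)).
  by apply: hyp_basis_tv.
case.
  rewrite long_app utv_app !bfE hh hh' qh qh' [RHS]eE.
  apply/matrixP => i j; rewrite !mxE.
  have -> : bf q q = - ((1 + lam) * d) by apply/eqP; rewrite -addr_eq0 addrC dq.
  apply: (half_ring hf2 (c := d * b (k0, false) i j)).
  by case: (lam_pm) => ->; ring.
rewrite long_app utv_app !bfE hh qh.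
by apply/matrixP => i j; rewrite !mxE; ring.
Qed.

End Exchange.
End HyperbolicBases.

Section LocalPlane.
Variables (R : comNzRingType) (p : prime_idealr R) (N : nat).
Local Notation A := (localization p).
Variables (J : 'M[A]_N) (lam hf : A) (et : 'M[A]_N).
Hypothesis JT : J^T = lam *: J.
Hypothesis lam_pm : lam = 1 \/ lam = -1.
Hypothesis hf2 : hf + hf = 1.
Hypothesis Jet : J *m et = J.
Local Notation bf := (bf J).
Variable m : nat.

(** Since <e, e'> = 1 and the ring is local, some coordinate of e is a unit. Its plane is rescaled
    to make that coordinate 1, then e and e' are exchanged in one after the other. *)
Lemma hyp_basis_extends b (e e' : 'cV[A]_N) : @hyp_basis _ _ J lam et m b ->
  et *m e = e -> et *m e' = e' -> bf e e = 0 -> bf e' e' = 0 -> bf e e' = 1 ->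
  exists b' k0, @hyp_basis _ _ J lam et m b' /\ forall s, b' (k0, s) = if s then e' else e.
Proof.
move=> hb ete ete' ee e'e' ee'; have [bb btot etb] := hb.
have sume : \sum_i (hyp_sign lam (~~ i.2) * bf (b (bar i)) e) * bf (b i) e' = 1.
  rewrite -ee' -[X in bf X e']ete btot mulmx_suml bf_suml; apply: eq_bigr => i _.
  by rewrite -scalemxAl rk_app !bfZl mulrA.
have [[k s] [c ec]] := loc_sum_unit sume.
have bk0 t : bf (b (k, t)) (b (k, t)) = 0.
  by rewrite bb xpair_eqE; case: t; rewrite andbF.
have bkk : bf (b (k, false)) (b (k, true)) = 1 by rewrite bb eqxx.
have bkk' : bf (b (k, true)) (b (k, false)) = lam by rewrite bb eqxx.
have perp t j : j.1 != k -> bf (b j) (b (k, t)) = 0.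
  by move=> jk; rewrite bb; case: eqP => // ej; rewrite -[k]/((k, t).1) ej eqxx in jk.
have ll := lam2 lam_pm.
(* With c the inverse of the coordinate a, up to sign, the new pair is (a h, c h') if the unit
   coordinate is along h, and (a h', lam c h) if it is along h'; in both cases e acquires coordinate
   1 along the first vector. *)
have [b1 hb1 b1e] : exists2 b1, @hyp_basis _ _ J lam et m b1 &
    lam * bf (b1 (k, true)) e = 1.
  case: s ec => /= ec.
    have [a ea] : exists a, a = bf (b (k, false)) e by eexists.
    rewrite /bar /= mul1r -ea in ec.
    exists (fun i => if i.1 == k then if i.2 then (lam * c) *: b (k, false)
                     else a *: b (k, true) else b i).
      apply: (hyp_basis_replace JT hb).
      - by rewrite -scalemxAr etb.
      - by rewrite -scalemxAr etb.
      - by rewrite !bfE bk0 !mulr0.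
      - by rewrite !bfE bk0 !mulr0.
      - rewrite !bfE bkk'; transitivity ((lam * lam) * (a * c)); first by ring.
        by rewrite ll ec mulr1.
      - by move=> j jk; rewrite !bfE !perp // !mulr0.
      have e1 : a * (lam * c) = lam by rewrite mulrCA ec mulr1.
      have e2 : lam * a * (lam * c) = 1.
        transitivity ((lam * lam) * (a * c)); first by ring.
        by rewrite ll ec mulr1.
      by rewrite !rkE !scalerA e1 e2 scale1r addrC.
    rewrite /= eqxx bfZl -ea; transitivity ((lam * lam) * (a * c)); first by ring.
    by rewrite ll ec mulr1.
  have [a ea] : exists a, a = lam * bf (b (k, true)) e by eexists.
  rewrite /bar /= -ea in ec.
  exists (fun i => if i.1 == k then if i.2 then c *: b (k, true)
                   else a *: b (k, false) else b i).
    apply: (hyp_basis_replace JT hb).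
    - by rewrite -scalemxAr etb.
    - by rewrite -scalemxAr etb.
    - by rewrite !bfE bk0 !mulr0.
    - by rewrite !bfE bk0 !mulr0.
    - by rewrite !bfE bkk mulr1 ec.
    - by move=> j jk; rewrite !bfE !perp // !mulr0.
    by rewrite !rkE !scalerA [c * a]mulrC -mulrA ec mulr1 scale1r.
  by rewrite /= eqxx bfZl mulrCA -ea mulrC.
have [b2 hb2 b2e] : exists2 b2, @hyp_basis _ _ J lam et m b2 & b2 (k, false) = e.
  by apply: (hyp_basis_exchange1 JT lam_pm hf2 Jet hb1).
have [b3 hb3 b3e] : exists2 b3, @hyp_basis _ _ J lam et m b3 &
    forall s, b3 (k, s) = if s then e' else b2 (k, false).
  by apply: (hyp_basis_exchange2 JT lam_pm hf2 Jet hb2) => //; rewrite b2e.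
by exists b3, k; split=> // t; rewrite b3e b2e.
Qed.

End LocalPlane.

(** * Bilinear forms and unitary coordinates *)

Section Bilinear.
Variables (A : comNzRingType) (M : lmodType A).

Definition bilin (F : M -> M -> A) : Prop :=
  (forall y, scalar (F^~ y)) /\ (forall x, scalar (F x)).

Lemma biscalar_bilin (F : {biscalar M}) : bilin F.
Proof.
by split=> [y a u v|x a u v]; rewrite ?linearDl ?linearZl ?linearP.
Qed.

Section Gram.
Variables (n : nat) (X : 'I_n -> M) (Phi : 'I_n -> M -> A) (F : M -> M -> A).
Hypotheses (db : dual_basis X Phi) (Fb : bilin F).

Definition gram : 'M[A]_n := \matrix_(i, j) F (X i) (X j).

Lemma gram_bf u v : bf gram (coords Phi u) (coords Phi v) = F u v.
Proof.
have -> : F u v = \sum_i Phi i u * F (X i) v.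
  by rewrite {1}(db_sum db u) (scalar_sum _ _ (Fb.1 v)).
rewrite /bf -mulmxA mxE; apply: eq_bigr => i _; rewrite !mxE; congr (_ * _).
have := congr1 (fun m : 'M_1 => m 0 0) (scalar_coords db v (Fb.2 (X i))).
rewrite !mxE eqxx mulr1n => <-; apply: eq_bigr => k _.
by rewrite !mxE.
Qed.

Lemma gram_db_mx : gram *m db_mx X Phi = gram.
Proof.
apply/matrixP => i j; rewrite mxE.
have := congr1 (fun m : 'M_1 => m 0 0) (scalar_coords db (X j) (Fb.2 (X i))).
rewrite !mxE eqxx mulr1n => <-; apply: eq_bigr => k _.
by rewrite !mxE.
Qed.

End Gram.
End Bilinear.

Section UniCoords.
Variables (A : comNzRingType) (M : lmodType A) (n : nat).
Variables (x : 'I_n -> M) (phi : 'I_n -> M -> A).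

Definition hypX (i : 'I_n.+2) : hypQ M :=
  if unlift ord0 i is Some j then
    if unlift ord0 j is Some k then (x k, (0, 0)) else (0, (0, 1))
  else (0, (1, 0)).
Definition hypPhi (i : 'I_n.+2) (u : hypQ M) : A :=
  if unlift ord0 i is Some j then
    if unlift ord0 j is Some k then phi k u.1 else u.2.2
  else u.2.1.

Hypothesis db : dual_basis x phi.

Lemma hyp_dual_basis : dual_basis hypX hypPhi.
Proof.
split=> [i a u v|u]; rewrite /hypPhi /hypX.
  case: (unlift _ i) => // j; case: (unlift _ j) => // k.
  by rewrite -(db_scalar db).
rewrite !big_ord_recl !unlift_none !liftK !unlift_none.
under eq_bigr do rewrite !liftK.
have -> : \sum_i phi i u.1 *: (x i, (0, 0)) = (\sum_i phi i u.1 *: x i, (0, 0)) :> hypQ M.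
  elim/big_rec2: _ => // i y v _ ->.
  by apply: prod_ext => //=; apply: prod_ext; rewrite /= ?scaler0 ?addr0.
rewrite -(db_sum db u.1).
have e1 (c : A) : c *: (1 : A^o) = c by rewrite -[LHS]/(c * 1) mulr1.
apply: prod_ext; rewrite /= ?scaler0 ?add0r //.
by apply: prod_ext; rewrite /= ?scaler0 ?add0r ?addr0 ?e1.
Qed.

Variables (F : M -> M -> A) (lam hf : A).
Hypothesis Fb : bilin F.
Hypothesis Fsym : forall y z, F z y = lam * F y z.
Hypothesis lam_pm : lam = 1 \/ lam = -1.
Hypothesis hf2 : hf + hf = 1.

(* [sp_form] for lam = -1 and [orth_form] for lam = 1. *)
Definition qf (u v : hypQ M) : A :=
  F u.1 v.1 + (u.2.1 : A) * v.2.2 + lam * ((u.2.2 : A) * v.2.1).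

Lemma qf_scalarr u : scalar (qf u).
Proof.
by move=> a v w; rewrite /qf /= Fb.2 -![_ *: _]/(_ * _) /=; ring.
Qed.

Lemma qf_scalarl v : scalar (qf^~ v).
Proof.
move=> a u w; rewrite /qf /=; have -> := Fb.1 v.1 a u.1 w.1.
by rewrite -![_ *: _]/(_ * _) /=; ring.
Qed.

Lemma qf_sym u v : qf v u = lam * qf u v.
Proof.
by rewrite /qf Fsym; case: (lam_pm) => ->; ring.
Qed.

Local Notation co := (coords hypPhi).
Definition hyp_J : 'M[A]_n.+2 := gram hypX qf.
Definition pl (s : bool) : hypQ M := if s then (0, (0, 1)) else (0, (1, 0)).
Local Notation J := hyp_J.
Local Notation et := (db_mx hypX hypPhi).
Local Notation bf := (bf J).

Lemma qf_bilin : bilin qf.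
Proof. by split; [exact: qf_scalarl|exact: qf_scalarr]. Qed.

Lemma hyp_bf u v : bf (co u) (co v) = qf u v.
Proof. exact: (gram_bf hyp_dual_basis qf_bilin). Qed.

Lemma hyp_JT : J^T = lam *: J.
Proof. by apply/matrixP => i j; rewrite !mxE qf_sym. Qed.

Lemma hyp_Jet : J *m et = J.
Proof. exact: (gram_db_mx hyp_dual_basis qf_bilin). Qed.

Lemma F0l y : F 0 y = 0.
Proof. by have [G e] := scalar_pack (Fb.1 y); rewrite -e linear0. Qed.
Lemma F0r y : F y 0 = 0.
Proof. by have [G e] := scalar_pack (Fb.2 y); rewrite -e linear0. Qed.

Lemma qf_pl s u : qf (pl s) u = if s then lam * (u.2.1 : A) else u.2.2.
Proof. by rewrite /qf; case: s; rewrite /= F0l !mul1r !mul0r ?mulr0 ?add0r ?addr0. Qed.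

Lemma qf_pl0 s : qf (pl s) (pl s) = 0.
Proof. by rewrite qf_pl; case: s; rewrite /= ?mulr0. Qed.

Lemma qf_plane : qf (pl false) (pl true) = 1.
Proof. by rewrite qf_pl. Qed.

Local Notation e := (co (pl false)).
Local Notation e' := (co (pl true)).

Lemma hyp_perp_coords u : perp_proj J lam et e e' *m co u = co (u.1, (0, 0)).
Proof.
have hd := hyp_dual_basis.
rewrite pi_app !hyp_bf (db_mx_coords hd) -!(coordsZ hd) -!(coordsB hd); congr co.
rewrite !qf_pl mulrA (lam2 lam_pm) mul1r.
have e1 (c : A) : c *: (1 : A^o) = c by rewrite -[LHS]/(c * 1) mulr1.
apply: prod_ext; rewrite /= ?scaler0 ?subr0 //.
by apply: prod_ext; rewrite /= ?scaler0 ?subr0 ?e1 ?subrr.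
Qed.

Lemma col_hyp_perp j : col j (perp_proj J lam et e e') = co ((hypX j).1, (0, 0)).
Proof.
have hd := hyp_dual_basis.
rewrite -hyp_perp_coords -col_db_mx -colM; congr col.
rewrite /perp_proj !mulmxBl (db_mx_idem hd) -scalemxAl /rk -!mulmxA hyp_Jet //.
Qed.

(** [tvf] and [lgf] are [utv] and [long] written on Q, along a vector of the plane and with q in
    P. *)
Definition tvf (s : bool) (q : M) (u : hypQ M) : hypQ M :=
  u + qf (pl s) u *: (q, (0, 0)) - (lam * F q u.1) *: pl s
  - (hf * F q q * qf (pl s) u) *: pl s.
Definition lgf (s : bool) (y : A) (u : hypQ M) : hypQ M :=
  u + (hf * (1 - lam) * y * qf (pl s) u) *: pl s.

Lemma qf_perp q u : qf (q, (0, 0)) u = F q u.1.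
Proof. by rewrite /qf /= !mul0r mulr0 !addr0. Qed.

Lemma tvf_coords s q u :
  co (tvf s q u) = utv J lam hf (co (pl s)) (co (q, (0, 0))) *m co u.
Proof.
have hd := hyp_dual_basis.
by rewrite utv_app !hyp_bf !qf_perp -!(coordsZ hd) -(coordsD hd) -!(coordsB hd).
Qed.

Lemma lgf_coords s y u : co (lgf s y u) = long J lam hf (co (pl s)) y *m co u.
Proof.
have hd := hyp_dual_basis.
by rewrite long_app !hyp_bf -!(coordsZ hd) -(coordsD hd).
Qed.

Section Transfer.
Variables (R : comNzRingType) (f : {rmorphism R -> A}).
Variables (J0 et0 : 'M[R]_n.+2) (lam0 hf0 : R) (e0 e0' : 'cV[R]_n.+2).
Hypotheses (fJ : map_mx f J0 = J) (fet : map_mx f et0 = et).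
Hypotheses (flam : f lam0 = lam) (fhf : f hf0 = hf).
Hypotheses (fe : map_mx f e0 = e) (fe' : map_mx f e0' = e').
Local Notation gen := (uni_gen J0 lam0 hf0 et0 e0 e0').
Local Notation EL := (elem_group gen f).

Lemma fplane s : map_mx f (plane e0 e0' s) = co (pl s).
Proof. by case: s. Qed.

Lemma fperp : map_mx f (perp_proj J0 lam0 et0 e0 e0') = perp_proj J lam et e e'.
Proof. by rewrite /perp_proj !map_mxB map_mxZ !map_rk fJ flam fet fe fe'. Qed.

Lemma uni_gen_utv s j t : gen (s, Some j) f t =
  utv J lam hf (co (pl s)) (co (t *: (hypX j).1, (0, 0))).
Proof.
rewrite /uni_gen /= fJ flam fhf fplane fperp col_hyp_perp.
rewrite -(coordsZ hyp_dual_basis); congr (utv _ _ _ _ (coords _ _)).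
by apply: prod_ext => //=; rewrite scaler0.
Qed.

Lemma uni_gen_long s t : gen (s, None) f t = long J lam hf (co (pl s)) t.
Proof. by rewrite /uni_gen /= fJ flam fhf fplane. Qed.

Lemma uni_elem_ET T H :
  (forall s j t, subgroup_gen T (tvf s (t *: (hypX j).1))) ->
  (forall s t, subgroup_gen T (lgf s t)) ->
  EL H -> exists2 g, subgroup_gen T g & forall u, co (g u) = H *m co u.
Proof.
move=> Tt Tl; elim=> [|[s [j|]] t {}H _ [g gE eg]].
- by exists id => [|u]; [exact: subgroup_gen_id|rewrite mul1mx].
- exists (tvf s (t *: (hypX j).1) \o g) => [|u]; first exact: subgroup_gen_comp.
  by rewrite /= tvf_coords eg uni_gen_utv mulmxA.
- exists (lgf s t \o g) => [|u]; first exact: subgroup_gen_comp.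
  by rewrite /= lgf_coords eg uni_gen_long mulmxA.
Qed.

Lemma co_pl0 s : bf (co (pl s)) (co (pl s)) = 0.
Proof. by rewrite hyp_bf qf_pl0. Qed.

Lemma co_perp s q : bf (co (pl s)) (co (q, (0, 0))) = 0.
Proof. by rewrite hyp_bf qf_pl; case: s; rewrite /= ?mulr0. Qed.

Lemma long_elem s y : EL (long J lam hf (co (pl s)) y).
Proof. by rewrite -uni_gen_long; apply: elem_gen. Qed.

(** The vector q is a combination of the generators of P; each addition is undone up to a factor
    [long], which is a generator as well. *)
Lemma utv_elem s q : EL (utv J lam hf (co (pl s)) (co (q, (0, 0)))).
Proof.
have hd := hyp_dual_basis.
pose inM (y : M) : hypQ M := (y, (0, 0)).
have inD y z : co (inM (y + z)) = co (inM y) + co (inM z).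
  rewrite -(coordsD hd); congr coords.
  by apply: prod_ext => //=; apply: prod_ext; rewrite /= addr0.
have h1 (c : 'I_n.+2 -> A) : (\sum_i c i *: hypX i).1 = \sum_i c i *: (hypX i).1.
  by elim/big_rec2: _ => // i y1 y2 _ /= <-.
rewrite -/(inM q).
have -> : q = \sum_i hypPhi i (inM q) *: (hypX i).1.
  by rewrite -h1 -(db_sum hd (inM q)).
elim/big_ind: _ => [|u v hu hv|i _].
- by rewrite (coords0 hd) utv0; apply: elem_group1.
- rewrite inD -[utv _ _ _ _ _]mulmx1 -(long0 J lam hf (co (pl s))).
  rewrite -(subrr (bf (co (inM u)) (co (inM v)))) longD ?co_pl0 // mulmxA -utvD //.
  + by apply: elem_mul; [exact: elem_mul|exact: long_elem].
  + exact: hyp_JT.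
  + exact: co_pl0.
  + exact: co_perp.
  + exact: co_perp.
- by rewrite -uni_gen_utv; apply: elem_gen.
Qed.

Hypothesis EL_inv : forall H, EL H -> exists2 H', EL H' & H *m H' = 1%:M.

Lemma uni_ET_elem T : (forall g, T g -> exists2 H, EL H & forall u, co (g u) = H *m co u) ->
  forall g, subgroup_gen T g -> exists2 H, EL H & forall u, co (g u) = H *m co u.
Proof.
move=> hT g; elim=> {g} [g Tg||g h _ [H HE eH] _ [H' H'E eH']|g h _ [H HE eH] gh hg].
- exact: hT.
- by exists 1%:M => [|u]; [exact: elem_group1|rewrite mul1mx].
- by exists (H *m H') => [|u]; [exact: elem_mul|rewrite /= eH eH' mulmxA].
- have [H' H'E HH'] := EL_inv HE; exists H' => // u.
  by rewrite -[u in RHS]hg eH mulmxA (mulmx1C HH') mul1mx.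
Qed.

End Transfer.
End UniCoords.

(** * Bilinear forms under base change *)

Section FormBaseChange.
Variables (R S : comNzRingType) (f : {rmorphism R -> S}) (M : lmodType R).
Variables (F : M -> M -> R) (lam : R).
Hypothesis Fb : bilin F.
Hypothesis Fsym : forall x y, F y x = lam * F x y.
Local Notation F' := (@basechange_form R S f M F).

Let inner s x (t : S) y : S := s * t * f (F x y).

Lemma inner_balanced s x : BaseChange.balanced f (inner s x).
Proof.
have [G e] := scalar_pack (Fb.2 x).
split=> [y t1 t2|t y1 y2|t r y]; rewrite /inner -?e.
- by rewrite mulrDr mulrDl.
- by rewrite linearD rmorphD mulrDr !e.
- by rewrite linearZ rmorphM !mulrA e.
Qed.

Lemma inner_lift_pure s x t y :
  BaseChange.lift (inner s x) (BaseChange.pure f t y) = inner s x t y.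
Proof. by rewrite (BaseChange.lift_pure (inner_balanced s x)). Qed.

Lemma lift_innerD s x (v w : basechange f M) :
  BaseChange.lift (inner s x) (v + w) =
  BaseChange.lift (inner s x) v + BaseChange.lift (inner s x) w :> S.
Proof. exact: (BaseChange.liftD (inner_balanced s x)). Qed.

Lemma lift_inner0 s x : BaseChange.lift (inner s x) (0 : basechange f M) = 0 :> S.
Proof. exact: (morph0 (lift_innerD s x)). Qed.

Lemma outer_balanced v :
  BaseChange.balanced f (fun s x => BaseChange.lift (inner s x) (v : basechange f M)).
Proof.
have Fl y := scalar_pack (Fb.1 y).
split=> [x s t|s x y|s r x]; elim/BaseChange.pure_ind: v => [|t' z|v w IHv IHw];
  rewrite ?lift_inner0 ?addr0 // ?inner_lift_pure ?lift_innerD.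
- by rewrite /inner !mulrDl.
- by rewrite IHv IHw addrACA.
- by rewrite /inner; have [G e] := Fl z; rewrite -!e linearD rmorphD mulrDr.
- by rewrite IHv IHw addrACA.
- by rewrite /inner; have [G e] := Fl z; rewrite -!e linearZ rmorphM /=; ring.
- by rewrite IHv IHw.
Qed.

Lemma bcF_pure s x t y :
  F' (BaseChange.pure f s x) (BaseChange.pure f t y) = s * t * f (F x y).
Proof.
by rewrite /basechange_form (BaseChange.lift_pure (outer_balanced _)) inner_lift_pure.
Qed.

Lemma bcF_bc1 x y : F' (bc1 f x) (bc1 f y) = f (F x y).
Proof. by rewrite bcF_pure !mul1r. Qed.

Lemma bcFDl v : {morph F'^~ v : u w / u + w}.
Proof. exact: (BaseChange.liftD (outer_balanced v)). Qed.

Lemma bcFDr u : {morph F' u : v w / v + w}.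
Proof.
elim/BaseChange.pure_ind: u => [|s x|u1 u2 IH1 IH2] v w.
- by rewrite !(morph0 (bcFDl _)) addr0.
- by rewrite /basechange_form !(BaseChange.lift_pure (outer_balanced _)) lift_innerD.
- by rewrite !bcFDl IH1 IH2 addrACA.
Qed.

Lemma bcF_bilin : bilin F'.
Proof.
split=> [v|u] a w1 w2.
  rewrite bcFDl; congr (_ + _).
  elim/BaseChange.pure_ind: w1 => [|s x|u1 u2 IH1 IH2].
  - by rewrite scaler0 !(morph0 (bcFDl _)) mulr0.
  - elim/BaseChange.pure_ind: v => [|t y|v1 v2 IH1 IH2].
    + by rewrite !(morph0 (bcFDr _)) mulr0.
    + by rewrite BaseChange.scale_pure !bcF_pure !mulrA.
    + by rewrite !bcFDr IH1 IH2 mulrDr.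
  - by rewrite scalerDr !bcFDl IH1 IH2 mulrDr.
rewrite bcFDr; congr (_ + _).
elim/BaseChange.pure_ind: w1 => [|t y|v1 v2 IH1 IH2].
- by rewrite scaler0 !(morph0 (bcFDr _)) mulr0.
- elim/BaseChange.pure_ind: u => [|s x|u1 u2 IH1 IH2].
  + by rewrite !(morph0 (bcFDl _)) mulr0.
  + by rewrite BaseChange.scale_pure !bcF_pure; ring.
  + by rewrite !bcFDl IH1 IH2 mulrDr.
- by rewrite scalerDr !bcFDr IH1 IH2 mulrDr.
Qed.

Lemma bcF_sym u v : F' v u = f lam * F' u v.
Proof.
elim/BaseChange.pure_ind: u => [|s x|u1 u2 IH1 IH2].
- by rewrite (morph0 (bcFDl _)) (morph0 (bcFDr _)) mulr0.
- elim/BaseChange.pure_ind: v => [|t y|v1 v2 IH1 IH2].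
  + by rewrite (morph0 (bcFDl _)) (morph0 (bcFDr _)) mulr0.
  + by rewrite !bcF_pure Fsym rmorphM; ring.
  + by rewrite bcFDl bcFDr IH1 IH2 mulrDr.
- by rewrite bcFDl bcFDr IH1 IH2 mulrDr.
Qed.

End FormBaseChange.

Section UniCompat.
Variables (R S : comNzRingType) (f : {rmorphism R -> S}) (M : lmodType R) (n : nat).
Variables (x : 'I_n -> M) (phi : 'I_n -> M -> R) (F : M -> M -> R) (lam : R).
Hypothesis db : dual_basis x phi.
Hypothesis Fb : bilin F.
Local Notation x' := (fun i => bc1 f (x i)).
Local Notation phi' := (fun i => bc_phi f (phi i)).
Local Notation F' := (@basechange_form R S f M F).

Definition bc_hyp (u : hypQ M) : hypQ (basechange f M) :=
  (bc1 f u.1, (f u.2.1, f u.2.2)).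

Lemma bc_hypX j : bc_hyp (hypX x j) = hypX x' j.
Proof.
rewrite /bc_hyp /hypX; case: (unlift _ _) => [i|] /=; last first.
  by rewrite bc1_0 rmorph1 rmorph0.
case: (unlift _ _) => [k|] /=; first by rewrite rmorph0.
by rewrite bc1_0 rmorph1 rmorph0.
Qed.

Lemma bc_hypPhi u : coords (hypPhi phi') (bc_hyp u) = map_mx f (coords (hypPhi phi) u).
Proof.
apply/matrixP => i j; rewrite !mxE /hypPhi /bc_hyp; case: (unlift _ _) => [k|] //=.
case: (unlift _ _) => [k'|] //=.
by rewrite bc_phi1 //; apply: (db_scalar db).
Qed.

Lemma bc_qf u v : qf F' (f lam) (bc_hyp u) (bc_hyp v) = f (qf F lam u v).
Proof. by rewrite /qf /= bcF_bc1 // !rmorphD !rmorphM. Qed.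

Lemma map_hyp_J : map_mx f (hyp_J x F lam) = hyp_J x' F' (f lam).
Proof. by apply/matrixP => i j; rewrite !mxE -!bc_hypX bc_qf. Qed.

Lemma map_hyp_et : map_mx f (db_mx (hypX x) (hypPhi phi)) = db_mx (hypX x') (hypPhi phi').
Proof. exact: (map_db_mx bc_hypPhi bc_hypX). Qed.

Lemma bc_pl s : bc_hyp (pl M s) = pl (basechange f M) s.
Proof. by case: s; rewrite /bc_hyp /= bc1_0 rmorph1 rmorph0. Qed.

Lemma map_co_pl s :
  map_mx f (coords (hypPhi phi) (pl M s)) = coords (hypPhi phi') (pl (basechange f M) s).
Proof. by rewrite -bc_pl bc_hypPhi. Qed.

End UniCompat.

(** * Hyperbolic bases from the local hypothesis *)

Section HyperbolicLocal.
Variables (R : comNzRingType) (p : prime_idealr R) (P : lmodType R) (n m : nat).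
Variables (x : 'I_n -> P) (phi : 'I_n -> P -> R) (F : P -> P -> R) (lam hf : R).
Hypothesis db : dual_basis x phi.
Hypothesis Fb : bilin F.
Hypothesis Fsym : forall y z, F z y = lam * F y z.
Hypothesis lam_pm : lam = 1 \/ lam = -1.
Hypothesis hf2 : hf + hf = 1.
Local Notation A := (localization p).
Local Notation V := 'rV[A]_m.

Definition hyperbolic_form (l : A) (u v : hyperbolic V) : A := u.2 v.1 + l * v.2 u.1.

Lemma coord_lin k : linear (fun v : V => v 0 k : A^o).
Proof. by move=> a u v; rewrite !mxE. Qed.

Definition coord_fun k : 'Hom(V, A^o) :=
  linfun (HB.pack_for {linear V -> A^o} (fun v : V => v 0 k : A^o)
    (GRing.isLinear.Build _ _ _ *:%R (fun v : V => v 0 k : A^o) (coord_lin k))).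

Lemma coord_funE k v : coord_fun k v = v 0 k.
Proof. by rewrite lfunE. Qed.

(** The coordinate form carries the index [false], so that its pairing with the partner vector is 1
    rather than lam. *)
Definition hyp_vec (i : 'I_m * bool) : hyperbolic V :=
  if i.2 then (delta_mx 0 i.1, 0) else (0, coord_fun i.1).

Lemma hyp_vec_form l i j : hyperbolic_form l (hyp_vec i) (hyp_vec j) =
  if j == bar i then hyp_sign l i.2 else 0.
Proof.
case: i j => [k s] [k' s']; rewrite /hyperbolic_form /hyp_vec /bar xpair_eqE.
case: s; case: s' => /=; rewrite ?andbF ?andbT.
- by rewrite !lfunE /= mulr0 addr0.
- by rewrite lfunE add0r coord_funE mxE eqxx eq_sym; case: eqP; rewrite ?mulr1 ?mulr0.
- by rewrite coord_funE lfunE /= mulr0 addr0 mxE eqxx eq_sym; case: eqP.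
- by rewrite !linear0 mulr0 addr0.
Qed.

Lemma hyp_vec_expand l (w : hyperbolic V) : l * l = 1 ->
  w = \sum_i (hyp_sign l (~~ i.2) * hyperbolic_form l (hyp_vec (bar i)) w) *: hyp_vec i.
Proof.
move=> ll.
have h1 (c : 'I_m * bool -> A) :
    (\sum_i c i *: hyp_vec i).1 = \sum_i c i *: (hyp_vec i).1.
  by elim/big_rec2: _ => // i y1 y2 _ /= <-.
have h2 (c : 'I_m * bool -> A) :
    (\sum_i c i *: hyp_vec i).2 = \sum_i c i *: (hyp_vec i).2.
  by elim/big_rec2: _ => // i y1 y2 _ /= <-.
have pairs (W : zmodType) (G : 'I_m * bool -> W) :
    \sum_i G i = \sum_k (G (k, false) + G (k, true)).
  rewrite (eq_bigr (fun i => G (i.1, i.2))); last by case.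
  rewrite -(pair_bigA _ (fun k s => G (k, s))) /=; apply: eq_bigr => k _.
  by rewrite big_bool addrC.
apply: prod_ext.
  rewrite h1 pairs /hyp_vec /bar /= {1}(row_sum_delta w.1); apply: eq_bigr => k _.
  rewrite scaler0 add0r mul1r /hyperbolic_form /=.
  by rewrite coord_funE linear0 mulr0 addr0.
rewrite h2 pairs /hyp_vec /bar /=; apply/lfunP => v.
rewrite {1}(row_sum_delta v) linear_sum sum_lfunE; apply: eq_bigr => k _.
rewrite scaler0 addr0 linearZ lfunE /= coord_funE /hyperbolic_form /= lfunE /= add0r.
by rewrite mulrA ll mul1r -[LHS]/(_ * _) -[RHS]/(_ * _) mulrC.
Qed.

Local Notation co := (coords (hypPhi phi)).
Local Notation X := (hypX x).
Local Notation Phi := (hypPhi phi).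

Lemma hyperbolic_hyp_basis
    (h : {linear locmod p (hypQ P) -> hyperbolic V}) :
  is_isometry (locmod_form (p := p) (qf F lam)) (hyperbolic_form (loc p lam)) h ->
  exists b, @hyp_basis _ _ (map_mx (loc p) (hyp_J x F lam)) (loc p lam)
    (map_mx (loc p) (db_mx X Phi)) m b.
Proof.
move=> [[h' hK h'K] hiso].
have hd := hyp_dual_basis db.
have qb := qf_bilin lam Fb.
have db' := bc_dual_basis (loc p) hd.
have ll : loc p lam * loc p lam = 1 by rewrite -rmorphM (lam2 lam_pm) rmorph1.
set Xp := fun i => bc1 (loc p) (X i) in db'; set Php := fun i => bc_phi (loc p) (Phi i) in db'.
have Qb : bilin (locmod_form (p := p) (qf F lam)) := bcF_bilin (loc p) qb.
have JE : map_mx (loc p) (hyp_J x F lam) = gram Xp (locmod_form (p := p) (qf F lam)).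
  by apply/matrixP => i j; rewrite !mxE /locmod_form bcF_bc1.
have etE : map_mx (loc p) (db_mx X Phi) = db_mx Xp Php by rewrite -(bc_db_mx _ hd).
rewrite JE etE.
pose b i := coords Php (h' (hyp_vec i)).
have bco i y : bf (gram Xp (locmod_form (p := p) (qf F lam))) (b i) (coords Php y) =
    hyperbolic_form (loc p lam) (hyp_vec i) (h y).
  by rewrite (gram_bf db' Qb) -hiso h'K.
exists b; split=> [i j||i].
- by rewrite bco h'K hyp_vec_form.
- pose Mt := \sum_i hyp_sign (loc p lam) (~~ i.2) *:
    rk (gram Xp (locmod_form (p := p) (qf F lam))) (b i) (b (bar i)).
  rewrite -/Mt; have <- : Mt *m db_mx Xp Php = Mt.
    rewrite /Mt mulmx_suml; apply: eq_bigr => i _; rewrite -scalemxAl; congr (_ *: _).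
    by rewrite /rk -!mulmxA (gram_db_mx db' Qb).
  apply: eq_cols => j; rewrite colM col_db_mx /Mt mulmx_suml.
  rewrite -[in LHS](hK (Xp j)) {1}(hyp_vec_expand (h (Xp j)) ll).
  have h'l : linear h' := can2_linear hK h'K.
  pose L := GRing.isLinear.Build _ _ _ *:%R h' h'l.
  pose H : {linear hyperbolic V -> locmod p (hypQ P)} := HB.pack_for {linear _ -> _} h' L.
  rewrite -[h' _]/(H _) linear_sum.
  have -> : \sum_i H ((hyp_sign (loc p lam) (~~ i.2) *
      hyperbolic_form (loc p lam) (hyp_vec (bar i)) (h (Xp j))) *: hyp_vec i) =
     \sum_i (hyp_sign (loc p lam) (~~ i.2) *
      hyperbolic_form (loc p lam) (hyp_vec (bar i)) (h (Xp j))) *: h' (hyp_vec i).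
    by apply: eq_bigr => i _; rewrite linearZ.
  rewrite (coords_sum db'); apply: eq_bigr => i _.
  by rewrite -scalemxAl rk_app bco scalerA.
- by rewrite (db_mx_coords db').
Qed.

Local Notation e := (co (pl P false)).
Local Notation e' := (co (pl P true)).

Lemma hyperbolic_uni_basis : (3 <= m)%N ->
  isometric (locmod_form (p := p) (qf F lam)) (hyperbolic_form (loc p lam)) ->
  uni_basis (hyp_J x F lam) lam (db_mx X Phi) e e' (loc p).
Proof.
move=> m3 [h /hyperbolic_hyp_basis[b hb]].
have hd := hyp_dual_basis db.
have JT := fJT (hyp_JT x Fsym lam_pm) (loc p).
have lp := flam_pm lam_pm (loc p).
have h2 := fhf2 hf2 (loc p).
have Jet : map_mx (loc p) (hyp_J x F lam) *m map_mx (loc p) (db_mx X Phi) =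
    map_mx (loc p) (hyp_J x F lam) by rewrite -map_mxM (hyp_Jet db lam Fb).
have [b' [k0 [[bb btot etb] bk0]]] : exists b' k0,
    @hyp_basis _ _ (map_mx (loc p) (hyp_J x F lam)) (loc p lam)
      (map_mx (loc p) (db_mx X Phi)) m b' /\
    forall s, b' (k0, s) = if s then map_mx (loc p) e' else map_mx (loc p) e.
  apply: (hyp_basis_extends JT lp h2 Jet hb).
  - by rewrite -map_mxM (db_mx_coords hd).
  - by rewrite -map_mxM (db_mx_coords hd).
  - by rewrite map_bf (co_pl0 db lam Fb) rmorph0.
  - by rewrite map_bf (co_pl0 db lam Fb) rmorph0.
  - by rewrite map_bf (hyp_bf db lam Fb) (qf_plane lam Fb) rmorph1.
exists m, b', k0; split=> // s; rewrite bk0; by case: s.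
Qed.

End HyperbolicLocal.

(** * Values of the form and isotropic vectors of P *)

Section LiftIsotropic.
Variables (R : comNzRingType) (P : lmodType R) (n : nat).
Variables (x : 'I_n -> P) (phi : 'I_n -> P -> R) (F : P -> P -> R) (lam : R).
Hypothesis db : dual_basis x phi.
Hypothesis Fb : bilin F.
Hypothesis lam_pm : lam = 1 \/ lam = -1.
Local Notation co := (coords (hypPhi phi)).
Local Notation X := (hypX x).
Local Notation J := (hyp_J x F lam).
Local Notation et := (db_mx X (hypPhi phi)).
Local Notation e := (co (pl P false)).
Local Notation e' := (co (pl P true)).

Lemma FZ a q q' : F (a *: q) q' = a * F q q'.
Proof. by have [G eG] := scalar_pack (Fb.1 q'); rewrite -!eG linearZ. Qed.

Lemma FZr a q q' : F q (a *: q') = a * F q q'.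
Proof. by have [G eG] := scalar_pack (Fb.2 q); rewrite -!eG linearZ. Qed.

(** The additive group generated by the values of F, given by its universal property; it is an ideal
    because F is bilinear. [isotropic_span] is encoded in the same way, for isotropic vectors. *)
Definition value_ideal (a : R) : Prop := forall Z : R -> Prop,
  Z 0 -> (forall u v, Z u -> Z v -> Z (u + v)) -> (forall q q', Z (F q q')) -> Z a.

Definition isotropic_span (y : P) : Prop := forall Z : P -> Prop,
  Z 0 -> (forall u v, Z u -> Z v -> Z (u + v)) -> (forall q, F q q = 0 -> Z q) -> Z y.

Lemma isotropic_spanZ a y : isotropic_span y -> isotropic_span (a *: y).
Proof.
move=> h Z Z0 ZD Zq; apply: (h (fun u => Z (a *: u))) => [|u v hu hv|q qq].
- by rewrite scaler0.
- by rewrite scalerDr; apply: ZD.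
- by apply: Zq; rewrite FZ FZr qq !mulr0.
Qed.

Lemma isotropic_spanD u v : isotropic_span u -> isotropic_span v -> isotropic_span (u + v).
Proof. by move=> hu hv Z Z0 ZD Zq; exact: ZD (hu Z Z0 ZD Zq) (hv Z Z0 ZD Zq). Qed.

Lemma isotropic_span0 : isotropic_span 0. Proof. by []. Qed.

Section AtMaximal.
Variable p : prime_idealr R.
Variables (m : nat) (b : 'I_m * bool -> 'cV[localization p]_n.+2) (k0 : 'I_m).
Hypothesis m3 : (3 <= m)%N.
Hypothesis bb : forall i j, bf (map_mx (loc p) J) (b i) (b j) =
  if j == bar i then hyp_sign (loc p lam) i.2 else 0.
Hypothesis btot : map_mx (loc p) et =
  \sum_i hyp_sign (loc p lam) (~~ i.2) *: rk (map_mx (loc p) J) (b i) (b (bar i)).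
Hypothesis etb : forall i, map_mx (loc p) et *m b i = b i.
Hypothesis bk0 : forall s, b (k0, s) = map_mx (loc p) (plane e e' s).

Lemma vec_den k (v : 'cV[localization p]_k) :
  exists2 s, s \notin p & exists v0, map_mx (loc p) v0 = loc p s *: v.
Proof.
have [||s sp h] := @common_den R p _ (fun (i : 'I_k) s => exists a, loc p a = loc p s * v i 0).
- by move=> i s r [a ea]; exists (r * a); rewrite !rmorphM ea mulrA.
- by move=> i; apply: loc_surj.
have [c cP] := choice h; exists s => //; exists (\col_i c i).
by apply/matrixP => i j; rewrite !mxE ord1 cP.
Qed.

(** A basis vector outside the plane [k0] is orthogonal to e and e', hence lies in P_p; clearing
    denominators and projecting to P gives q. *)
Lemma lift_basis i : i.1 != k0 ->
  exists2 s, s \notin p & exists q, map_mx (loc p) (co (q, (0, 0))) = loc p s *: b i.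
Proof.
move=> ik; have [s sp [v0 ev]] := vec_den (b i).
exists s => //; exists (db_comb X v0).1.
have hd := hyp_dual_basis db.
have perp t : bf (map_mx (loc p) J) (b (k0, t)) (b i) = 0.
  by rewrite bb; case: eqP => // ei; rewrite ei eqxx in ik.
rewrite -(hyp_perp_coords db Fb lam_pm) (coords_comb hd) !map_mxM ev -!scalemxAr etb.
congr (_ *: _); rewrite /perp_proj !map_mxB map_mxZ !map_rk.
rewrite !mulmxBl -scalemxAl !rk_app etb.
by rewrite -[map_mx _ e](bk0 false) -[map_mx _ e'](bk0 true) !perp !scale0r scaler0 !subr0.
Qed.

Lemma loc_F q q' : loc p (F q q') =
  bf (map_mx (loc p) J) (map_mx (loc p) (co (q, (0, 0)))) (map_mx (loc p) (co (q', (0, 0)))).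
Proof. by rewrite map_bf (hyp_bf db lam Fb) qf_perp. Qed.

Lemma loc_eq a c : loc p a = loc p c -> exists2 t, t \notin p & t * a = t * c.
Proof.
move=> h; have [|t tp et] := @loc_eq0 _ p (a - c); first by rewrite rmorphB h subrr.
by exists t => //; apply/eqP; rewrite -subr_eq0 -mulrBr et.
Qed.

(** Multiples of two partners in a second plane lift to P, and their pairing is a product of
    denominators up to torsion. *)
Lemma value_ideal_loc : exists2 s, s \notin p & value_ideal s.
Proof.
have [k1 /andP[k10 _]] := third m3 k0 k0.
have [s sp [q eq]] := lift_basis (i := (k1, false)) k10.
have [s' s'p [q' eq']] := lift_basis (i := (k1, true)) k10.
have [|t tp et] := @loc_eq (F q q') (s * s').
  by rewrite loc_F eq eq' bfZl bfZr bb eqxx mulr1 rmorphM.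
exists (t * (s * s')); first by rewrite !prime_idealrM !negb_or tp sp.
by move=> Z _ _ ZF; rewrite -et -FZ; apply: ZF.
Qed.

(** The basis vectors outside the plane [k0] form an isotropic basis of P_p. They are lifted to
    isotropic vectors of P, and the expansion of a generator of P is cleared of denominators. *)
Lemma isotropic_span_loc : exists2 s, s \notin p & forall j, isotropic_span (s *: (X j).1).
Proof.
apply: common_den => [j s r h|j]; first by rewrite -scalerA; apply: isotropic_spanZ.
have hd := hyp_dual_basis db.
have [||s sp hq] := @common_den R p _ (fun (i : 'I_m * bool) s => exists2 q, F q q = 0 &
    (i.1 != k0 -> map_mx (loc p) (co (q, (0, 0))) = loc p s *: b i)).
- move=> i s r [q qq eq]; exists (r *: q) => [|ik]; first by rewrite FZ FZr qq !mulr0.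
  rewrite rmorphM -scalerA -eq // -map_mxZ -(coordsZ hd); congr (map_mx _ (coords _ _)).
  by apply: prod_ext => //=; apply: prod_ext; rewrite /= scaler0.
- move=> i; have [ik|ik] := boolP (i.1 == k0).
    by exists 1; rewrite ?idealr1 //; exists 0; rewrite ?(F0l Fb).
  have [s sp [q eq]] := lift_basis ik.
  (* The lift is isotropic only up to torsion: t F(q, q) = 0, so t q is isotropic. *)
  have [|t tp et] := @loc_eq (F q q) 0.
    rewrite loc_F eq bfZl bfZr bb rmorph0.
    by case: i {ik eq} => k t; rewrite xpair_eqE; case: t; rewrite andbF !mulr0.
  exists (t * s); first by rewrite prime_idealrM negb_or tp.
  exists (t *: q) => [|_]; first by rewrite FZ FZr et !mulr0.
  rewrite rmorphM -scalerA -eq -map_mxZ -(coordsZ hd); congr (map_mx _ (coords _ _)).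
  by apply: prod_ext => //=; apply: prod_ext; rewrite /= scaler0.
have /choice[q qP] : forall i, exists q, F q q = 0 /\
    (i.1 != k0 -> map_mx (loc p) (co (q, (0, 0))) = loc p s *: b i).
  by move=> i; have [q q1 q2] := hq i; exists q.
pose w := map_mx (loc p) (co ((X j).1, (0, 0))).
pose c i := hyp_sign (loc p lam) (~~ i.2) * bf (map_mx (loc p) J) (b (bar i)) w.
have we : w = \sum_i c i *: b i.
  transitivity (map_mx (loc p) et *m w).
    by rewrite /w -map_mxM (db_mx_coords hd).
  rewrite btot mulmx_suml; apply: eq_bigr => i _.
  by rewrite -scalemxAl rk_app scalerA.
(* Vectors of P are orthogonal to e and e', so the plane [k0] does not contribute. *)
have c0 i : i.1 == k0 -> c i = 0.
  move=> /eqP ik; rewrite /c /bar ik bk0 /w.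
  have -> : plane e e' (~~ i.2) = co (pl P (~~ i.2)) by case: (~~ _).
  by rewrite map_bf (co_perp db lam Fb) rmorph0 mulr0.
have [||s' s'p hc] := @common_den R p _ (fun (i : 'I_m * bool) s' =>
    exists a, loc p a = loc p s' * c i).
- by move=> i s' r [a ea]; exists (r * a); rewrite !rmorphM ea mulrA.
- by move=> i; apply: loc_surj.
have [a aP] := choice hc.
pose y := \sum_(i | i.1 != k0) a i *: q i.
have inD u v : co (u + v, (0, 0)) = co (u, (0, 0)) + co (v, (0, 0)).
  rewrite -(coordsD hd); congr coords.
  by apply: prod_ext => //=; apply: prod_ext; rewrite /= addr0.
have inZ r u : co (r *: u, (0, 0)) = r *: co (u, (0, 0)).
  rewrite -(coordsZ hd); congr coords.
  by apply: prod_ext => //=; apply: prod_ext; rewrite /= scaler0.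
have ey : map_mx (loc p) (co (y, (0, 0))) =
    map_mx (loc p) (co ((s' * s) *: (X j).1, (0, 0))).
  rewrite inZ map_mxZ -/w we (bigID (fun i => i.1 == k0)) /= big1 ?add0r; last first.
    by move=> i ik; rewrite c0 // scale0r.
  rewrite scaler_sumr /y.
  elim/big_rec2: _ => [|i u v ik IH]; first by rewrite (coords0 hd) map_mx0.
  rewrite inD inZ map_mxD map_mxZ IH (qP i).2 // aP !scalerA rmorphM.
  by congr (_ *: _ + _); rewrite mulrAC.
have [||t tp et0] := @common_den R p _ (fun (i : 'I_n.+2) t =>
    t * co (y, (0, 0)) i 0 = t * co ((s' * s) *: (X j).1, (0, 0)) i 0).
- by move=> i t r h; rewrite -!mulrA h.
- move=> i; apply: loc_eq.
  by have := congr1 (fun v : 'cV_n.+2 => v i 0) ey; rewrite [LHS]mxE [RHS]mxE.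
have ety : t *: y = (t * (s' * s)) *: (X j).1.
  have /(congr1 fst) : (t *: y, (0, 0)) = (t *: ((s' * s) *: (X j).1), (0, 0)) :> hypQ P.
    apply: (coords_inj hd); rewrite !(inZ t); apply/matrixP => i k.
    by rewrite [LHS]mxE [RHS]mxE ord1 et0.
  by rewrite /= scalerA.
exists (t * (s' * s)); first by rewrite !prime_idealrM !negb_or tp s'p.
rewrite -ety; apply: isotropic_spanZ; rewrite /y.
elim/big_ind: _ => [|u v|i ik]; [exact: isotropic_span0|exact: isotropic_spanD|].
by apply: isotropic_spanZ => Z _ _ Zq; apply: Zq; exact: (qP i).1.
Qed.

End AtMaximal.
Hypothesis bases : forall (M : {pred R}) (hM : maximal_ideal M),
  uni_basis J lam et e e' (loc (prime_of_maximal hM)).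

Lemma value_ideal1 : value_ideal 1.
Proof.
apply: one_in_ideal => [Z|a u v hu hv Z Z0 ZD ZF|M hM]; first by [].
  apply: (ZD); last exact: hv Z Z0 ZD ZF.
  apply: (hu (fun u => Z (a * u))) => [|u1 u2 h1 h2|q q'].
  - by rewrite mulr0.
  - by rewrite mulrDr; apply: ZD.
  - by rewrite -FZ.
have [m [b [k0 [m3 bb btot etb bk0]]]] := bases hM.
by have [s sp h] := value_ideal_loc m3 bb etb bk0; exists s.
Qed.

Lemma isotropic_span_gen j : isotropic_span (X j).1.
Proof.
rewrite -[(X j).1]scale1r.
apply: (one_in_ideal (J := fun a => isotropic_span (a *: (X j).1))) => [|a u v hu hv|M hM].
- by rewrite scale0r.
- by rewrite scalerDl -scalerA; apply: isotropic_spanD => //; apply: isotropic_spanZ.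
have [m [b [k0 [m3 bb btot etb bk0]]]] := bases hM.
by have [s sp h] := isotropic_span_loc bb btot etb bk0; exists s.
Qed.

End LiftIsotropic.

(** * Symplectic and orthogonal elementary groups *)

Section SymplecticTransvections.
Variables (A : comNzRingType) (M : lmodType A) (F : M -> M -> A) (hf : A).
Hypothesis Fb : bilin F.
Hypothesis Falt : forall q, F q q = 0.
Hypothesis hf2 : hf + hf = 1.

Lemma bilinD y z w : F (y + z) w = F y w + F z w.
Proof. by have := Fb.1 w 1 y z; rewrite scale1r mul1r. Qed.

Lemma bilinDr y z w : F w (y + z) = F w y + F w z.
Proof. by have := Fb.2 w 1 y z; rewrite scale1r mul1r. Qed.

Lemma bilinN y w : F (- y) w = - F y w.
Proof. by rewrite -scaleN1r (FZ Fb) mulN1r. Qed.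

Lemma bilinNr y w : F w (- y) = - F w y.
Proof. by rewrite -scaleN1r (FZr Fb) mulN1r. Qed.

Lemma alternating_skew y z : F z y = -1 * F y z.
Proof.
have := Falt (y + z); rewrite bilinD !bilinDr !Falt add0r addr0 mulN1r => /eqP.
by rewrite addr_eq0 => /eqP ->; rewrite opprK.
Qed.

(** The pairs (q, z) form a Heisenberg group with cocycle F. The given elementary transvections are
    exactly the pairs with z = 1, which accounts for the term a or -b in their formulas. *)
Definition sp_pair (s : bool) (q : M) (z : A) (u : hypQ M) : hypQ M :=
  if s then (u.1 - (u.2.1 : A) *: q, (u.2.1, u.2.2 + F q u.1 - z * (u.2.1 : A)))
  else (u.1 + (u.2.2 : A) *: q, (u.2.1 + F q u.1 + z * (u.2.2 : A), u.2.2)).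

Lemma sp_pair_comp s q z q' z' :
  sp_pair s q z \o sp_pair s q' z' = sp_pair s (q + q') (z + z' + F q q').
Proof.
apply/funext => -[y [b a]]; rewrite /sp_pair /=; case: s => /=.
  rewrite !bilinD bilinDr bilinNr (FZr Fb) scalerDr opprD.
  apply: prod_ext; rewrite /= -?addrA; first by congr (_ + _); rewrite addrC.
  by apply: prod_ext => //=; ring.
rewrite !bilinD bilinDr (FZr Fb) scalerDr.
apply: prod_ext; rewrite /= -?addrA; first by congr (_ + _); rewrite addrC.
by apply: prod_ext => //=; ring.
Qed.

Lemma sp_pair0 s : sp_pair s 0 0 = id.
Proof.
apply/funext => -[y [b a]]; rewrite /sp_pair /= (F0l Fb) !scaler0 !mul0r.
by case: s; rewrite ?subr0 !addr0.
Qed.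

Lemma sp_pair_tvf s q z : sp_pair s q z = tvf F (-1) hf s q \o lgf F (-1) hf s z.
Proof.
have h : hf * (1 - -1) = 1 by rewrite opprK mulrDr mulr1.
have -> : lgf F (-1) hf s z = sp_pair s 0 z.
  apply/funext => -[y [b a]]; rewrite /lgf h (qf_pl _ Fb) /sp_pair.
  case: s; rewrite /= (F0l Fb) !scaler0 ?subr0 !addr0.
    apply: prod_ext; rewrite /= ?scaler0 ?addr0 //.
    apply: prod_ext; rewrite /= -?[_ *: _]/(_ * _) ?mulr0 ?addr0 //; ring.
  apply: prod_ext; rewrite /= ?scaler0 ?addr0 //.
  by apply: prod_ext; rewrite /= -?[_ *: _]/(_ * _) ?mulr0 ?addr0 //; ring.
have -> : tvf F (-1) hf s q = sp_pair s q 0.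
  apply/funext => -[y [b a]]; rewrite /tvf Falt (qf_pl _ Fb) /sp_pair.
  rewrite mulr0 mul0r scale0r subr0.
  case: s; apply: prod_ext; rewrite /= ?scaler0 ?subr0 ?mulN1r ?scaleNr //;
    by apply: prod_ext; rewrite /= -?[_ *: _]/(_ * _); ring.
by rewrite sp_pair_comp addr0 add0r (F0r Fb) addr0.
Qed.

Lemma sp_transvection_pair g : sp_transvection F g -> exists s q z, g = sp_pair s q z.
Proof.
case=> q.
  exists false, q, 1; apply/funext => -[y [b a]]; rewrite /sp_pair /=.
  by rewrite (alternating_skew q) mulN1r opprK mul1r.
exists true, (- q), 1; apply/funext => -[y [b a]]; rewrite /sp_pair /=.
by rewrite bilinN (alternating_skew y) mulN1r opprK mul1r scalerN opprK.
Qed.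

Lemma ET_sp_pair1 s q : ET_sp F (sp_pair s q 1).
Proof.
case: s; apply: (@subgroup_gen_in _ (sp_transvection F)).
  have := SpTransvection2 F (- q); congr (sp_transvection F _).
  apply/funext => -[y [b a]]; rewrite /sp_pair /=.
  by rewrite bilinNr (alternating_skew q) mulN1r opprK mul1r scalerN.
have := SpTransvection1 F q; congr (sp_transvection F _).
apply/funext => -[y [b a]]; rewrite /sp_pair /=.
by rewrite (alternating_skew q) mulN1r opprK mul1r.
Qed.

(** (q, 0) = (q, 1)(0, -1), and (0, -1) is the inverse of the given transvection with q = 0. *)
Lemma ET_sp_pair0 s q : ET_sp F (sp_pair s q 0).
Proof.
have -> : sp_pair s q 0 = sp_pair s q 1 \o sp_pair s 0 (-1).
  by rewrite sp_pair_comp addr0 (F0r Fb) subrr addr0.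
apply: subgroup_gen_comp; first exact: ET_sp_pair1.
have h z : sp_pair s 0 z \o sp_pair s 0 (- z) = id.
  by rewrite sp_pair_comp addr0 (F0r Fb) subrr addr0 sp_pair0.
apply: (subgroup_gen_inv (ET_sp_pair1 s 0)) => u.
  by have := congr1 (@^~ u) (h (-1)); rewrite opprK.
exact: (congr1 (@^~ u) (h 1)).
Qed.

(** It remains to reach (0, z). The product of (-(q1 + q2), 0), (q1, 0) and (q2, 0) is (0, F(q1,
    q2)), and sums of such values exhaust the ring when they include 1. *)
Lemma ET_sp_pair s q z : value_ideal F 1 -> ET_sp F (sp_pair s q z).
Proof.
move=> v1; have -> : sp_pair s q z = sp_pair s q 0 \o sp_pair s 0 z.
  by rewrite sp_pair_comp addr0 (F0r Fb) add0r addr0.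
apply: subgroup_gen_comp; first exact: ET_sp_pair0.
rewrite -[z]mulr1; move: z.
apply: (v1 (fun y => forall z, ET_sp F (sp_pair s 0 (z * y)))) => [z|v w hv hw z|q1 q2 z].
- by rewrite mulr0; exact: ET_sp_pair0.
- have -> : sp_pair s 0 (z * (v + w)) = sp_pair s 0 (z * v) \o sp_pair s 0 (z * w).
    by rewrite sp_pair_comp addr0 (F0r Fb) addr0 mulrDr.
  exact: subgroup_gen_comp (hv z) (hw z).
- rewrite -(FZ Fb); set q3 := z *: q1.
  have -> : sp_pair s 0 (F q3 q2) =
      sp_pair s (- (q3 + q2)) 0 \o (sp_pair s q3 0 \o sp_pair s q2 0).
    by rewrite !sp_pair_comp addNr bilinN Falt oppr0 !add0r addr0.
  apply: subgroup_gen_comp; first exact: ET_sp_pair0.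
  by apply: subgroup_gen_comp; exact: ET_sp_pair0.
Qed.

End SymplecticTransvections.

Section OrthogonalTransvections.
Variables (A : comNzRingType) (M : lmodType A) (F : M -> M -> A) (hf : A).
Hypothesis Fb : bilin F.
Hypothesis Fsym : forall y z, F z y = 1 * F y z.
Hypothesis hf2 : hf + hf = 1.

Lemma orth_tvfE s q u : tvf F 1 hf s q u =
  let c : A := if s then u.2.1 else u.2.2 in
  let d := - F q u.1 - hf * F q q * c in
  (u.1 + c *: q, if s then (u.2.1, u.2.2 + d) else (u.2.1 + d, u.2.2)).
Proof.
case: u => y [b a]; rewrite /tvf (qf_pl _ Fb).
by case: s; apply: prod_ext; rewrite /= ?scaler0 ?subr0 ?mul1r //;
  apply: prod_ext; rewrite /= -?[_ *: _]/(_ * _); ring.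
Qed.

Lemma orth_tvf_comp s q q' : tvf F 1 hf s (q + q') = tvf F 1 hf s q \o tvf F 1 hf s q'.
Proof.
apply/funext => -[y [b a]]; rewrite /= !orth_tvfE.
case: s; rewrite /= !(bilinD Fb) !(bilinDr Fb) !(FZr Fb) (Fsym q q') scalerDr.
  apply: prod_ext; first by rewrite /= -addrA; congr (_ + _); rewrite addrC.
  apply: prod_ext => //=; apply: (half_ring hf2 (c := - (b * F q q'))); ring.
apply: prod_ext; first by rewrite /= -addrA; congr (_ + _); rewrite addrC.
by apply: prod_ext => //=; apply: (half_ring hf2 (c := - (a * F q q'))); ring.
Qed.

Lemma orth_lgf s z : lgf F 1 hf s z = id.
Proof.
by apply/funext => u; rewrite /lgf subrr mulr0 !mul0r scale0r addr0.
Qed.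

Lemma orth_transvection_tvf g : orth_transvection F g ->
  exists s q, F q q = 0 /\ g = tvf F 1 hf s (- q).
Proof.
case=> q qq; [exists false, q|exists true, q]; split=> //;
  apply/funext => -[y [b a]]; rewrite orth_tvfE /= !(bilinN Fb) (bilinNr Fb) qq;
  by rewrite oppr0 oppr0 !opprK mulr0 mul0r subr0 (Fsym q) mul1r scalerN.
Qed.

(** In the orthogonal case q |-> [tvf] is a homomorphism, so sums of isotropic vectors give products
    of the given transvections. *)
Lemma ET_orth_tvf s q : isotropic_span F q -> ET_orth F (tvf F 1 hf s q).
Proof.
move=> iq; apply: (iq (fun q => ET_orth F (tvf F 1 hf s q))) => [|u v hu hv|{iq}q qq].
- have -> : tvf F 1 hf s 0 = id; last exact: subgroup_gen_id.
  apply/funext => -[y [b a]]; rewrite orth_tvfE /= !(F0l Fb) mulr0 mul0r !oppr0 !addr0.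
  by rewrite scaler0 addr0; case: s.
- by rewrite orth_tvf_comp; exact: subgroup_gen_comp hu hv.
have nqq : F (- q) (- q) = 0 by rewrite (bilinN Fb) (bilinNr Fb) qq !oppr0.
case: s; apply: (@subgroup_gen_in _ (orth_transvection F)).
  have := OrthTransvection2 nqq; congr (orth_transvection F _).
  apply/funext => -[y [b a]]; rewrite orth_tvfE /= qq mulr0 mul0r subr0.
  by rewrite (bilinNr Fb) (Fsym q) mul1r scalerN opprK.
have := OrthTransvection1 nqq; congr (orth_transvection F _).
apply/funext => -[y [b a]]; rewrite orth_tvfE /= qq mulr0 mul0r subr0.
by rewrite (bilinNr Fb) (Fsym q) mul1r scalerN opprK.
Qed.

End OrthogonalTransvections.

Section BaseChangeValues.
Variables (R S : comNzRingType) (f : {rmorphism R -> S}) (M : lmodType R).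
Variables (F : M -> M -> R).
Hypothesis Fb : bilin F.
Local Notation F' := (@basechange_form R S f M F).

(** Needed for R -> R[X]: generation of R by the values on P passes to R[X], and likewise below for
    isotropic vectors. *)
Lemma bc_value_ideal a : value_ideal F a -> value_ideal F' (f a).
Proof.
move=> h Z Z0 ZD ZF; apply: (h (fun b => Z (f b))) => [|u v hu hv|q q'].
- by rewrite rmorph0.
- by rewrite rmorphD; apply: ZD.
- by rewrite -bcF_bc1.
Qed.

Lemma bc_isotropic_span y : isotropic_span F y -> isotropic_span F' (bc1 f y).
Proof.
move=> h Z Z0 ZD ZF; apply: (h (fun b => Z (bc1 f b))) => [|u v hu hv|q qq].
- by rewrite bc1_0.
- by rewrite bc1D; apply: ZD.
- by apply: ZF; rewrite bcF_bc1 // qq rmorph0.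
Qed.

End BaseChangeValues.

Section ElementaryComplement.
Variables (R : comNzRingType) (N : nat) (J : 'M[R]_N) (lam hf : R) (et : 'M[R]_N).
Variables (e e' : 'cV[R]_N).
Hypothesis Jet : J *m et = J.

Lemma uni_elem_compl (A : comNzRingType) (f : {rmorphism R -> A}) H :
  elem_group (uni_gen J lam hf et e e') f H ->
  H *m (1%:M - map_mx f et) = 1%:M - map_mx f et.
Proof.
have rkc u v : rk (map_mx f J) u v *m (1%:M - map_mx f et) = 0.
  rewrite /rk -!mulmxA mulmxBr mulmx1 -map_mxM Jet subrr.
  by rewrite !mulmx0.
move: (1%:M - _) rkc => C rkc; elim=> [|[s [j|]] t {}H _ IH]; first by rewrite mul1mx.
  rewrite -mulmxA IH /uni_gen /= /utv !mulmxBl mulmxDl -!scalemxAl !rkc.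
  by rewrite !scaler0 !subr0 addr0 mul1mx.
by rewrite -mulmxA IH /uni_gen /= /long mulmxDl -!scalemxAl rkc scaler0 addr0 mul1mx.
Qed.

End ElementaryComplement.

(** * The unitary theorem for an abstract set of transvections *)

Section UnitaryTheorem.
Variables (R : comNzRingType) (P : lmodType R) (n : nat).
Variables (x : 'I_n -> P) (phi : 'I_n -> P -> R).
Hypothesis db : dual_basis x phi.

Lemma hypQ_at0_coords u :
  coords (hypPhi phi) (hypQ_at0 u) =
  map_mx (horner_eval 0) (coords (hypPhi (fun i => bc_phi (@polyC R) (phi i))) u).
Proof.
apply/matrixP => i j; rewrite !mxE /hypPhi; case: (unlift _ _) => [k|] //=.
case: (unlift _ _) => [k'|] //=.
by rewrite polymod_at0_phi //; apply: (db_scalar db).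
Qed.

Lemma hypQ_at0_X j : hypQ_at0 (hypX (fun i => bc1 (@polyC R) (x i)) j) = hypX x j.
Proof.
rewrite /hypQ_at0 /hypX; case: (unlift _ _) => [k|] /=; last first.
  by rewrite (morph0 (@polymod_at0D _ _)) !hornerC.
case: (unlift _ _) => [k'|] /=; first by rewrite polymod_at0_cst !hornerC.
by rewrite (morph0 (@polymod_at0D _ _)) !hornerC.
Qed.

Lemma hypQ_cst_X j : hypQ_cst (hypX x j) = hypX (fun i => bc1 (@polyC R) (x i)) j.
Proof. by rewrite -bc_hypX. Qed.

Section Loc.
Variable p : prime_idealr R.
Let x2 i := bc1 (@polyC (localization p)) (bc1 (loc p) (x i)).
Let phi2 i := bc_phi (@polyC (localization p)) (bc_phi (loc p) (phi i)).

Lemma hypQ_loc_coords u :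
  coords (hypPhi phi2) (hypQ_loc p u) =
  map_mx (map_poly (loc p)) (coords (hypPhi (fun i => bc_phi (@polyC R) (phi i))) u).
Proof.
apply/matrixP => i j; rewrite !mxE /hypPhi; case: (unlift _ _) => [k|] //=.
case: (unlift _ _) => [k'|] //=.
by rewrite /phi2 polymod_loc_phi //; apply: (db_scalar db).
Qed.

Lemma hypQ_loc_X j : hypQ_loc p (hypX (fun i => bc1 (@polyC R) (x i)) j) = hypX x2 j.
Proof.
rewrite /hypQ_loc /hypX /poly_loc; case: (unlift _ _) => [k|] /=; last first.
  by rewrite (morph0 (@polymod_locD _ _ p)) rmorph1 rmorph0.
case: (unlift _ _) => [k'|] /=; first by rewrite polymod_loc_cst rmorph0.
by rewrite (morph0 (@polymod_locD _ _ p)) rmorph1 rmorph0.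
Qed.

End Loc.

Variables (F : P -> P -> R) (lam hf : R).
Hypothesis Fb : bilin F.
Hypothesis Fsym : forall y z, F z y = lam * F y z.
Hypothesis lam_pm : lam = 1 \/ lam = -1.
Hypothesis hf2 : hf + hf = 1.
Local Notation J := (hyp_J x F lam).
Local Notation et := (db_mx (hypX x) (hypPhi phi)).
Local Notation e := (coords (hypPhi phi) (pl P false)).
Local Notation e' := (coords (hypPhi phi) (pl P true)).
Hypothesis bases : forall (M : {pred R}) (hM : maximal_ideal M),
  uni_basis J lam et e e' (loc (prime_of_maximal hM)).

(** T and Tp are the given transvections over R[X] and R_p[X]. The two groups are compared in
    opposite directions: over R_p[X] transvections must be elementary matrices, while over R[X] the
    generating matrices must come from products of transvections. *)
Theorem unitary_case (T : (hypQ (polymod P) -> hypQ (polymod P)) -> Prop)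
    (Tp : forall p, (hypQ (polymod (locmod p P)) -> hypQ (polymod (locmod p P))) -> Prop) :
  (forall s j t, subgroup_gen T (tvf (polymod_form F) lam%:P hf%:P s
     (t *: (hypX (fun i => bc1 (@polyC R) (x i)) j).1))) ->
  (forall s t, subgroup_gen T (lgf (polymod_form F) lam%:P hf%:P s t)) ->
  (forall p g, Tp p g -> exists s q z,
     g = tvf (polymod_form (locmod_form (p := p) F)) (loc p lam)%:P (loc p hf)%:P s q
         \o lgf (polymod_form (locmod_form (p := p) F)) (loc p lam)%:P (loc p hf)%:P s z) ->
  forall alpha : {linear hypQ (polymod P) -> hypQ (polymod P)},
  bijective alpha -> hyp_at0 alpha =1 id ->
  (forall (M : {pred R}) (hM : maximal_ideal M),
     exists2 beta, subgroup_gen (Tp (prime_of_maximal hM)) beta &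
       hyp_localizes (p := prime_of_maximal hM) alpha beta) ->
  subgroup_gen T alpha.
Proof.
move=> Tt Tl Tpin alpha [alphaV aK aVK] a0 aloc.
pose x1 i := bc1 (@polyC R) (x i); pose phi1 i := bc_phi (@polyC R) (phi i).
have db1 : dual_basis x1 phi1 by apply: bc_dual_basis.
have dbH := hyp_dual_basis db; have dbQ := hyp_dual_basis db1.
have JT := hyp_JT x Fsym lam_pm; have Jet := hyp_Jet db lam Fb.
have ee := co_pl0 db lam Fb false; have e'e' := co_pl0 db lam Fb true.
have ee' : bf J e e' = 1 by rewrite (hyp_bf db lam Fb) (qf_plane lam Fb).
have aVl : linear alphaV := can2_linear aK aVK.
have al : linear alpha by move=> c u v; rewrite linearP.
pose am := endo_mx (hypX x1) (hypPhi phi1) alpha.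
pose amV := endo_mx (hypX x1) (hypPhi phi1) alphaV.
have amK : am *m amV = 1%:M by apply: (endo_mxK dbQ).
have am0 : map_mx (horner_eval 0) am = 1%:M.
  apply: (map_endo_mx dbQ hypQ_at0_coords hypQ_at0_X al) => [|j].
    by rewrite mul1mx.
  by rewrite mul1mx -(hypQ_cst_X j) -[hypQ_at0 _]/(hyp_at0 alpha (hypX x j)) a0.
have : elem_group (uni_gen J lam hf et e e') (polyC : R -> {poly R}) am.
  apply: (uni_local_global JT lam_pm hf2 (db_mx_idem dbH) Jet (db_mx_coords dbH _)
    (db_mx_coords dbH _) ee e'e' ee' amK am0 bases) => M hM.
  set p := prime_of_maximal hM.
  have [beta betaE betaP] := aloc M hM.
  pose x2 i := bc1 (@polyC (localization p)) (bc1 (loc p) (x i)).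
  pose phi2 i := bc_phi (@polyC (localization p)) (bc_phi (loc p) (phi i)).
  have dbp : dual_basis (fun i => bc1 (loc p) (x i)) (fun i => bc_phi (loc p) (phi i)).
    exact: bc_dual_basis.
  have db2 : dual_basis x2 phi2 by apply: bc_dual_basis.
  have Fbp := bcF_bilin (loc p) Fb.
  have Fsp := bcF_sym Fb Fsym (f := loc p).
  pose F2 := polymod_form (locmod_form (p := p) F).
  have Fb2 : bilin F2 := bcF_bilin (@polyC (localization p)) Fbp.
  have Fs2 : forall y z, F2 z y = (loc p lam)%:P * F2 y z.
    exact: (bcF_sym Fbp Fsp (f := @polyC (localization p))).
  have lp2 : (loc p lam)%:P = 1 \/ (loc p lam)%:P = -1.
    by case: (lam_pm) => ->; [left|right]; rewrite ?rmorphN1 ?rmorph1.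
  have hp2 : (loc p hf)%:P + (loc p hf)%:P = 1 by rewrite -!rmorphD hf2 !rmorph1.
  have fJ : map_mx (cloc p) J = hyp_J x2 F2 (loc p lam)%:P.
    by rewrite cloc_comp (map_hyp_J (loc p) x lam Fb) (map_hyp_J (@polyC _) _ _ Fbp).
  have fet : map_mx (cloc p) et = db_mx (hypX x2) (hypPhi phi2).
    by rewrite cloc_comp (map_hyp_et _ db) (map_hyp_et _ dbp).
  have fpl s : map_mx (cloc p) (coords (hypPhi phi) (pl P s)) =
      coords (hypPhi phi2) (pl (polymod (locmod p P)) s).
    by rewrite cloc_comp (map_co_pl _ db) (map_co_pl _ dbp).
  have flam : cloc p lam = (loc p lam)%:P by rewrite clocE.
  have fhf : cloc p hf = (loc p hf)%:P by rewrite clocE.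
  have ELinv H : elem_group (uni_gen J lam hf et e e') (cloc p) H ->
      exists2 H', elem_group (uni_gen J lam hf et e e') (cloc p) H' & H *m H' = 1%:M.
    apply: elem_inv => A f i.
      exact: (uni_gen_add JT lam_pm hf2 Jet ee e'e' ee').
    exact: uni_gen0.
  have Tin g : Tp p g -> exists2 H, elem_group (uni_gen J lam hf et e e') (cloc p) H &
      forall u, coords (hypPhi phi2) (g u) = H *m coords (hypPhi phi2) u.
    move=> /Tpin[s [q [z ->]]].
    exists (utv (hyp_J x2 F2 (loc p lam)%:P) (loc p lam)%:P (loc p hf)%:P
        (coords (hypPhi phi2) (pl _ s)) (coords (hypPhi phi2) (q, (0, 0))) *m
      long (hyp_J x2 F2 (loc p lam)%:P) (loc p lam)%:P (loc p hf)%:P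
        (coords (hypPhi phi2) (pl _ s)) z) => [|u].
      apply: elem_mul.
        exact: (utv_elem db2 Fb2 Fs2 lp2 hp2 fJ fet flam fhf (fpl false) (fpl true)).
      exact: (long_elem _ fJ flam fhf (fpl false) (fpl true)).
    by rewrite /= (tvf_coords db2 _ _ Fb2) (lgf_coords db2 _ _ Fb2) mulmxA.
  have [H HE eH] := uni_ET_elem ELinv Tin betaE.
  suff -> : map_mx (map_poly (loc p)) am = H by [].
  apply: (map_endo_mx dbQ (hypQ_loc_coords p) (hypQ_loc_X p) al) => [|j].
    by have := uni_elem_compl Jet HE; rewrite fet.
  by rewrite -eH -(hypQ_loc_X p) betaP.
have Fb1 : bilin (polymod_form F) := bcF_bilin (@polyC R) Fb.
have fJ : map_mx polyC J = hyp_J x1 (polymod_form F) lam%:P by rewrite -map_hyp_J.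
have fet : map_mx polyC et = db_mx (hypX x1) (hypPhi phi1) by rewrite (map_hyp_et _ db).
have fpl s : map_mx polyC (coords (hypPhi phi) (pl P s)) =
  coords (hypPhi phi1) (pl (polymod P) s) by rewrite (map_co_pl _ db).
have lp1 : lam%:P = 1 \/ lam%:P = -1.
  by case: (lam_pm) => ->; [left|right]; rewrite ?rmorphN1 ?rmorph1.
move=> /(uni_elem_ET db1 Fb1 lp1 fJ fet _ _ (fpl false) (fpl true) Tt Tl)[] // g gE eg.
suff -> : (alpha : hypQ _ -> hypQ _) = g by [].
by apply/funext => u; apply: (coords_inj dbQ); rewrite eg (endo_mx_coords dbQ).
Qed.

End UnitaryTheorem.

Section FormIdentification.
Variables (R : comNzRingType) (P : lmodType R).

Lemma sp_form_qf (F : P -> P -> R) : sp_form F = qf F (-1).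
Proof.
apply/funext => -[y [b a]]; apply/funext => -[z [d c]].
by rewrite /qf /= mulN1r.
Qed.

Lemma orth_form_qf (F : P -> P -> R) : orth_form F = qf F 1.
Proof.
apply/funext => -[y [b a]]; apply/funext => -[z [d c]].
by rewrite /qf /= mul1r.
Qed.

Lemma invertible2_half : invertible2 R -> exists hf : R, hf + hf = 1.
Proof. by move=> [c c2]; exists c; rewrite -mulr2n -mulr_natl. Qed.

Variables (n : nat) (x : 'I_n -> P) (phi : 'I_n -> P -> R).
Hypothesis db : dual_basis x phi.
Variables (F : P -> P -> R).
Hypothesis Fb : bilin F.

Lemma symplectic_case : invertible2 R -> (forall q, F q q = 0) ->
  (exists2 m : nat, (3 <= m)%N & locally_hyperbolic_sp m (sp_form F)) ->
  forall alpha : {linear hypQ (polymod P) -> hypQ (polymod P)},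
  bijective alpha -> hyp_at0 alpha =1 id ->
  (forall (M : {pred R}) (hM : maximal_ideal M),
     exists2 beta, ET_sp (polymod_form (locmod_form (p := prime_of_maximal hM) F)) beta &
       hyp_localizes (p := prime_of_maximal hM) alpha beta) ->
  ET_sp (polymod_form F) alpha.
Proof.
move=> /invertible2_half[hf hf2] Falt [m m3 lh] alpha abij a0 aloc.
have Fsk := alternating_skew Fb Falt.
have lam_pm : (-1 : R) = 1 \/ (-1 : R) = -1 by right.
have bases (M : {pred R}) (hM : maximal_ideal M) :
    uni_basis (hyp_J x F (-1)) (-1) (db_mx (hypX x) (hypPhi phi))
      (coords (hypPhi phi) (pl P false)) (coords (hypPhi phi) (pl P true))
      (loc (prime_of_maximal hM)).
  apply: (hyperbolic_uni_basis (p := prime_of_maximal hM) db Fb Fsk lam_pm hf2 m3).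
  have := lh M hM; rewrite sp_form_qf; congr isometric.
  apply/funext => u; apply/funext => v.
  by rewrite /hyperbolic_sp /hyperbolic_form rmorphN1 mulN1r.
(* Base change is known to preserve skew-symmetry; alternation follows from it by means of 1/2. *)
have bcalt (A B : comNzRingType) (f : {rmorphism A -> B}) (N : lmodType A)
    (G : N -> N -> A) (h : A) : bilin G -> (forall q, G q q = 0) -> h + h = 1 ->
    forall u, @basechange_form A B f N G u u = 0.
  move=> Gb Galt h2 u; have := bcF_sym Gb (alternating_skew Gb Galt) (f := f) u u.
  rewrite rmorphN1 mulN1r => /eqP; rewrite -addr_eq0 => /eqP e.
  rewrite -[LHS]mul1r -(rmorph1 f) -h2 rmorphD mulrDl -mulrDr e mulr0 //.
have lamC (A : comNzRingType) : (-1)%:P = -1 :> {poly A} by rewrite rmorphN1.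
have Fb1 : bilin (polymod_form F) := bcF_bilin (@polyC R) Fb.
have alt1 u : polymod_form F u u = 0 by exact: bcalt hf2 u.
have hf21 : hf%:P + hf%:P = 1 :> {poly R} by rewrite -rmorphD hf2 rmorph1.
have v1 : value_ideal (polymod_form F) 1.
  by have := bc_value_ideal (f := @polyC R) Fb
    (value_ideal1 db Fb lam_pm bases); rewrite rmorph1.
apply: (@unitary_case _ _ _ x phi db F (-1) hf Fb Fsk lam_pm hf2 bases
  (sp_transvection (polymod_form F))
  (fun p => sp_transvection (polymod_form (locmod_form (p := p) F)))
  _ _ _ alpha abij a0 aloc) => [s j t|s t|p g].
- have -> : tvf (polymod_form F) (-1)%:P hf%:P s (t *: (hypX (fun i => bc1 (@polyC R) (x i)) j).1) =
      sp_pair (polymod_form F) s (t *: (hypX (fun i => bc1 (@polyC R) (x i)) j).1) 0.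
    rewrite lamC (sp_pair_tvf Fb1 alt1 hf21); apply/funext => u /=.
    by rewrite /lgf mulr0 mul0r scale0r addr0.
  exact: (ET_sp_pair Fb1 alt1 _ _ _ v1).
- have -> : lgf (polymod_form F) (-1)%:P hf%:P s t = sp_pair (polymod_form F) s 0 t.
    rewrite lamC (sp_pair_tvf Fb1 alt1 hf21); apply/funext => u /=.
    by rewrite /tvf !(F0l Fb1) !mulr0 !mul0r !scale0r !subr0 scaler0 addr0.
  exact: (ET_sp_pair Fb1 alt1 _ _ _ v1).
have Fbp := bcF_bilin (loc p) Fb.
have altp u : locmod_form (p := p) F u u = 0 by exact: bcalt hf2 u.
have hfp : loc p hf + loc p hf = 1 by rewrite -rmorphD hf2 rmorph1.
have alt2 u : polymod_form (locmod_form (p := p) F) u u = 0 by exact: bcalt hfp u.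
have Fb2 := bcF_bilin (@polyC (localization p)) Fbp.
have hf22 : (loc p hf)%:P + (loc p hf)%:P = 1 by rewrite -rmorphD hfp rmorph1.
move=> /(sp_transvection_pair Fb2 alt2)[s [q [z ->]]]; exists s, q, z.
by rewrite rmorphN1 lamC (sp_pair_tvf Fb2 alt2 hf22).
Qed.

Lemma orthogonal_case : invertible2 R -> (forall q q', F q q' = F q' q) ->
  (exists2 m : nat, (3 <= m)%N & locally_hyperbolic_orth m (orth_form F)) ->
  forall alpha : {linear hypQ (polymod P) -> hypQ (polymod P)},
  bijective alpha -> hyp_at0 alpha =1 id ->
  (forall (M : {pred R}) (hM : maximal_ideal M),
     exists2 beta, ET_orth (polymod_form (locmod_form (p := prime_of_maximal hM) F)) beta &
       hyp_localizes (p := prime_of_maximal hM) alpha beta) ->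
  ET_orth (polymod_form F) alpha.
Proof.
move=> /invertible2_half[hf hf2] FC [m m3 lh] alpha abij a0 aloc.
have Fsy y z : F z y = 1 * F y z by rewrite mul1r FC.
have lam_pm : (1 : R) = 1 \/ (1 : R) = -1 by left.
have bases (M : {pred R}) (hM : maximal_ideal M) :
    uni_basis (hyp_J x F 1) 1 (db_mx (hypX x) (hypPhi phi))
      (coords (hypPhi phi) (pl P false)) (coords (hypPhi phi) (pl P true))
      (loc (prime_of_maximal hM)).
  apply: (hyperbolic_uni_basis (p := prime_of_maximal hM) db Fb Fsy lam_pm hf2 m3).
  have := lh M hM; rewrite orth_form_qf; congr isometric.
  apply/funext => u; apply/funext => v.
  by rewrite /hyperbolic_orth /hyperbolic_form rmorph1 mul1r.
have sym1 (A B : comNzRingType) (f : {rmorphism A -> B}) (N : lmodType A)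
    (G : N -> N -> A) : bilin G -> (forall y z, G z y = 1 * G y z) ->
    forall y z, @basechange_form A B f N G z y = 1 * @basechange_form A B f N G y z.
  by move=> Gb Gs y z; rewrite (bcF_sym Gb Gs) rmorph1.
have lamC (A : comNzRingType) : 1%:P = 1 :> {poly A} by rewrite rmorph1.
have Fb1 : bilin (polymod_form F) := bcF_bilin (@polyC R) Fb.
have hf21 : hf%:P + hf%:P = 1 :> {poly R} by rewrite -rmorphD hf2 rmorph1.
apply: (@unitary_case _ _ _ x phi db F 1 hf Fb Fsy lam_pm hf2 bases
  (orth_transvection (polymod_form F))
  (fun p => orth_transvection (polymod_form (locmod_form (p := p) F)))
  _ _ _ alpha abij a0 aloc) => [s j t|s t|p g].
- rewrite lamC; apply: (ET_orth_tvf Fb1 (sym1 _ _ _ _ _ Fb Fsy) hf21).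
  apply: (isotropic_spanZ Fb1); rewrite -bc_hypX.
  exact: (bc_isotropic_span (f := @polyC R) Fb (isotropic_span_gen db Fb lam_pm bases j)).
- by rewrite lamC orth_lgf; exact: subgroup_gen_id.
have Fbp := bcF_bilin (loc p) Fb.
have Fsp := sym1 _ _ (loc p) _ _ Fb Fsy.
have Fb2 := bcF_bilin (@polyC (localization p)) Fbp.
have Fs2 := sym1 _ _ (@polyC (localization p)) _ _ Fbp Fsp.
move=> /(orth_transvection_tvf (loc p hf)%:P Fb2 Fs2)[s [q [_ ->]]].
by exists s, (- q), 0; rewrite rmorph1 lamC orth_lgf.
Qed.

End FormIdentification.

Theorem theorem1 (R : comNzRingType) (P : lmodType R)
    (fgP : finitely_generated P) (projP : projective P) :
  [/\ (* linear case *)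
      (exists2 n : nat, (3 <= n)%N & constant_rank n (linQ P)) ->
      forall alpha : {linear linQ (polymod P) -> linQ (polymod P)},
        bijective alpha ->
        lin_at0 alpha =1 id ->
        (forall (M : {pred R}) (hM : maximal_ideal M),
           exists2 beta, ET_lin beta &
             lin_localizes (p := prime_of_maximal hM) alpha beta) ->
        ET_lin alpha,
      (* symplectic case *)
      invertible2 R ->
      forall form : {biscalar P},
        nonsingular form ->
        (forall q, form q q = 0) ->
        (exists2 m : nat, (3 <= m)%N &
           locally_hyperbolic_sp m (sp_form form)) ->
      forall alpha : {linear hypQ (polymod P) -> hypQ (polymod P)},
        is_isometry (sp_form (polymod_form form)) (sp_form (polymod_form form))
          alpha ->
        hyp_at0 alpha =1 id ->
        (forall (M : {pred R}) (hM : maximal_ideal M),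
           exists2 beta,
             ET_sp (polymod_form
               (locmod_form (p := prime_of_maximal hM) form)) beta &
             hyp_localizes (p := prime_of_maximal hM) alpha beta) ->
        ET_sp (polymod_form form) alpha
    & (* orthogonal case *)
      invertible2 R ->
      forall form : {biscalar P},
        nonsingular form ->
        (forall q q', form q q' = form q' q) ->
        (exists2 m : nat, (3 <= m)%N &
           locally_hyperbolic_orth m (orth_form form)) ->
      forall alpha : {linear hypQ (polymod P) -> hypQ (polymod P)},
        is_isometry (orth_form (polymod_form form)) (orth_form (polymod_form form))
          alpha ->
        hyp_at0 alpha =1 id ->
        (forall (M : {pred R}) (hM : maximal_ideal M),
           exists2 beta,
             ET_orth (polymod_form
               (locmod_form (p := prime_of_maximal hM) form)) beta &
             hyp_localizes (p := prime_of_maximal hM) alpha beta) ->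
        ET_orth (polymod_form form) alpha].
Proof.
have [n [x [phi db]]] := projective_dual_basis fgP projP.
split=> [rk|two form _ alt lh alpha [abij _]|two form _ sym lh alpha [abij _]].
- exact: (linear_case db).
- exact: (symplectic_case db (biscalar_bilin form) two alt lh abij).
- exact: (orthogonal_case db (biscalar_bilin form) two sym lh abij).
Qed.
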